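(* Let $(M^m,g)$ be a compact Riemannian manifold without boundary, let $(N^n,h)$ be a Riemannian manifold of non-positive sectional curvature, and let $f:M\to(0,\infty)$ be a smooth positive function. Then every bi-$f$-harmonic map $\phi:(M^m,g)\to(N^n,h)$ is $f$-harmonic, i.e. satisfies $\tau_f(\phi)=0$.
   Context: All manifolds, maps and functions are smooth. For a smooth map $\phi:(M,g)\to(N,h)$ between Riemannian manifolds, $\nabla^\phi$ is the connection on $\phi^{-1}TN$ induced by the Levi-Civita connection of $N$, and $R^N(X,Y)Z=[\nabla^N_X,\nabla^N_Y]Z-\nabla^N_{[X,Y]}Z$. The tension field is $\tau(\phi)=\mathrm{Tr}_g\nabla d\phi$. The Jacobi operator on sections $X$ of $\phi^{-1}TN$ is $J^\phi(X)=-\sum_i\{\nabla^\phi_{e_i}\nabla^\phi_{e_i}X-\nabla^\phi_{\nabla^M_{e_i}e_i}X-R^N(d\phi(e_i),X)d\phi(e_i)\}$ for a local orthonormal frame $(e_i)$ of $M$. For a positive function $f$ on $M$, the $f$-tension field is $\tau_f(\phi)=f\tau(\phi)+d\phi(\mathrm{grad} f)$; $\phi$ is $f$-harmonic if $\tau_f(\phi)=0$, and bi-$f$-harmonic if $\tau_{2,f}(\phi):=-fJ^\phi(\tau_f(\phi))+\nabla^\phi_{\mathrm{grad} f}\tau_f(\phi)=0$ (the Euler-Lagrange equation of $\frac12\int|\tau_f(\phi)|^2v_g$). *)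

(* Defs.v *)
From HB Require Import structures.
From mathcomp Require Import all_boot all_order all_algebra.
From mathcomp Require Import all_classical all_reals all_analysis.

Set Implicit Arguments.
Unset Strict Implicit.
Unset Printing Implicit Defensive.

Import Order.TTheory GRing.Theory Num.Theory numFieldNormedType.Exports.
Local Open Scope classical_set_scope.
Local Open Scope ring_scope.

Definition basis_vec (R : realType) (m : nat) (i : 'I_m) : 'rV[R]_m :=
  delta_mx 0 i.

Fixpoint Ck_on (R : realType) (m : nat) (W : normedModType R) (k : nat)
    (U : set 'rV[R]_m) (F : 'rV[R]_m -> W) : Prop :=
  (forall x, U x -> {for x, continuous F}) /\
  match k with
  | 0%N => True
  | k'.+1 => forall i : 'I_m,
      (forall x, U x -> derivable F x (basis_vec R i)) /\
      Ck_on k' U ('D_(basis_vec R i) F)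
  end.

(* Only meaningful for open [U]: the functions are total, and their values
   outside [U] are irrelevant. *)
Definition smooth_on (R : realType) (m : nat) (W : normedModType R)
    (U : set 'rV[R]_m) (F : 'rV[R]_m -> W) : Prop :=
  forall k, Ck_on k U F.

(* [chart_map] and [chart_inv] are total functions, with junk values outside
   [chart_dom] and its image. *)
Record chart (R : realType) (m : nat) (T : topologicalType) := Chart {
  chart_dom : set T ;
  chart_map : T -> 'rV[R]_m ;
  chart_inv : 'rV[R]_m -> T ;
  chart_dom_open : open chart_dom ;
  chart_img_open : open (chart_map @` chart_dom) ;
  chart_mapK : forall p, chart_dom p -> chart_inv (chart_map p) = p ;
  chart_map_continuous :
    forall p, chart_dom p -> {for p, continuous chart_map} ;
  chart_inv_continuous :
    forall x, (chart_map @` chart_dom) x -> {for x, continuous chart_inv}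
}.

Definition chart_img (R : realType) (m : nat) (T : topologicalType)
    (a : chart R m T) : set 'rV[R]_m :=
  chart_map a @` chart_dom a.

(* Second countable Hausdorff, without boundary; not assumed connected.
   The atlas need not be maximal. *)
Record smoothManifold (R : realType) (m : nat) := SmoothManifold {
  space :> topologicalType ;
  space_hausdorff : hausdorff_space space ;
  space_second_countable : @second_countable space ;
  atlas_index : Type ;
  atlas : atlas_index -> chart R m space ;
  atlas_cover : forall p : space, exists a, chart_dom (atlas a) p ;
  atlas_compatible : forall a b,
    smooth_on
      (chart_map (atlas a) @` (chart_dom (atlas a) `&` chart_dom (atlas b)))
      (chart_map (atlas b) \o chart_inv (atlas a))
}.

Definition inner (R : realType) (m : nat) (G : 'M[R]_m) (u v : 'rV[R]_m) : R :=
  (u *m G *m v^T) 0 0.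

(* [metric a x] is the Gram matrix of the coordinate frame of the chart [a] at
   the point of coordinates [x]; [metric_change] says that these matrices
   represent one and the same tensor, the differential of the change of
   coordinates being written as a directional derivative. *)
Record riemannianManifold (R : realType) (m : nat) := RiemannianManifold {
  manifold :> smoothManifold R m ;
  metric : atlas_index manifold -> 'rV[R]_m -> 'M[R]_m ;
  metric_smooth : forall a, smooth_on (chart_img (atlas a)) (metric a) ;
  metric_sym : forall a x, chart_img (atlas a) x -> (metric a x)^T = metric a x ;
  metric_pos : forall a x, chart_img (atlas a) x ->
    forall u, u != 0 -> 0 < inner (metric a x) u u ;
  metric_change : forall a b p,
    chart_dom (atlas a) p -> chart_dom (atlas b) p ->
    let x := chart_map (atlas a) p in
    let theta := chart_map (atlas b) \o chart_inv (atlas a) in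
    forall u v : 'rV[R]_m,
      inner (metric a x) u v =
      inner (metric b (theta x)) ('D_u theta x) ('D_v theta x)
}.

Section LocalGeometry.
Variables (R : realType) (m : nat) (g : 'rV[R]_m -> 'M[R]_m).
Implicit Types (x u v w : 'rV[R]_m) (X Y Z : 'rV[R]_m -> 'rV[R]_m).

Definition christoffel (k i j : 'I_m) x : R :=
  2^-1 * \sum_(l < m) invmx (g x) k l *
    ('D_(basis_vec R i) (fun y => g y j l) x
     + 'D_(basis_vec R j) (fun y => g y i l) x
     - 'D_(basis_vec R l) (fun y => g y i j) x).

Definition christoffel_form x u v : 'rV[R]_m :=
  \row_k \sum_(i < m) \sum_(j < m) christoffel k i j x * u 0 i * v 0 j.

Definition levi_civita X Y : 'rV[R]_m -> 'rV[R]_m :=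
  fun x => 'D_(X x) Y x + christoffel_form x (X x) (Y x).

Definition lie_bracket X Y : 'rV[R]_m -> 'rV[R]_m :=
  fun x => 'D_(X x) Y x - 'D_(Y x) X x.

Definition curvature X Y Z : 'rV[R]_m -> 'rV[R]_m :=
  fun x => levi_civita X (levi_civita Y Z) x - levi_civita Y (levi_civita X Z) x
           - levi_civita (lie_bracket X Y) Z x.

(* By tensoriality the curvature may be evaluated on any extension of the
   vectors to vector fields; we take the ones with constant coefficients. *)
Definition riemann x u v w : 'rV[R]_m := curvature (cst u) (cst v) (cst w) x.

(* The sign matches R(X,Y)Z = [nabla_X,nabla_Y]Z - nabla_[X,Y]Z: round spheres
   have positive sectional curvature. *)
Definition sectional x u v : R :=
  inner (g x) (riemann x u v v) u /
  (inner (g x) u u * inner (g x) v v - inner (g x) u v ^+ 2).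

Definition gradient (f : 'rV[R]_m -> R) : 'rV[R]_m -> 'rV[R]_m :=
  fun x => (\row_l 'D_(basis_vec R l) f x) *m invmx (g x).

Definition orthonormal_frame (U : set 'rV[R]_m)
    (e : 'I_m -> 'rV[R]_m -> 'rV[R]_m) : Prop :=
  (forall i, smooth_on U (e i)) /\
  (forall x, U x -> forall i j, inner (g x) (e i x) (e j x) = (i == j)%:R).

(* Trace with respect to g of a bilinear form on the tangent space at x. *)
Definition metric_trace (n : nat) x
    (B : 'rV[R]_m -> 'rV[R]_m -> 'rV[R]_n) : 'rV[R]_n :=
  \sum_(i < m) \sum_(j < m)
    invmx (g x) i j *: B (basis_vec R i) (basis_vec R j).

End LocalGeometry.

(* Everything is expressed in a chart of the source (metric g) and a chart of the
   target (metric h): F is the map in these coordinates, f the weight, and a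
   section of the pulled-back tangent bundle is the function V of its
   components. *)
Section MapGeometry.
Variables (R : realType) (m n : nat).
Variables (g : 'rV[R]_m -> 'M[R]_m) (h : 'rV[R]_n -> 'M[R]_n).
Variables (F : 'rV[R]_m -> 'rV[R]_n) (f : 'rV[R]_m -> R).
Implicit Types (X Y : 'rV[R]_m -> 'rV[R]_m) (V : 'rV[R]_m -> 'rV[R]_n).

Definition pushforward X : 'rV[R]_m -> 'rV[R]_n := fun x => 'D_(X x) F x.

Definition pullback_connection X V : 'rV[R]_m -> 'rV[R]_n :=
  fun x => 'D_(X x) V x + christoffel_form h (F x) (pushforward X x) (V x).

Definition second_fundamental_form X Y : 'rV[R]_m -> 'rV[R]_n :=
  fun x => pullback_connection X (pushforward Y) x
           - pushforward (levi_civita g X Y) x.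

Definition tension : 'rV[R]_m -> 'rV[R]_n :=
  fun x => metric_trace g x
    (fun u v => second_fundamental_form (cst u) (cst v) x).

Definition f_tension : 'rV[R]_m -> 'rV[R]_n :=
  fun x => f x *: tension x + pushforward (gradient g f) x.

Definition jacobi (e : 'I_m -> 'rV[R]_m -> 'rV[R]_m) V : 'rV[R]_m -> 'rV[R]_n :=
  fun x => - \sum_(i < m)
    (pullback_connection (e i) (pullback_connection (e i) V) x
     - pullback_connection (levi_civita g (e i) (e i)) V x
     - riemann h (F x) (pushforward (e i) x) (V x) (pushforward (e i) x)).

Definition bi_f_tension (e : 'I_m -> 'rV[R]_m -> 'rV[R]_m) :
    'rV[R]_m -> 'rV[R]_n :=
  fun x => - (f x *: jacobi e f_tension x)
           + pullback_connection (gradient g f) f_tension x.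

End MapGeometry.

Definition smooth_function (R : realType) (m : nat) (M : smoothManifold R m)
    (f : M -> R) : Prop :=
  forall a : atlas_index M,
    smooth_on (chart_img (atlas a)) (f \o chart_inv (atlas a)).

Section MapsBetweenManifolds.
Variables (R : realType) (m n : nat).

Definition local_dom (M : smoothManifold R m) (N : smoothManifold R n)
    (phi : M -> N) (a : atlas_index M) (b : atlas_index N) : set 'rV[R]_m :=
  chart_map (atlas a) @` (chart_dom (atlas a) `&` phi @^-1` chart_dom (atlas b)).

Definition local_map (M : smoothManifold R m) (N : smoothManifold R n)
    (phi : M -> N) (a : atlas_index M) (b : atlas_index N) :
    'rV[R]_m -> 'rV[R]_n :=
  chart_map (atlas b) \o phi \o chart_inv (atlas a).

Definition smooth_map (M : smoothManifold R m) (N : smoothManifold R n)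
    (phi : M -> N) : Prop :=
  continuous phi /\
  forall a b, smooth_on (local_dom phi a b) (local_map phi a b).

Definition nonpositive_curvature (N : riemannianManifold R n) : Prop :=
  forall (b : atlas_index N) y, chart_img (atlas b) y ->
  forall u v : 'rV[R]_n, row_free (col_mx u v) ->
    sectional (metric b) y u v <= 0.

Definition f_harmonic (M : riemannianManifold R m) (N : riemannianManifold R n)
    (f : M -> R) (phi : M -> N) : Prop :=
  forall (a : atlas_index M) (b : atlas_index N) x, local_dom phi a b x ->
    f_tension (metric a) (metric b) (local_map phi a b)
      (f \o chart_inv (atlas a)) x = 0.

(* The Jacobi operator does not depend on the orthonormal frame, and smooth
   orthonormal frames exist near every point: the equation is required in each
   of them. *)
Definition bi_f_harmonic (M : riemannianManifold R m)
    (N : riemannianManifold R n) (f : M -> R) (phi : M -> N) : Prop :=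
  forall (a : atlas_index M) (b : atlas_index N) (U : set 'rV[R]_m)
    (e : 'I_m -> 'rV[R]_m -> 'rV[R]_m),
    open U -> U `<=` local_dom phi a b -> orthonormal_frame (metric a) U e ->
    forall x, U x ->
      bi_f_tension (metric a) (metric b) (local_map phi a b)
        (f \o chart_inv (atlas a)) e x = 0.

End MapsBetweenManifolds.

(* Main.v *)
(** Write T for the f-tension field of [phi] and let (e_i) be a local orthonormal
    frame. Pairing the bi-f-harmonic equation with T gives the Bochner formula
      div (f grad |T|^2) = 2 f (sum_i |nabla_{e_i} T|^2 + sum_i <R(dphi e_i, T) dphi e_i, T>),
    whose right-hand side is nonnegative because N is nonpositively curved. By the
    divergence theorem it vanishes, so T is parallel. Then the divergence of the
    field dual to w |-> f <dphi w, T> is |T|^2, and a second use of the divergence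
    theorem gives T = 0.

    Only one consequence of the divergence theorem is needed: on a compact manifold
    a divergence that is everywhere nonnegative vanishes. It is obtained without
    integration. In a chart, integrals are replaced by averages over the lattice
    (1/p^2) Z^m of functions weighted by the inverse of the mass, seen from the
    lattice, of a bump of radius of order 1/p for the metric; this weight is
    asymptotically independent of the chart, and a discrete divergence sums to 0. *)

From HB Require Import structures.
From mathcomp Require Import all_boot all_order all_algebra perm.
From mathcomp Require Import all_classical all_reals all_analysis.
From mathcomp Require Import ring lra zify.
Require Import Defs.

Set Implicit Arguments.
Unset Strict Implicit.
Unset Printing Implicit Defensive.

Import Order.TTheory GRing.Theory Num.Theory numFieldNormedType.Exports.
Local Open Scope classical_set_scope.
Local Open Scope ring_scope.

(** * Functions of class C^k *)

(** The integral of bump (Q(z, z)) over R^m is a constant times det(Q)^(-1/2), so that the inverse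
    of its Riemann sum [lmass] imitates the density sqrt(det g). Neither that constant nor a change
    of variables formula is needed. The logarithmic derivative of the mass comes from a telescoping
    sum over the lattice. Two charts are compared through a double sum over pairs (x, y) of points
    of their lattices, with a bump of radius of order 1/p in y - theta(x): summed over y first, the
    normalized bump contributes about 1 and leaves the sum in the first chart; summed over x first,
    it leaves the sum in the second.

    Two scales are needed. A bump must span many lattice steps, about p, for its mass to be accurate
    up to 1/p; and a discrete divergence divides by the step 1/p^2, so that the error made at each
    step has to be small compared with 1/p^2.

    The second divergence is needed because a parallel T has locally constant norm and nothing more
    can be drawn from the first. Both times the divergence is nonnegative, and a lower bound for
    lattice sums, uniform in p, does the work of the positivity of the integral. *)

Lemma open_near (T : topologicalType) (U : set T) (P : T -> Prop) (x : T) :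
  open U -> U x -> (forall y : T, U y -> P y) -> \forall y \near x, P y.
Proof. by move=> oU Ux UP; apply: filterS (open_nbhs_nbhs (conj oU Ux)) => y /UP. Qed.

Lemma near_forall (T : topologicalType) (I : finType) (P : I -> T -> Prop) (x : T) :
  (forall i, \forall y \near x, P i y) -> \forall y \near x, forall i, P i y.
Proof. by move=> H; apply: filter_forall. Qed.

Lemma near_and (T : topologicalType) (P Q : T -> Prop) (x : T) :
  (\forall y \near x, P y) -> (\forall y \near x, Q y) ->
  \forall y \near x, P y /\ Q y.
Proof. by move=> H1 H2; apply: filterI. Qed.

Lemma near_eq_continuous (T T' : topologicalType) (F G : T -> T') (x : T) :
  (\near x, F x = G x) -> {for x, continuous F} -> {for x, continuous G}.
Proof.
move=> FG; rewrite /prop_for /continuous_at -(nbhs_singleton FG) => cF.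
apply: cvg_trans cF; apply: near_eq_cvg; exact: FG.
Qed.

Lemma coord_continuousE (R : realType) (T : topologicalType) (p q : nat)
    (F : T -> 'M[R]_(p, q)) (x : T) :
  {for x, continuous F} <-> forall i j, {for x, continuous (fun y => F y i j)}.
Proof.
split=> cF.
  move=> i j; rewrite /prop_for /continuous_at.
  apply: (@cvg_comp _ _ _ F (fun M : 'M[R]_(p, q) => M i j) _ (nbhs (F x))) => //.
  exact: coord_continuous.
rewrite /prop_for /continuous_at; apply: (iffRL (@cvgrPdist_le R _ _ (nbhs x) _ F (F x))) => e e0.
have N : \forall y \near x, forall ij : 'I_p * 'I_q, `|F x ij.1 ij.2 - F y ij.1 ij.2| <= e.
  by apply: filter_forall => -[k l]; exact: ((cvgrPdist_le _ _).1 (cF k l)).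
apply: filterS N => y N.
rewrite /Num.Def.normr/= mx_normrE (bigmax_le _ (ltW e0))//= => -[i j] _.
by rewrite !mxE; exact: (N (i, j)).
Qed.

Section Calculus.
Variables (R : realType) (m : nat).
Implicit Types (U : set 'rV[R]_m) (x y v : 'rV[R]_m).

Notation "\d_ i u" := ('D_(basis_vec R i) u) (at level 10, i at level 2, u at level 9).

Lemma Ck_on_continuous (W : normedModType R) k U (F : 'rV[R]_m -> W) :
  Ck_on k U F -> forall x, U x -> {for x, continuous F}.
Proof. by case: k => [|k] []. Qed.

Lemma Ck_on_eq (W : normedModType R) k U (F G : 'rV[R]_m -> W) :
  open U -> (forall x, U x -> F x = G x) -> Ck_on k U F -> Ck_on k U G.
Proof.
move=> oU; elim: k F G => [|k IH] F G FG /= [cF dF].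
  by split => // x Ux; apply: near_eq_continuous (cF x Ux); exact: open_near FG.
split; first by move=> x Ux; apply: near_eq_continuous (cF x Ux); exact: open_near FG.
move=> i; have [dFi CFi] := dF i; split.
  by move=> x Ux; apply: near_eq_derivable (dFi x Ux); exact: open_near FG.
by apply: IH CFi => x Ux; apply: near_eq_derive; exact: open_near FG.
Qed.

Lemma Ck_on_subset (W : normedModType R) k U U' (F : 'rV[R]_m -> W) :
  U' `<=` U -> Ck_on k U F -> Ck_on k U' F.
Proof.
move=> UU'; elim: k F => [|k IH] F /= [cF dF]; split => //.
- by move=> x /UU'; exact: cF.
- by move=> x /UU'; exact: cF.
by move=> i; have [dFi CFi] := dF i; split; [move=> x /UU'; exact: dFi|exact: IH].
Qed.

Lemma Ck_onW (W : normedModType R) k U (F : 'rV[R]_m -> W) :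
  Ck_on k.+1 U F -> Ck_on k U F.
Proof.
elim: k F => [|k IH] F [cF dF]; split => //.
by move=> i; have [dFi CFi] := dF i; split => //; exact: IH.
Qed.

Lemma Ck_on_partial (W : normedModType R) k U (F : 'rV[R]_m -> W) i :
  Ck_on k.+1 U F -> Ck_on k U (\d_ i F).
Proof. by case=> _ /(_ i)[]. Qed.

Lemma Ck_on_derivable (W : normedModType R) k U (F : 'rV[R]_m -> W) i x :
  Ck_on k.+1 U F -> U x -> derivable F x (basis_vec R i).
Proof. by case=> _ /(_ i)[dF _] /dF. Qed.

Lemma Ck_on_cst (W : normedModType R) k U (c : W) : Ck_on k U (cst c).
Proof.
elim: k c => [|k IH] c /=; split => //; try by move=> x _; exact: cst_continuous.
move=> i; split; first by move=> x _; exact: derivable_cst.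
have -> : 'D_(basis_vec R i) (cst c) = cst (0 : W); last exact: IH.
by apply/funext => x; exact: derive_cst.
Qed.

Lemma Ck_onD (W : normedModType R) k U (F G : 'rV[R]_m -> W) : open U ->
  Ck_on k U F -> Ck_on k U G -> Ck_on k U (fun x => F x + G x).
Proof.
move=> oU; elim: k F G => [|k IH] F G /= [cF dF] [cG dG]; split => //.
- by move=> x Ux; apply: continuousD; [exact: cF|exact: cG].
- by move=> x Ux; apply: continuousD; [exact: cF|exact: cG].
move=> i; have [dFi CFi] := dF i; have [dGi CGi] := dG i; split.
  by move=> x Ux; apply: derivableD; [exact: dFi|exact: dGi].
apply: (@Ck_on_eq _ _ _ (fun x => \d_ i F x + \d_ i G x)) => //; last exact: IH.
by move=> x Ux; rewrite -deriveD //; [exact: dFi|exact: dGi].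
Qed.

Lemma Ck_onM k U (u w : 'rV[R]_m -> R) : open U ->
  Ck_on k U u -> Ck_on k U w -> Ck_on k U (fun x => u x * w x).
Proof.
move=> oU; elim: k u w => [|k IH] u w Cu Cw; split => //.
- by move=> x Ux; apply: continuousM; [exact: Ck_on_continuous Cu _ _|exact: Ck_on_continuous Cw _ _].
- by move=> x Ux; apply: continuousM; [exact: Ck_on_continuous Cu _ _|exact: Ck_on_continuous Cw _ _].
move=> i; split.
  by move=> x Ux; apply: derivableM; [exact: Ck_on_derivable Cu _|exact: Ck_on_derivable Cw _].
apply: (@Ck_on_eq _ _ _ (fun x => u x * \d_ i w x + w x * \d_ i u x)) => //.
  move=> x Ux; rewrite deriveM //;
    [exact: Ck_on_derivable Cu _|exact: Ck_on_derivable Cw _].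
by apply: Ck_onD => //; apply: IH;
  do ?[exact: Ck_on_partial|exact: Ck_onW].
Qed.

Lemma Ck_on_sum (W : normedModType R) k U (I : Type) (r : seq I) (P : pred I)
    (F : I -> 'rV[R]_m -> W) : open U ->
  (forall i, P i -> Ck_on k U (F i)) ->
  Ck_on k U (fun x => \sum_(i <- r | P i) F i x).
Proof.
move=> oU CF; elim: r => [|i r IH].
  apply: (@Ck_on_eq W _ _ (cst (0 : W))) => //; last exact: Ck_on_cst.
  by move=> x _; rewrite big_nil.
case Pi : (P i).
  apply: (@Ck_on_eq _ _ _ (fun x => F i x + \sum_(j <- r | P j) F j x)) => //.
    by move=> x _; rewrite big_cons Pi.
  by apply: Ck_onD => //; exact: CF.
by apply: Ck_on_eq IH => // x _; rewrite big_cons Pi.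
Qed.

Lemma Ck_on_prod k U (I : Type) (r : seq I) (P : pred I)
    (F : I -> 'rV[R]_m -> R) : open U ->
  (forall i, P i -> Ck_on k U (F i)) ->
  Ck_on k U (fun x => \prod_(i <- r | P i) F i x).
Proof.
move=> oU CF; elim: r => [|i r IH].
  apply: (@Ck_on_eq R _ _ (cst (1 : R))) => //; last exact: Ck_on_cst.
  by move=> x _; rewrite big_nil.
case Pi : (P i).
  apply: (@Ck_on_eq _ _ _ (fun x => F i x * \prod_(j <- r | P j) F j x)) => //.
    by move=> x _; rewrite big_cons Pi.
  by apply: Ck_onM => //; exact: CF.
by apply: Ck_on_eq IH => // x _; rewrite big_cons Pi.
Qed.

Lemma Ck_onN k U (u : 'rV[R]_m -> R) : open U ->
  Ck_on k U u -> Ck_on k U (fun x => - u x).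
Proof.
move=> oU Cu; apply: (@Ck_on_eq _ _ _ (fun x => (cst (- 1) x) * u x)) => //.
  by move=> x _ /=; rewrite mulN1r.
by apply: Ck_onM => //; exact: Ck_on_cst.
Qed.

Lemma Ck_onB k U (u w : 'rV[R]_m -> R) : open U ->
  Ck_on k U u -> Ck_on k U w -> Ck_on k U (fun x => u x - w x).
Proof. by move=> oU Cu Cw; apply: Ck_onD => //; exact: Ck_onN. Qed.

(** Bootstrapping: the derivative is a polynomial in the inverse itself and the derivative of [u],
    and the inverse is already of class C^k by induction. [Ck_on_sqrt] follows the same pattern. *)
Lemma Ck_onV k U (u : 'rV[R]_m -> R) : open U -> (forall x, U x -> u x != 0) ->
  Ck_on k U u -> Ck_on k U (fun x => (u x)^-1).
Proof.
move=> oU u0; elim: k => [|k IH] Cu; split => //.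
- by move=> x Ux; apply: continuousV; [exact: u0|exact: Ck_on_continuous Cu _ _].
- by move=> x Ux; apply: continuousV; [exact: u0|exact: Ck_on_continuous Cu _ _].
move=> i; split.
  by move=> x Ux; apply: derivableV; [exact: u0|exact: Ck_on_derivable Cu _].
have CV := IH (Ck_onW Cu).
apply: (@Ck_on_eq _ _ _ (fun x => - ((u x)^-1 * (u x)^-1 * \d_ i u x))) => //.
  move=> x Ux; rewrite deriveV //; [|exact: u0|exact: Ck_on_derivable Cu _].
  by rewrite expr2 invfM /GRing.scale /= mulNr.
apply: Ck_onN => //; apply: Ck_onM => //; first exact: Ck_onM.
exact: Ck_on_partial.
Qed.

(** The difference quotients along [v] are those of the restriction of [u] to the line t *: v + x,
    to which the one-variable chain rule applies; [u] is differentiated in this single direction. *)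
Lemma derivable_comp1 (h : R -> R) (u : 'rV[R]_m -> R) x v (dh : R) :
  derivable u x v -> is_derive (u x) 1 h dh ->
  is_derive x v (h \o u) (dh * 'D_v u x).
Proof.
move=> du hd.
pose g := fun t : R => u (t *: v + x).
have g0 : g 0 = u x by rewrite /g scale0r add0r.
have dg : is_derive (0 : R) 1 g ('D_v u x).
  have qE : (fun t => t^-1 *: (g (t *: 1 + 0) - g 0)) =
            (fun t => t^-1 *: (u (t *: v + x) - u x)).
    by apply/funext => t; rewrite g0 /g addr0 /GRing.scale /= mulr1.
  by split; rewrite /derivable /derive qE.
have hd' : is_derive (g 0) 1 h dh by rewrite g0.
have [D E] := is_derive1_comp hd' dg.
have qE : (fun t => t^-1 *: ((h \o g) (t *: 1 + 0) - (h \o g) 0)) =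
          (fun t => t^-1 *: ((h \o u) (t *: v + x) - (h \o u) x)).
  by apply/funext => t; rewrite /= g0 /g addr0 /GRing.scale /= mulr1.
split; first by move: D; rewrite /derivable qE.
by move: E; rewrite /derive qE => ->.
Qed.

Lemma Ck_on_sqrt k U (u : 'rV[R]_m -> R) : open U -> (forall x, U x -> 0 < u x) ->
  Ck_on k U u -> Ck_on k U (fun x => Num.sqrt (u x)).
Proof.
move=> oU u0; elim: k => [|k IH] Cu; split => //.
1,2: by move=> x Ux; apply: (@continuous_comp _ _ _ u Num.sqrt); [exact: Ck_on_continuous Cu _ _|exact: sqrt_continuous].
have D x i : U x -> is_derive x (basis_vec R i) (Num.sqrt \o u) ((2 * Num.sqrt (u x))^-1 * \d_ i u x).
  by move=> Ux; apply: derivable_comp1; [exact: Ck_on_derivable Cu _|exact: is_derive1_sqrt (u0 _ Ux)].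
move=> i; split; first by move=> x /D; move=> /(_ i)[].
have CV := IH (Ck_onW Cu).
apply: (@Ck_on_eq _ _ _ (fun x => (2 * Num.sqrt (u x))^-1 * \d_ i u x)) => //.
  by move=> x Ux; have [_ <-] := D x i Ux.
apply: Ck_onM => //; last exact: Ck_on_partial.
apply: Ck_onV => //.
  by move=> x Ux; rewrite mulf_neq0 // gt_eqF // sqrtr_gt0 u0.
by apply: Ck_onM => //; exact: Ck_on_cst.
Qed.

Lemma Ck_on_mx (p q : nat) k U (F : 'rV[R]_m -> 'M[R]_(p, q)) : open U ->
  Ck_on k U F <-> forall i j, Ck_on k U (fun y => F y i j).
Proof.
move=> oU; split.
  elim: k F => [|k IH] F [cF dF] i j; split => //.
  - by move=> x Ux; have /coord_continuousE/(_ i j) := cF x Ux.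
  - by move=> x Ux; have /coord_continuousE/(_ i j) := cF x Ux.
  move=> l; have [dFl CFl] := dF l; split.
    by move=> x Ux; have /derivable_mxP/(_ i j) := dFl x Ux.
  apply: Ck_on_eq (IH _ CFl i j) => // x Ux.
  by rewrite derive_mx ?mxE //; exact: dFl.
elim: k F => [|k IH] F CF; split => //.
- by move=> x Ux; apply/coord_continuousE => i j; exact: Ck_on_continuous (CF i j) _ _.
- by move=> x Ux; apply/coord_continuousE => i j; exact: Ck_on_continuous (CF i j) _ _.
have dF x l : U x -> derivable F x (basis_vec R l).
  by move=> Ux; apply/derivable_mxP => i j; exact: Ck_on_derivable (CF i j) _.
move=> l; split; first by move=> x; exact: dF.
apply: IH => i j; apply: (@Ck_on_eq _ _ _ (\d_ l (fun y => F y i j))) => //.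
  by move=> x Ux; rewrite (derive_mx (dF x l Ux)) mxE.
exact: Ck_on_partial.
Qed.

End Calculus.

(** * Strict differentiability and the chain rule *)

Section StrictDifferentiability.
Variables (R : realType) (m : nat).
Implicit Types (U : set 'rV[R]_m) (x y z v : 'rV[R]_m) (u : 'rV[R]_m -> R).

Notation "\d_ i u" := ('D_(basis_vec R i) u) (at level 10, i at level 2, u at level 9).

Lemma is_derive_line u z v (t : R) : derivable u (z + t *: v) v ->
  is_derive t 1 (fun s : R => u (z + s *: v)) ('D_v u (z + t *: v)).
Proof.
move=> du.
have qE : (fun h => h^-1 *: (u (z + (h *: 1 + t) *: v) - u (z + t *: v))) =
          (fun h => h^-1 *: (u (h *: v + (z + t *: v)) - u (z + t *: v))).
  apply/funext => h; congr (_ *: (u _ - _)).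
  have -> : h *: (1 : R) = h by exact: mulr1.
  by rewrite scalerDl addrCA.
by split; rewrite /derivable /derive qE.
Qed.

(** The parameter runs over [0, 1] with [s] as a factor, so that the sign of [s] needs no
    discussion. *)
Lemma MVT_line u z v (s : R) :
  (forall t, 0 <= t <= 1 -> derivable u (z + (t * s) *: v) v) ->
  exists2 t, 0 <= t <= 1 & u (z + s *: v) - u z = s * 'D_v u (z + (t * s) *: v).
Proof.
move=> du; pose g := fun t : R => u (z + (t * s) *: v).
have dg (t : R) : 0 <= t <= 1 -> is_derive t 1 g ('D_v u (z + (t * s) *: v) * s).
  move=> t01; have h1 : is_derive t (1 : R) (fun t => t * s) s.
    have -> : (fun t : R => t * s) = s \*: (@id R).
      by apply/funext => a /=; rewrite mulrC.
    by apply: is_derive_eq; rewrite /GRing.scale /= mulr1.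
  exact: (@is_derive1_comp R (fun a : R => u (z + a *: v)) (fun a => a * s) t _ _ (is_derive_line (du t t01)) h1).
have [||c] := @MVT_segment R g (fun t => 'D_v u (z + (t * s) *: v) * s) 0 1 ler01.
- by move=> t; rewrite in_itv /= => /andP[t0 t1]; apply: dg; rewrite !ltW.
- apply: derivable_within_continuous => t; rewrite in_itv /= => t01.
  by have [] := dg t t01.
rewrite in_itv /= => c01; rewrite /g mul1r mul0r scale0r addr0 subr0 mulr1 => E.
by exists c => //; rewrite E mulrC.
Qed.

Lemma row_norm_le (x : 'rV[R]_m) (e : R) : 0 <= e ->
  (forall i, `|x 0 i| <= e) -> `|x| <= e.
Proof.
move=> e0 H; rewrite /Num.Def.normr/= mx_normrE (bigmax_le _ e0)//= => -[i j] _.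
by rewrite /= ord1.
Qed.

Lemma row_coord_le (x : 'rV[R]_m) i : `|x 0 i| <= `|x|.
Proof.
rewrite [leRHS]/Num.Def.normr/= mx_normrE.
by apply: le_trans (le_bigmax _ _ (0, i)).
Qed.

Lemma row_sum_basis x : x = \sum_i x 0 i *: basis_vec R i.
Proof. exact: row_sum_delta. Qed.

(** Going from [x] to [y] one coordinate at a time and applying the mean value theorem to each step
    leaves only the continuity of the partial derivatives at [x0]. Both points vary: the later uses
    compare lattice neighbours, neither of which is [x0]. *)
Lemma C1_strict_diff U u x0 (e : R) : open U -> Ck_on 1 U u -> U x0 -> 0 < e ->
  exists2 r : R, 0 < r & forall x y, `|x - x0| < r -> `|y - x0| < r ->
    U x /\ `|u y - u x - \sum_i (y - x) 0 i * \d_ i u x0| <= e * `|y - x|.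
Proof.
move=> oU Cu Ux0 e0; pose e' := e / m.+1%:R.
have e'0 : 0 < e' by rewrite divr_gt0.
have : \forall z \near x0, U z /\ forall i, `|\d_ i u x0 - \d_ i u z| <= e'.
  apply: near_and; first exact: open_nbhs_nbhs.
  apply: near_forall => i.
  have := Ck_on_continuous (Ck_on_partial i Cu) Ux0.
  by move=> /cvgrPdist_le/(_ _ e'0).
move=> /nbhs_ballP[r /= r0 rU]; exists r => // x y xr yr.
have inU z : `|z - x0| < r -> U z /\ forall i, `|\d_ i u x0 - \d_ i u z| <= e'.
  by move=> zr; apply: rU; rewrite -ball_normE /ball_ /= distrC.
split; first by have [] := inU x xr.
(* [z k] has the first [k] coordinates of [y] and the others of [x]; consecutive points differ in
   one coordinate. *)
pose z k := \row_i (if (i < k)%N then y 0 i else x 0 i) : 'rV[R]_m.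
have zS (k : 'I_m) : z k.+1 = z k + (y - x) 0 k *: basis_vec R k.
  apply/rowP => i; rewrite !mxE /= ltnS leq_eqVlt.
  have [->|ik] := eqVneq i k; first by rewrite !eqxx ltnn /= mulr1 addrCA subrr addr0.
  by rewrite (negbTE (_ : (i : nat) != k)) //= ?andbF ?mulr0 ?addr0.
have zm : z m = y by apply/rowP => i; rewrite mxE ltn_ord.
have z0 : z 0%N = x by apply/rowP => i; rewrite mxE.
have -> : u y - u x = \sum_(k < m) (u (z k.+1) - u (z k)).
  by rewrite -(big_mkord xpredT (fun k => u (z k.+1) - u (z k))) telescope_sumr // zm z0.
rewrite -sumrB; apply: le_trans (ler_norm_sum _ _ _) _.
have -> : e * `|y - x| = e' * m.+1%:R * `|y - x| by rewrite /e' divfK.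
rewrite -mulrA.
apply: (@le_trans _ _ (\sum_(k < m) e' * `|y - x|)); last first.
  rewrite sumr_const card_ord -[leLHS]mulr_natl mulrCA ler_pM2l //.
  by rewrite ler_wpM2r // ler_nat.
apply: ler_sum => k _.
have ball_line t : 0 <= t <= 1 -> `|z k + (t * (y - x) 0 k) *: basis_vec R k - x0| < r.
  move=> /andP[t0 t1].
  have hb i : `|(z k + (t * (y - x) 0 k) *: basis_vec R k - x0) 0 i| <= Num.max `|x - x0| `|y - x0|.
    have hx := row_coord_le (x - x0) i; have hy := row_coord_le (y - x0) i.
    rewrite !mxE in hx hy; rewrite !mxE /=.
    have Mx : `|x - x0| <= Num.max `|x - x0| `|y - x0| by rewrite le_max lexx.
    have My : `|y - x0| <= Num.max `|x - x0| `|y - x0| by rewrite le_max lexx orbT.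
    move: (Num.max _ _) Mx My => M Mx My.
    have {}hx := le_trans hx Mx; have {}hy := le_trans hy My.
    have [ik|ik] := eqVneq i k.
      rewrite ik in hx hy *; rewrite ltnn /= mulr1.
      move: hx hy; rewrite !ler_norml => /andP[h1 h2] /andP[h3 h4].
      apply/andP; split; nra.
    by rewrite mulr0 addr0; case: ifP.
  apply: le_lt_trans (row_norm_le _ hb) _; first by rewrite le_max normr_ge0.
  by rewrite gt_max xr yr.
rewrite zS; have [|t t01 ->] := @MVT_line u (z k) (basis_vec R k) ((y - x) 0 k).
  by move=> t t01; have [Uz _] := inU _ (ball_line t t01); exact: Ck_on_derivable Cu Uz.
have [_ /(_ k) dk] := inU _ (ball_line t t01).
rewrite -mulrBr normrM mulrC; apply: ler_pM => //; last exact: row_coord_le.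
by rewrite distrC.
Qed.

(** A derivative of [F] along [v] is enough: its increments are [h] times the bounded quotient
    [q h], and strict differentiability controls [u] on all small increments from [F w]. *)
Lemma C1_chain (W : normedModType R) U u (F : W -> 'rV[R]_m) (w v : W) (dF : 'rV[R]_m) :
  open U -> Ck_on 1 U u -> U (F w) -> is_derive w v F dF ->
  is_derive w v (u \o F) (\sum_i dF 0 i * \d_ i u (F w)).
Proof.
move=> oU Cu UFw [DF EF].
pose q h := h^-1 *: (F (h *: v + w) - F w).
have qcv : q h @[h --> (0 : R)^'] --> dF.
  by rewrite -EF; exact: DF.
suff cvq : h^-1 *: ((u \o F) (h *: v + w) - (u \o F) w) @[h --> (0 : R)^'] -->
    (\sum_i dF 0 i * \d_ i u (F w)).
  by split; [apply/cvg_ex; eexists; exact: cvq|exact: cvg_lim].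
pose S (d : 'rV[R]_m) := \sum_i d 0 i * \d_ i u (F w).
pose K := \sum_i `|\d_ i u (F w)|.
have K0 : 0 <= K by apply: sumr_ge0.
have SB d : `|S d| <= K * `|d|.
  apply: le_trans (ler_norm_sum _ _ _) _; rewrite mulr_suml; apply: ler_sum => i _.
  by rewrite normrM mulrC ler_wpM2l // row_coord_le.
pose c := `|dF| + 1.
have c0 : 0 < c by rewrite ltr_wpDl.
apply/cvgrPdist_le => e e0.
pose e' := e / 2 / c.
have e'0 : 0 < e' by rewrite !divr_gt0.
pose eta := Num.min 1 (e / 2 / (K + 1)).
have K1 : 0 < K + 1 by rewrite ltr_wpDl.
have eta0 : 0 < eta by rewrite lt_min ltr01 !divr_gt0.
have [r r0 sd] := C1_strict_diff oU Cu UFw e'0.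
have rc0 : 0 < r / c by rewrite divr_gt0.
near=> h.
have h0 : h != 0 by near: h; exact: nbhs_dnbhs_neq.
have hr : `|h| < r / c by near: h; exact: dnbhs0_lt.
have qh : `|dF - q h| <= eta by near: h; move/cvgrPdist_le : qcv; apply.
have qc : `|q h| <= c.
  rewrite -[q h](subrK dF) addrC (le_trans (ler_normD _ _)) // lerD2l distrC.
  by rewrite (le_trans qh) // ge_min lexx.
have hq : F (h *: v + w) - F w = h *: q h by rewrite /q scalerA divff ?scale1r.
have FhB : `|F (h *: v + w) - F w| < r.
  rewrite hq normrZ; apply: (@le_lt_trans _ _ (`|h| * c)); first by rewrite ler_wpM2l.
  by rewrite -ltr_pdivlMr.
have [|_ sdh] := sd (F w) (F (h *: v + w)) _ FhB; first by rewrite subrr normr0.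
have SZ d : S (h *: d) = h * S d.
  by rewrite /S mulr_sumr; apply: eq_bigr => i _; rewrite mxE mulrA.
rewrite -/(S _) hq in sdh; rewrite -/(S _).
have -> : h^-1 *: ((u \o F) (h *: v + w) - (u \o F) w) =
   h^-1 * (u (F (h *: v + w)) - u (F w) - S (h *: q h)) + S (q h).
  by rewrite SZ mulrBr mulKf // subrK.
rewrite opprD addrCA (le_trans (ler_normD _ _)) // (splitr e) lerD //.
  rewrite normrN normrM normfV ler_pdivrMl ?normr_gt0 // (le_trans sdh) //.
  rewrite normrZ mulrCA ler_wpM2l // -[leRHS](divfK (lt0r_neq0 c0)) -/e'.
  by rewrite ler_wpM2l // ltW.
have -> : S dF - S (q h) = S (dF - q h).
  by rewrite /S -sumrB; apply: eq_bigr => i _; rewrite !mxE mulrBl.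
rewrite (le_trans (SB _)) //; apply: (@le_trans _ _ ((K + 1) * eta)).
  by apply: ler_pM => //; rewrite lerDl.
by rewrite mulrC -ler_pdivlMr // ge_min lexx orbT.
Unshelve. all: by end_near. Qed.

Lemma C1_derive U u x v : open U -> Ck_on 1 U u -> U x ->
  is_derive x v u (\sum_i v 0 i * \d_ i u x).
Proof. by move=> oU Cu Ux; exact: (@C1_chain _ U u id x v v oU Cu Ux (is_derive_id _ _)). Qed.

Lemma C1_deriveE U u x v : open U -> Ck_on 1 U u -> U x ->
  'D_v u x = \sum_i v 0 i * \d_ i u x.
Proof. by move=> oU Cu Ux; have [] := C1_derive v oU Cu Ux. Qed.

Lemma C1_derive_comp (W : normedModType R) U u (F : W -> 'rV[R]_m) (w v : W) :
  open U -> Ck_on 1 U u -> U (F w) -> derivable F w v ->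
  is_derive w v (u \o F) ('D_('D_v F w) u (F w)).
Proof.
move=> oU Cu UFw dF; rewrite (C1_deriveE _ oU Cu UFw).
by apply: (C1_chain oU Cu UFw); exact: derivableP.
Qed.

End StrictDifferentiability.

(** * Symmetry of second partial derivatives *)

Section Schwarz.
Variables (R : realType) (m : nat).
Implicit Types (U : set 'rV[R]_m) (x y z v : 'rV[R]_m) (u : 'rV[R]_m -> R).

Notation "\d_ i u" := ('D_(basis_vec R i) u) (at level 10, i at level 2, u at level 9).

Lemma is_derive_translate u z c v : derivable u (z + c) v ->
  is_derive z v (fun y => u (y + c)) ('D_v u (z + c)).
Proof.
move=> du.
have qE : (fun h => h^-1 *: (u (h *: v + z + c) - u (z + c))) =
          (fun h => h^-1 *: (u (h *: v + (z + c)) - u (z + c))).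
  by apply/funext => h; rewrite addrA.
by split; rewrite /derivable /derive qE.
Qed.

Lemma norm_scale_basis (s : R) i : `|s *: basis_vec R i : 'rV[R]_m| <= `|s|.
Proof.
apply: row_norm_le => // j; rewrite !mxE /=; case: eqP => _ /=; first by rewrite mulr1.
by rewrite mulr0 normr0.
Qed.

Lemma sum_scale_basis (s : R) i (a : 'I_m -> R) :
  \sum_k (s *: basis_vec R i : 'rV[R]_m) 0 k * a k = s * a i.
Proof.
rewrite (bigD1 i) //= big1 ?addr0; first by rewrite !mxE !eqxx mulr1.
by move=> k ki; rewrite !mxE eqxx /= (negbTE ki) mulr0 mul0r.
Qed.

(** The mean value theorem along direction [i] for the increment [phi] of [u] in direction [j], then
    strict differentiability of the [i]-th partial derivative at [x]. *)
Lemma second_difference U u x i j (e : R) : open U -> Ck_on 2 U u -> U x -> 0 < e ->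
  exists2 r, 0 < r & forall s, 0 < s < r ->
  `|u (x + s *: basis_vec R i + s *: basis_vec R j) - u (x + s *: basis_vec R i)
    - u (x + s *: basis_vec R j) + u x - s * (s * \d_ j (\d_ i u) x)| <= s * (s * e).
Proof.
move=> oU Cu Ux e0.
have Ci : Ck_on 1 U (\d_ i u) by exact: Ck_on_partial.
have [r r0 sd] := C1_strict_diff oU Ci Ux e0.
exists (r / 2) => [|s /andP[s0 sr]]; first by rewrite divr_gt0.
pose ei : 'rV[R]_m := basis_vec R i; pose ej : 'rV[R]_m := basis_vec R j.
have n1 (t : R) : 0 <= t <= 1 -> `|(t * s) *: ei| <= s.
  move=> /andP[t0 t1]; apply: le_trans (norm_scale_basis _ _) _.
  by rewrite normrM (ger0_norm t0) (gtr0_norm s0) ler_piMl // ltW.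
have nj : `|s *: ej| <= s.
  by apply: le_trans (norm_scale_basis _ _) _; rewrite gtr0_norm.
have s2 : s + s < r by lra.
have b1 (t : R) : 0 <= t <= 1 -> `|x + (t * s) *: ei - x| < r.
  by move=> /n1 h; rewrite addrAC subrr add0r (le_lt_trans h) //; lra.
have b2 (t : R) : 0 <= t <= 1 -> `|x + (t * s) *: ei + s *: ej - x| < r.
  move=> /n1 h; rewrite -2!addrA addrC -addrA addrNK.
  by rewrite (le_lt_trans (ler_normD _ _)) // (le_lt_trans (lerD h nj)).
have inU y : `|y - x| < r -> U y by move=> yr; have [] := sd y y yr yr.
pose phi z := u (z + s *: ej) - u z.
have dphi (t : R) : 0 <= t <= 1 -> is_derive (x + (t * s) *: ei) ei phi
    (\d_ i u (x + (t * s) *: ei + s *: ej) - \d_ i u (x + (t * s) *: ei)).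
  move=> t01; apply: is_deriveB.
    by apply: is_derive_translate; apply: Ck_on_derivable Cu _; exact: inU (b2 _ t01).
  by apply: derivableP; apply: Ck_on_derivable Cu _; exact: inU (b1 _ t01).
have [|t t01] := @MVT_line _ _ phi x ei s.
  by move=> t /dphi[].
have [_ ->] := dphi t t01 => E.
have -> : u (x + s *: ei + s *: ej) - u (x + s *: ei) - u (x + s *: ej) + u x =
   phi (x + s *: ei) - phi x by rewrite /phi; ring.
rewrite E -mulrBr normrM (gtr0_norm s0) ler_pM2l //.
have [_] := sd _ _ (b1 t t01) (b2 t t01).
have -> : x + (t * s) *: ei + s *: ej - (x + (t * s) *: ei) = s *: ej by rewrite addrAC subrr add0r.
rewrite sum_scale_basis => /le_trans; apply.
by rewrite mulrC ler_pM2r.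
Qed.

(** The second difference is symmetric in [i] and [j], and after division by the square of [s] it is
    within e / 2 of either mixed derivative. *)
Lemma schwarz U u x i j : open U -> Ck_on 2 U u -> U x ->
  \d_ i (\d_ j u) x = \d_ j (\d_ i u) x.
Proof.
move=> oU Cu Ux; apply/eqP; rewrite -subr_eq0 -normr_le0; apply/ler_addgt0Pl => e e0.
have e2 : 0 < e / 2 by rewrite divr_gt0.
have [r r0 h1] := second_difference i j oU Cu Ux e2.
have [r' r'0 h2] := second_difference j i oU Cu Ux e2.
pose s := Num.min r r' / 2.
have s0 : 0 < s by rewrite divr_gt0 // lt_min r0.
have sr : s < r.
  by rewrite ltr_pdivrMr // (le_lt_trans (_ : _ <= r)) ?ge_min ?lexx // ltr_pMr // ltr1n.
have sr' : s < r'.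
  by rewrite ltr_pdivrMr // (le_lt_trans (_ : _ <= r')) ?ge_min ?lexx ?orbT // ltr_pMr // ltr1n.
have {}h1 := h1 s; have {}h2 := h2 s; rewrite s0 sr in h1; rewrite s0 sr' in h2.
have {}h1 := h1 isT; have {}h2 := h2 isT.
rewrite (addrAC x (s *: basis_vec R j)) in h2.
set A := \d_ i _ x in h2 *; set B := \d_ j _ x in h1 *.
rewrite addr0 -(ler_pM2l s0) -(ler_pM2l s0).
rewrite -(gtr0_norm s0) -!normrM (gtr0_norm s0).
apply: le_trans (_ : s * (s * (e / 2)) + s * (s * (e / 2)) <= _); last by rewrite -2!mulrDr -splitr.
apply: le_trans (lerD h1 h2); rewrite -[X in _ <= X + _]normrN.
apply: le_trans (ler_normD _ _); rewrite le_eqVlt; apply/orP; left; apply/eqP.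
by rewrite -normrN; congr (`|_|); ring.
Qed.

End Schwarz.

(** * Lattice sums and bump functions *)

(* Junk value 0 when the support of [F] is infinite. *)
HB.lock Definition lsum (R : realType) (m : nat) (F : 'rV[int]_m -> R) : R :=
  \sum_(j \in [set: 'rV[int]_m]) F j.

Section LatticeSums.
Variables (R : realType) (m : nat).
Implicit Types (B : nat) (F G : 'rV[int]_m -> R) (j : 'rV[int]_m).

Definition box B : seq 'rV[int]_m :=
  [seq \row_i ((k i : nat)%:Z - B%:Z) | k : {ffun 'I_m -> 'I_(2 * B).+1%N}].

Lemma mem_box B j : (j \in box B) = [forall i, (`|j 0%R i| <= B)%N].
Proof.
apply/idP/forallP => [/mapP[k _ ->] i|H].
  by rewrite mxE; move: (k i) => [a al] /=; move: al => /=; lia.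
apply/mapP; exists [ffun i => inord (absz (j 0 i + B%:Z))]; first by rewrite mem_enum.
by apply/rowP => i; rewrite mxE ffunE inordK; move: (H i) => /=; move: (j 0 i) => a; lia.
Qed.

Lemma box_uniq B : uniq (box B).
Proof.
rewrite map_inj_uniq ?enum_uniq // => k k' /rowP E; apply/ffunP => i.
apply/val_inj => /=; move: (E i); rewrite !mxE; move: (k i) (k' i) => [a al] [b bl] /=; lia.
Qed.

Lemma size_box B : size (box B) = ((2 * B).+1 ^ m)%N.
Proof. by rewrite size_map -cardT card_ffun !card_ord. Qed.

Lemma box_subset B B' : (B <= B')%N -> {subset box B <= box B'}.
Proof.
move=> BB' j; rewrite !mem_box => /forallP H; apply/forallP => i.
by move: (H i) => /=; lia.
Qed.

Definition bsupp B F := forall j, j \notin box B -> F j = 0.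

Lemma lsum_box B F : bsupp B F -> lsum F = \sum_(j <- box B) F j.
Proof.
move=> H; rewrite lsum.unlock [RHS](fsbig_seq _ _ (box_uniq B)); symmetry.
apply: (@fsbig_widen _ R 0 +%R [set` box B] setT F) => //.
by move=> j [_ /negP/H].
Qed.

Lemma lsum_eq0 F : (forall j, F j = 0) -> lsum F = 0.
Proof. by move=> F0; rewrite lsum.unlock fsbig1. Qed.

Lemma bsupp_le B B' F : (B <= B')%N -> bsupp B F -> bsupp B' F.
Proof. by move=> BB' H j jB; apply: H; exact: contra (box_subset BB' (x := j)) jB. Qed.

Lemma lsum_shift F c : lsum (fun j => F (j + c)) = lsum F.
Proof.
rewrite lsum.unlock [RHS](reindex_fsbigT (fun j => j + c)) //.
by exists (fun j => j - c) => j; rewrite ?addrK ?subrK.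
Qed.

Lemma lsumD B F G : bsupp B F -> bsupp B G -> lsum (fun j => F j + G j) = lsum F + lsum G.
Proof.
move=> HF HG; rewrite !(@lsum_box B) // ?big_split //.
by move=> j jB; rewrite HF ?HG ?addr0.
Qed.

Lemma lsumZ B (c : R) F : bsupp B F -> lsum (fun j => c * F j) = c * lsum F.
Proof.
move=> HF; rewrite !(@lsum_box B) ?mulr_sumr //.
by move=> j jB; rewrite HF ?mulr0.
Qed.

Lemma lsumB B F G : bsupp B F -> bsupp B G -> lsum (fun j => F j - G j) = lsum F - lsum G.
Proof.
move=> HF HG; rewrite !(@lsum_box B) // ?sumrB //.
by move=> j jB; rewrite HF ?HG ?subr0.
Qed.

Lemma lsum_sum B (I : Type) (r : seq I) (F : I -> 'rV[int]_m -> R) :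
  (forall i, bsupp B (F i)) -> lsum (fun j => \sum_(i <- r) F i j) = \sum_(i <- r) lsum (F i).
Proof.
move=> HF; rewrite (@lsum_box B); last by move=> j jB; rewrite big1 // => i _; rewrite HF.
by rewrite exchange_big /=; apply: eq_bigr => i _; rewrite (@lsum_box B).
Qed.

Lemma ler_lsum B F G : bsupp B F -> bsupp B G -> (forall j, F j <= G j) -> lsum F <= lsum G.
Proof. by move=> HF HG FG; rewrite !(@lsum_box B) //; apply: ler_sum. Qed.

Lemma exchange_lsum B B' (F : 'rV[int]_m -> 'rV[int]_m -> R) :
  (forall j, j \notin box B -> forall k, F j k = 0) ->
  (forall k, k \notin box B' -> forall j, F j k = 0) ->
  lsum (fun j => lsum (F j)) = lsum (fun k => lsum (F^~ k)).
Proof.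
move=> H H'.
have e1 : lsum (fun j => lsum (F j)) = \sum_(j <- box B) \sum_(k <- box B') F j k.
  rewrite (@lsum_box B); last by move=> j /H jB; rewrite lsum.unlock fsbig1.
  by apply: eq_bigr => j _; rewrite (@lsum_box B') // => k /H' ->.
have e2 : lsum (fun k => lsum (F^~ k)) = \sum_(k <- box B') \sum_(j <- box B) F j k.
  rewrite (@lsum_box B'); last by move=> k /H' kB; rewrite lsum.unlock fsbig1.
  by apply: eq_bigr => k _; rewrite (@lsum_box B) // => j /H ->.
by rewrite e1 e2 exchange_big.
Qed.

Lemma lsum_count_le B j0 (c : R) F : 0 <= c ->
  (forall j, `|F j| <= c) -> (forall j, F j != 0 -> j - j0 \in box B) ->
  `|lsum F| <= c * ((2 * B).+1 ^ m)%:R.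
Proof.
move=> c0 Fc HF; rewrite -(lsum_shift F j0) (@lsum_box B); last first.
  by move=> j jB; apply/eqP; apply: contraNT jB => /HF; rewrite addrK.
apply: le_trans (ler_norm_sum _ _ _) _.
apply: le_trans (ler_sum _ (fun j _ => Fc (j + j0))) _.
by rewrite big_const_seq count_predT size_box iter_addr_0 mulr_natr.
Qed.

Lemma lsum_count_ge B B' j0 (c : R) F : bsupp B' F ->
  (forall j, 0 <= F j) -> (forall j, j - j0 \in box B -> c <= F j) ->
  c * ((2 * B).+1 ^ m)%:R <= lsum F.
Proof.
move=> sF F0 HF.
(* [K] is large enough for the support of [F] translated by [j0] and for the box that is counted. *)
pose K := (B + B' + \sum_i `|j0 0%R i|)%N.
have sF' : bsupp K (fun j => F (j + j0)).
  move=> j jK; apply: sF; apply: contra jK; rewrite !mem_box => /forallP H.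
  apply/forallP => i; move: (H i); rewrite mxE /K (bigD1 i) //=.
  by move: (j 0 i) (j0 0 i) (\sum_(_ < _ | _) _)%N => a b c'; lia.
rewrite -(lsum_shift F j0) (lsum_box sF').
have -> : c * ((2 * B).+1 ^ m)%:R = \sum_(j <- box B) c.
  by rewrite big_const_seq count_predT size_box iter_addr_0 mulr_natr.
rewrite [leRHS](bigID (fun j => j \in box B)) /= -[leLHS]addr0.
apply: lerD; last by apply: sumr_ge0 => j _.
have -> : \sum_(j <- box K | j \in box B) F (j + j0) = \sum_(j <- box B) F (j + j0).
  rewrite -big_filter; apply: perm_big; apply: uniq_perm.
  - exact/filter_uniq/box_uniq.
  - exact: box_uniq.
  move=> j; rewrite mem_filter andb_idr // => /box_subset; apply.
  by rewrite /K -addnA leq_addr.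
rewrite big_seq [leRHS]big_seq; apply: ler_sum => j jB.
by apply: HF; rewrite addrK.
Qed.

End LatticeSums.

(** * The bump profile *)

Section Bump.
Variable R : realType.
Implicit Types s t : R.

(** The square makes the profile of class C^1, with a quadratic Taylor remainder that holds even
    across the kink of [dbump] at 1 ([bump_taylor]). Composed with a positive definite form, it is
    supported in an ellipsoid and involves no square root. *)
Definition bump s : R := Num.max 0 (1 - s) ^+ 2.
Definition dbump s : R := - 2 * Num.max 0 (1 - s).

Lemma bump_taylor s t : `|bump (s + t) - bump s - dbump s * t| <= t ^+ 2.
Proof.
rewrite /bump /dbump; case: (leP 0 (1 - s)) => h1; case: (leP 0 (1 - (s + t))) => h2;
  rewrite ler_norml; nra.
Qed.

Lemma bump_ge0 s : 0 <= bump s. Proof. exact: sqr_ge0. Qed.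

Lemma bump_le1 s : 0 <= s -> bump s <= 1.
Proof. by rewrite /bump => s0; case: (leP 0 (1 - s)) => h1; nra. Qed.

Lemma bump_eq0 s : 1 <= s -> bump s = 0.
Proof.
move=> s1; rewrite /bump; case: (leP 0 (1 - s)) => h1; last by rewrite expr2 mulr0.
have -> : s = 1 by lra.
by rewrite subrr expr2 mulr0.
Qed.

Lemma dbump_eq0 s : 1 <= s -> dbump s = 0.
Proof.
move=> s1; rewrite /dbump; case: (leP 0 (1 - s)) => h1; last by rewrite mulr0.
have -> : s = 1 by lra.
by rewrite subrr mulr0.
Qed.

Lemma bump_lip s t : 0 <= s -> 0 <= t -> `|bump s - bump t| <= 2 * `|s - t|.
Proof.
move=> s0 t0; rewrite /bump.
by case: (leP 0 (1 - s)) => h1; case: (leP 0 (1 - t)) => h2; case: (ger0P (s - t)) => h3;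
  rewrite ler_norml; nra.
Qed.

Lemma bump_ge_quarter s : 0 <= s <= 2^-1 -> 4^-1 <= bump s.
Proof.
by move=> /andP[s0 s1]; rewrite /bump; case: (leP 0 (1 - s)) => h1; nra.
Qed.

Lemma dbump_le2 s : 0 <= s -> `|dbump s| <= 2.
Proof.
by move=> s0; rewrite /dbump; case: (leP 0 (1 - s)) => h1; rewrite ler_norml; nra.
Qed.

Lemma is_derive_bump s : is_derive s 1 bump (dbump s).
Proof.
have D : h^-1 *: ((bump \o shift s) (h *: 1) - bump s) @[h --> (0 : R)^'] --> dbump s.
  apply/cvgrPdist_le => e e0; near=> h.
  have h0 : h != 0 by near: h; exact: nbhs_dnbhs_neq.
  have he : `|h| <= e by near: h; exact: dnbhs0_le.
  have -> : h *: (1 : R) = h by exact: mulr1.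
  have -> : dbump s - h^-1 *: ((bump \o shift s) h - bump s) =
    - (h^-1 * (bump (s + h) - bump s - dbump s * h)).
    by rewrite /= (addrC h) /GRing.scale /=; field.
  rewrite normrN normrM normfV ler_pdivrMl ?normr_gt0 //.
  by rewrite (le_trans (bump_taylor _ _)) // -(real_normK (num_real h)) expr2 ler_wpM2l.
by split; [apply/cvg_ex; exists (dbump s)|exact: cvg_lim].
Unshelve. all: by end_near. Qed.

End Bump.

(** * Matrix norms and positive definite matrices *)

Section MatrixNorm.
Variable R : realType.

Lemma mx_norm_le (p q : nat) (A : 'M[R]_(p, q)) (e : R) : 0 <= e ->
  (forall i j, `|A i j| <= e) -> `|A| <= e.
Proof.
by move=> e0 H; rewrite /Num.Def.normr/= mx_normrE (bigmax_le _ e0)//= => -[i j] _.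
Qed.

Lemma mx_entry_le (p q : nat) (A : 'M[R]_(p, q)) i j : `|A i j| <= `|A|.
Proof.
rewrite [leRHS]/Num.Def.normr/= mx_normrE.
by apply: le_trans (le_bigmax _ _ (i, j)).
Qed.

Lemma mulmx_norm (p q r : nat) (A : 'M[R]_(p, q)) (B : 'M[R]_(q, r)) :
  `|A *m B| <= q%:R * `|A| * `|B|.
Proof.
apply: mx_norm_le => [|i j]; first by rewrite !mulr_ge0.
rewrite mxE; apply: le_trans (ler_norm_sum _ _ _) _.
apply: (@le_trans _ _ (\sum_(k < q) `|A| * `|B|)).
  by apply: ler_sum => k _; rewrite normrM ler_pM // mx_entry_le.
by rewrite sumr_const card_ord -[leLHS]mulr_natl mulrA.
Qed.

Lemma trmx_norm (p q : nat) (A : 'M[R]_(p, q)) : `|A^T| <= `|A|.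
Proof. by apply: mx_norm_le => // i j; rewrite mxE mx_entry_le. Qed.

Variable m : nat.
Implicit Types (Q H : 'M[R]_m) (u v w z : 'rV[R]_m).

Lemma inner_norm Q u v : `|inner Q u v| <= m%:R ^+ 2 * `|Q| * `|u| * `|v|.
Proof.
apply: le_trans (mx_entry_le _ _ _) _; apply: le_trans (mulmx_norm _ _) _.
apply: (@le_trans _ _ (m%:R * (m%:R * `|u| * `|Q|) * `|v|)).
  by rewrite ler_pM ?mulr_ge0 ?trmx_norm // ler_wpM2l // mulmx_norm.
by rewrite le_eqVlt; apply/orP; left; apply/eqP; ring.
Qed.

Lemma innerDl Q u v w : inner Q (u + v) w = inner Q u w + inner Q v w.
Proof. by rewrite /inner !mulmxDl mxE. Qed.

Lemma innerDr Q u v w : inner Q w (u + v) = inner Q w u + inner Q w v.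
Proof. by rewrite /inner linearD /= mulmxDr mxE. Qed.

Lemma innerZl Q (a : R) u v : inner Q (a *: u) v = a * inner Q u v.
Proof. by rewrite /inner -!scalemxAl mxE. Qed.

Lemma innerZr Q (a : R) u v : inner Q u (a *: v) = a * inner Q u v.
Proof. by rewrite /inner linearZ /= -scalemxAr mxE. Qed.

Lemma innerNl Q u v : inner Q (- u) v = - inner Q u v.
Proof. by rewrite -scaleN1r innerZl mulN1r. Qed.

Lemma innerNr Q u v : inner Q u (- v) = - inner Q u v.
Proof. by rewrite -scaleN1r innerZr mulN1r. Qed.

Lemma inner0l Q u : inner Q 0 u = 0.
Proof. by rewrite /inner !mul0mx mxE. Qed.

Lemma inner0r Q u : inner Q u 0 = 0.
Proof. by rewrite /inner trmx0 mulmx0 mxE. Qed.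

Lemma innerC Q u v : Q^T = Q -> inner Q u v = inner Q v u.
Proof.
move=> sQ; rewrite /inner.
have <- : (u *m Q *m v^T)^T = v *m Q *m u^T by rewrite !trmx_mul trmxK sQ mulmxA.
by rewrite [RHS]mxE.
Qed.

Lemma inner_mxD Q H u v : inner (Q + H) u v = inner Q u v + inner H u v.
Proof. by rewrite /inner mulmxDr mulmxDl mxE. Qed.

Lemma inner_mxZ (a : R) Q u v : inner (a *: Q) u v = a * inner Q u v.
Proof. by rewrite /inner -scalemxAr -scalemxAl mxE. Qed.

Lemma inner_basis Q i j : inner Q (basis_vec R i) (basis_vec R j) = Q i j.
Proof. by rewrite /inner -rowE trmx_delta -colE !mxE. Qed.

Definition spd Q := Q^T = Q /\ forall u, u != 0 -> 0 < inner Q u u.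

Lemma spd_ge0 Q u : spd Q -> 0 <= inner Q u u.
Proof.
move=> [_ H]; have [->|/H/ltW //] := eqVneq u 0; by rewrite inner0l.
Qed.

Lemma spd_unitmx Q : spd Q -> Q \in unitmx.
Proof.
move=> [_ H]; rewrite -row_free_unit -kermx_eq0.
apply/eqP/row_matrixP => i; rewrite row0; apply/eqP; apply: contraT => /H.
rewrite /inner (_ : row i (kermx Q) *m Q = 0) ?mul0mx ?mxE ?ltxx //.
by rewrite -row_mul mulmx_ker row0.
Qed.

Lemma cauchy_schwarz Q u v : spd Q ->
  inner Q u v ^+ 2 <= inner Q u u * inner Q v v.
Proof.
move=> sQ; have [->|v0] := eqVneq v 0; first by rewrite !inner0r expr0n mulr0.
have vv : 0 < inner Q v v by exact: sQ.2.
have := spd_ge0 (inner Q v v *: u - inner Q u v *: v) sQ.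
have -> : inner Q (inner Q v v *: u - inner Q u v *: v) (inner Q v v *: u - inner Q u v *: v)
    = inner Q v v * (inner Q u u * inner Q v v - inner Q u v ^+ 2).
  by rewrite !(innerDl, innerDr, innerNl, innerNr, innerZl, innerZr) (innerC v u sQ.1); ring.
by rewrite pmulr_rge0 // subr_ge0.
Qed.

(** Cauchy-Schwarz against the [i]-th row of [invmx Q], the vector that represents the [i]-th
    coordinate. It bounds the ellipsoid on which a bump is supported. *)
Lemma coord_le_inner Q z i : spd Q -> z 0 i ^+ 2 <= inner Q z z * invmx Q i i.
Proof.
move=> sQ; have uQ := spd_unitmx sQ.
have tQ : (invmx Q)^T = invmx Q by rewrite trmx_inv sQ.1.
have := cauchy_schwarz z (basis_vec R i *m invmx Q) sQ.
have E u : inner Q u (basis_vec R i *m invmx Q) = u 0 i.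
  rewrite /inner trmx_mul tQ -[u *m Q *m _]mulmxA (mulmxA Q) mulmxV // mul1mx.
  by rewrite trmx_delta -colE mxE.
by rewrite !E -rowE mxE.
Qed.

End MatrixNorm.

(** * The lattice mass of a quadratic form *)

Section LatticeMass.
Variables (R : realType) (m : nat).
Implicit Types (p b : nat) (Q H : 'M[R]_m) (z v : 'rV[R]_m) (j : 'rV[int]_m)
  (F : 'rV[int]_m -> R).

Definition ipt p j : 'rV[R]_m := p%:R^-1 *: map_mx intr j.

Definition lavg p F : R := p%:R^-1 ^+ m * lsum F.

(** Riemann sum of spacing 1/p for the integral of bump (Q(z, z)), which is proportional to
    det(Q)^(-1/2). *)
Definition lmass p Q : R := lavg p (fun j => bump (inner Q (ipt p j) (ipt p j))).

(** The constants in the estimates below depend on [b] and [m] alone, which makes them uniform in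
    [p] and over a compact set of metrics. *)
Definition good b Q := [/\ spd Q, `|Q| <= b%:R & `|invmx Q| <= b%:R].

Lemma iptD p j j' : ipt p (j + j') = ipt p j + ipt p j'.
Proof. by rewrite /ipt -scalerDr; congr (_ *: _); apply/rowP => i; rewrite !mxE intrD. Qed.

Lemma iptN p j : ipt p (- j) = - ipt p j.
Proof. by rewrite /ipt -scalerN; congr (_ *: _); apply/rowP => i; rewrite !mxE intrN. Qed.

Lemma ipt_basis p i : ipt p (delta_mx 0 i) = p%:R^-1 *: basis_vec R i.
Proof.
rewrite /ipt; congr (_ *: _); apply/rowP => k; rewrite !mxE.
by case: (_ && _).
Qed.

Lemma ipt_box p b j : (0 < p)%N -> (j \in box m (b * p)) = (`|ipt p j| <= b%:R).
Proof.
move=> p0; have p0' : 0 < p%:R :> R by rewrite ltr0n.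
have E i : (`|ipt p j 0 i| <= b%:R) = (`|j 0%R i| <= b * p)%N.
  rewrite !mxE normrM normfV normr_nat ler_pdivrMl // -natrM -intr_norm.
  have -> : (p * b)%:R = ((p * b)%N : int)%:~R :> R by [].
  by rewrite ler_int mulnC; move: (j 0 i) => a; apply/idP/idP; lia.
rewrite mem_box; apply/forallP/idP => [H|H i].
  by apply: row_norm_le => // i; rewrite E.
by rewrite -E (le_trans (row_coord_le _ _)).
Qed.

Lemma lavg_le p b (c : R) j0 F : (0 < p)%N -> (0 < b)%N -> 0 <= c ->
  (forall j, `|F j| <= c) -> (forall j, F j != 0 -> `|ipt p (j - j0)| <= b%:R) ->
  `|lavg p F| <= c * (3 * b%:R) ^+ m.
Proof.
move=> p0 b0 c0 Fc HF; have p0' : 0 < p%:R :> R by rewrite ltr0n.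
rewrite /lavg normrM ger0_norm ?exprn_ge0 ?invr_ge0 //.
have := @lsum_count_le _ _ (b * p)%N j0 c F c0 Fc _.
move=> /(_ (fun j Hj => etrans (ipt_box b _ p0) (HF j Hj))) h.
rewrite exprVn ler_pdivrMl ?exprn_gt0 // (le_trans h) // mulrCA -exprMn.
rewrite ler_wpM2l // natrX lerXn2r ?nnegrE ?mulr_ge0 //.
rewrite -!natrM ler_nat; nia.
Qed.

Lemma good_supp b Q z : (0 < b)%N -> good b Q -> inner Q z z < 1 -> `|z| <= b%:R.
Proof.
move=> b0 [sQ _ iQ] q1; apply: row_norm_le => // i.
have b1 : 1 <= b%:R :> R by rewrite ler1n.
have h := coord_le_inner z i sQ; have q0 := spd_ge0 z sQ.
have hi : invmx Q i i <= b%:R by rewrite (le_trans (ler_norm _)) // (le_trans (mx_entry_le _ _ _)).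
have h2 : z 0 i ^+ 2 <= b%:R.
  by apply: le_trans h _; nra.
by rewrite ler_norml; nra.
Qed.

Lemma good_ge1 b Q z : (0 < b)%N -> good b Q -> b%:R < `|z| -> 1 <= inner Q z z.
Proof. by move=> b0 gQ; rewrite ltNge; apply: contraR; rewrite -ltNge; exact: good_supp. Qed.

Lemma lavgE p B F G : bsupp B F -> bsupp B G -> forall a : R,
  lavg p (fun j => F j + a * G j) = lavg p F + a * lavg p G.
Proof.
move=> sF sG a; rewrite /lavg (@lsumD _ _ B) //; last by move=> j /sG ->; rewrite mulr0.
by rewrite (@lsumZ _ _ B) // mulrDr mulrCA.
Qed.

Lemma bump_supp b Q z : (0 < b)%N -> good b Q -> b%:R < `|z| -> bump (inner Q z z) = 0.
Proof. by move=> b0 gQ zb; apply: bump_eq0; exact: good_ge1 zb. Qed.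

Lemma dbump_supp b Q z : (0 < b)%N -> good b Q -> b%:R < `|z| -> dbump (inner Q z z) = 0.
Proof. by move=> b0 gQ zb; apply: dbump_eq0; exact: good_ge1 zb. Qed.

Lemma ipt_bsupp p b F : (0 < p)%N -> (forall j, b%:R < `|ipt p j| -> F j = 0) ->
  bsupp (b * p) F.
Proof. by move=> p0 HF j; rewrite ipt_box // -ltNge => /HF. Qed.

Lemma lavg_le0 p b (c : R) F : (0 < p)%N -> (0 < b)%N -> 0 <= c ->
  (forall j, `|ipt p j| <= b%:R -> `|F j| <= c) -> (forall j, b%:R < `|ipt p j| -> F j = 0) ->
  `|lavg p F| <= c * (3 * b%:R) ^+ m.
Proof.
move=> p0 b0 c0 Fc HF; apply: (lavg_le (j0 := 0)) => // j.
  by have [/Fc //|/HF ->] := leP `|ipt p j| b%:R; rewrite normr0.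
by rewrite subr0 leNgt; apply: contra => /HF ->.
Qed.

Lemma inner_norm_le b Q z (K : R) : `|Q| <= b%:R -> `|z| <= K ->
  `|inner Q z z| <= m%:R ^+ 2 * b%:R * K * K.
Proof.
move=> Qb zK; apply: le_trans (inner_norm _ _ _) _.
by rewrite !ler_pM ?mulr_ge0.
Qed.

(** Taylor's formula for [bump] is applied term by term. The terms that do not vanish lie in the
    ball of radius [b]; their number is of order p^m, which the normalization of [lavg]
    compensates. *)
Lemma lmass_taylor b : (0 < b)%N -> exists2 C, 0 <= C &
  forall p Q H (e : R), (0 < p)%N -> good b Q -> good b (Q + e *: H) -> `|H| <= b%:R ->
  `|lmass p (Q + e *: H) - lmass p Q
    - e * lavg p (fun j => dbump (inner Q (ipt p j) (ipt p j)) * inner H (ipt p j) (ipt p j))|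
  <= C * e ^+ 2.
Proof.
move=> b0; pose c : R := (m%:R ^+ 2 * b%:R * b%:R * b%:R) ^+ 2.
have c0 : 0 <= c by exact: sqr_ge0.
exists (c * (3 * b%:R) ^+ m); first by rewrite mulr_ge0 // exprn_ge0 // mulr_ge0.
move=> p Q H e p0 gQ gQ' Hb.
pose f1 j := bump (inner (Q + e *: H) (ipt p j) (ipt p j)).
pose f2 j := bump (inner Q (ipt p j) (ipt p j)).
pose f3 j := dbump (inner Q (ipt p j) (ipt p j)) * inner H (ipt p j) (ipt p j).
have s1 j : b%:R < `|ipt p j| -> f1 j = 0 by move=> h; rewrite /f1 (bump_supp b0 gQ').
have s2 j : b%:R < `|ipt p j| -> f2 j = 0 by move=> h; rewrite /f2 (bump_supp b0 gQ).
have s3 j : b%:R < `|ipt p j| -> f3 j = 0 by move=> h; rewrite /f3 (dbump_supp b0 gQ) // mul0r.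
have -> : lmass p (Q + e *: H) - lmass p Q - e * lavg p f3 =
   lavg p (fun j => f1 j + (-1) * f2 j + (- e) * f3 j).
  rewrite !(@lavgE _ (b * p)%N); try exact: ipt_bsupp.
    by rewrite /lmass -/f1 -/f2 mulN1r mulNr.
  by apply: ipt_bsupp => // j h; rewrite s1 // s2 // mulr0 addr0.
rewrite mulrAC; apply: lavg_le0 => //.
- by rewrite mulr_ge0 // sqr_ge0.
- move=> j zb; rewrite /f1 /f2 /f3 mulN1r mulNr inner_mxD inner_mxZ.
  set q := inner Q _ _; set h := inner H _ _.
  have := bump_taylor q (e * h).
  rewrite (mulrCA (dbump _)) => /le_trans; apply.
  rewrite exprMn mulrC ler_wpM2r ?sqr_ge0 // -(real_normK (num_real h)).
  by rewrite lerXn2r ?nnegrE ?mulr_ge0 //; exact: inner_norm_le.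
by move=> j h; rewrite s1 // s2 // s3 // !mulr0 !addr0.
Qed.

Lemma spd_sym_inner Q u v : spd Q -> inner Q u v = inner Q v u.
Proof. by case=> sQ _; exact: innerC. Qed.

(** Discrete derivative of the field z |-> bump (Q(z, z)) (z A) in direction [i]. For A = H Q^-1 the
    first-order terms add up over [i] to bump * tr A + 2 dbump * H(z, z), by [sum_trace_inner]. *)
Lemma flux_difference b : (0 < b)%N -> exists2 C, 0 <= C &
  forall Q (A : 'M[R]_m) z i (eta : R), good b Q -> `|A| <= m%:R * b%:R * b%:R -> 0 <= eta <= 1 ->
  `|bump (inner Q (z + eta *: basis_vec R i) (z + eta *: basis_vec R i))
      * ((z + eta *: basis_vec R i) *m A) 0 i - bump (inner Q z z) * (z *m A) 0 i
    - eta * (bump (inner Q z z) * A i i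
             + 2 * dbump (inner Q z z) * inner Q z (basis_vec R i) * (z *m A) 0 i)|
  <= C * eta ^+ 2.
Proof.
move=> b0; pose K : R := b.+1%:R.
pose Aa : R := m%:R * b%:R * b%:R; pose W := m%:R * K * Aa.
pose tau : R := 2 * (m%:R ^+ 2 * b%:R * K * 1) + b%:R.
have K0 : 0 <= K by []. have Aa0 : 0 <= Aa by rewrite !mulr_ge0.
have W0 : 0 <= W by rewrite !mulr_ge0.
have tau0 : 0 <= tau by rewrite addr_ge0 // !mulr_ge0.
pose C := 2 * W * b%:R + 2 * tau * Aa + tau ^+ 2 * (W + Aa).
have C0 : 0 <= C by rewrite !addr_ge0 // !mulr_ge0 // ?sqr_ge0 // addr_ge0.
exists C => // Q A z i eta gQ AA /andP[eta0 eta1].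
(* From beyond radius [K], that is b + 1, a step of length at most 1 ends outside the ball of radius
   [b], and every term vanishes. *)
have [zK|zK] := leP `|z| K; last first.
  have zb : b%:R < `|z| by apply: lt_trans zK; rewrite ltr_nat.
  have zb' : b%:R < `|z + eta *: basis_vec R i|.
    have : `|z| <= `|z + eta *: basis_vec R i| + `|eta *: basis_vec R i : 'rV[R]_m|.
      by rewrite -{1}(addrK (eta *: basis_vec R i) z) -[X in _ <= _ + X]normrN ler_normD.
    have : `|eta *: basis_vec R i : 'rV[R]_m| <= 1.
      apply: row_norm_le => // k; rewrite !mxE /= normrM (ger0_norm eta0).
      by case: (_ == _); rewrite ?normr1 ?normr0 ?mulr1 ?mulr0.
    by move: zK; rewrite /K -natr1; lra.
  rewrite (bump_supp b0 gQ zb) (bump_supp b0 gQ zb') (dbump_supp b0 gQ zb).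
  by rewrite !(mulr0, mul0r, subr0, addr0) normr0 mulr_ge0 ?sqr_ge0.
have e1 : `|basis_vec R i : 'rV[R]_m| <= 1.
  by apply: row_norm_le => // k; rewrite !mxE /=; case: (_ == _); rewrite ?normr1 ?normr0.
case: (gQ) => sQ Qb _.
set e := basis_vec R i; set q := inner Q z z; set w := (z *m A) 0 i.
have wW : `|w| <= W.
  apply: le_trans (mx_entry_le _ _ _) _; apply: le_trans (mulmx_norm _ _) _.
  by rewrite ler_pM ?mulr_ge0 // ler_wpM2l.
have Aii : `|A i i| <= Aa by apply: le_trans (mx_entry_le _ _ _) _.
have Qii : `|Q i i| <= b%:R by apply: le_trans (mx_entry_le _ _ _) _.
have -> : ((z + eta *: e) *m A) 0 i = w + eta * A i i.
  by rewrite mulmxDl mxE -scalemxAl -rowE; congr (_ + _); rewrite !mxE.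
set a := inner Q z e.
have ab : `|a| <= m%:R ^+ 2 * b%:R * K * 1.
  by apply: le_trans (inner_norm _ _ _) _; rewrite !ler_pM ?mulr_ge0.
have -> : inner Q (z + eta *: e) (z + eta *: e) = q + (2 * eta * a + eta ^+ 2 * Q i i).
  rewrite !(innerDl, innerDr, innerZl, innerZr) (spd_sym_inner e z sQ) inner_basis -/q -/a.
  by ring.
set t := 2 * eta * a + _.
have tt : `|t| <= eta * tau.
  rewrite /t /tau; apply: le_trans (ler_normD _ _) _; rewrite mulrDr lerD //.
    by rewrite !normrM normr_nat (ger0_norm eta0) -mulrA mulrCA ler_wpM2l // ler_wpM2l.
  by rewrite normrM expr2 normrM (ger0_norm eta0) -mulrA ler_wpM2l // (le_trans (ler_pM _ _ eta1 Qii)) // mul1r.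
have q0 : 0 <= q by exact: spd_ge0.
have dk := dbump_le2 q0.
have kr := bump_taylor q t; set r := _ - _ - _ in kr.
(* Three products remain once the first-order terms are removed, each of order eta ^+ 2; [C] adds up
   their bounds. *)
have -> : bump (q + t) * (w + eta * A i i) - bump q * w
    - eta * (bump q * A i i + 2 * dbump q * a * w) =
   dbump q * w * (eta ^+ 2 * Q i i) + dbump q * t * (eta * A i i) + r * (w + eta * A i i).
  by rewrite /r /t; ring.
have wA : `|w + eta * A i i| <= W + Aa.
  rewrite (le_trans (ler_normD _ _)) // lerD // normrM (ger0_norm eta0).
  by rewrite (le_trans (ler_pM _ _ eta1 Aii)) // mul1r.
have rt : `|r| <= (eta * tau) ^+ 2.
  by apply: le_trans kr _; rewrite -(real_normK (num_real t)) lerXn2r ?nnegrE ?mulr_ge0.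
apply: le_trans (ler_normD _ _) _; apply: le_trans (lerD (ler_normD _ _) (lexx _)) _.
have -> : C * eta ^+ 2 = 2 * W * (eta ^+ 2 * b%:R) + 2 * (eta * tau) * (eta * Aa)
    + (eta * tau) ^+ 2 * (W + Aa) by rewrite /C; ring.
clear kr; clearbody r t; move: (dbump q) dk => dq dk.
rewrite !normrM (ger0_norm eta0) -?expr2.
by rewrite !lerD // !ler_pM ?mulr_ge0 ?sqr_ge0 ?ler_wpM2l ?sqr_ge0.
Qed.

Lemma lavg_shift p F j0 : lavg p (fun j => F (j + j0)) = lavg p F.
Proof. by rewrite /lavg lsum_shift. Qed.

Lemma lavgZ p B F (a : R) : bsupp B F -> lavg p (fun j => a * F j) = a * lavg p F.
Proof. by move=> sF; rewrite /lavg (@lsumZ _ _ B) // mulrCA. Qed.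

Lemma lavgB p B F G : bsupp B F -> bsupp B G ->
  lavg p (fun j => F j - G j) = lavg p F - lavg p G.
Proof. by move=> sF sG; rewrite /lavg (@lsumB _ _ B) // mulrBr. Qed.

Lemma lavg_sum p B (I : Type) (r : seq I) (F : I -> 'rV[int]_m -> R) :
  (forall i, bsupp B (F i)) ->
  lavg p (fun j => \sum_(i <- r) F i j) = \sum_(i <- r) lavg p (F i).
Proof. by move=> sF; rewrite /lavg (@lsum_sum _ _ B) // mulr_sumr. Qed.

Lemma ipt_basis_norm p i : (0 < p)%N -> `|ipt p (delta_mx 0 i)| <= 1.
Proof.
move=> p0; rewrite ipt_basis; apply: row_norm_le => // k; rewrite !mxE /=.
rewrite normrM normfV normr_nat; case: (_ == _); rewrite ?normr1 ?normr0 ?mulr1 ?mulr0 //.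
by rewrite invf_le1 ?ltr0n // ler1n.
Qed.

Lemma sum_trace_inner Q H z : spd Q ->
  \sum_i inner Q z (basis_vec R i) * (z *m (H *m invmx Q)) 0 i = inner H z z.
Proof.
move=> sQ; have E i : inner Q z (basis_vec R i) = (z *m Q) 0 i.
  by rewrite /inner trmx_delta -colE !mxE.
have -> : inner H z z = ((z *m Q) *m (z *m (H *m invmx Q))^T) 0 0.
  rewrite !trmx_mul trmx_inv sQ.1 -mulmxA (mulmxA Q) (mulmxA Q) mulmxV ?spd_unitmx // mul1mx.
  have -> : z *m (H^T *m z^T) = (z *m H *m z^T)^T by rewrite !trmx_mul trmxK mulmxA.
  by rewrite [RHS]mxE.
by rewrite [RHS]mxE; apply: eq_bigr => i _; rewrite E; congr (_ * _); rewrite [RHS]mxE.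
Qed.

(** Discrete integration by parts: the differences of the field in [flux_difference] sum to 0 over
    the lattice. They are of the form eta times the divergence, up to eta ^+ 2, so that division by
    the spacing eta = 1/p leaves an error of order 1/p. *)
Lemma lmass_divergence b : (0 < b)%N -> exists2 C, 0 <= C &
  forall p Q H, (0 < p)%N -> good b Q -> `|H| <= b%:R ->
  `|lavg p (fun j => dbump (inner Q (ipt p j) (ipt p j)) * inner H (ipt p j) (ipt p j))
    + 2^-1 * \tr (H *m invmx Q) * lmass p Q| <= C / p%:R.
Proof.
move=> b0; have [C C0 HC] := flux_difference b0.
exists (2^-1 * (m%:R * C) * (3 * b.+2%:R) ^+ m).
  by rewrite mulr_ge0 ?exprn_ge0 // !mulr_ge0.
move=> p Q H p0 gQ Hb; pose A := H *m invmx Q.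
have [sQ Qb iQb] := gQ.
have p0' : 0 < p%:R :> R by rewrite ltr0n.
have AA : `|A| <= m%:R * b%:R * b%:R.
  by apply: le_trans (mulmx_norm _ _) _; rewrite ler_pM ?mulr_ge0 // ler_wpM2l.
pose eta : R := p%:R^-1.
have eta01 : 0 <= eta <= 1 by rewrite invr_ge0 ler0n invf_le1 // ler1n.
pose q j := inner Q (ipt p j) (ipt p j).
pose Y i j := bump (q j) * (ipt p j *m A) 0 i.
have Ys i : bsupp (b * p) (Y i).
  by apply: ipt_bsupp => // j h; rewrite /Y /q (bump_supp b0 gQ) ?mul0r.
have bump_s : bsupp (b * p) (fun j => bump (q j)).
  by apply: ipt_bsupp => // j h; rewrite /q (bump_supp b0 gQ).
pose D j := dbump (q j) * inner H (ipt p j) (ipt p j).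
have Ds : bsupp (b * p) D.
  by apply: ipt_bsupp => // j h; rewrite /D /q (dbump_supp b0 gQ) ?mul0r.
pose G j := bump (q j) * \tr A + 2 * D j.
have Gs : bsupp (b * p) G by move=> j jb; rewrite /G bump_s // Ds // mul0r mulr0 addr0.
pose del i : 'rV[int]_m := delta_mx 0 i.
have Ys' i : bsupp (b.+1 * p) (fun j => Y i (j + del i)).
  apply: ipt_bsupp => // j h; rewrite /Y /q (bump_supp b0 gQ) ?mul0r //.
  have h1 := ipt_basis_norm i p0.
  have : `|ipt p j| <= `|ipt p (j + del i)| + `|ipt p (del i)|.
    have -> : ipt p j = ipt p (j + del i) - ipt p (del i) by rewrite -iptN -iptD addrK.
    by rewrite -[X in _ <= _ + X]normrN ler_normD.
  by move: h; rewrite -natr1; move: h1; rewrite /del; lra.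
have bb : (b * p <= b.+1 * p)%N by rewrite leq_mul2r leqnSn orbT.
pose E j := \sum_i (Y i (j + del i) - Y i j) - eta * G j.
have EE j : `|E j| <= m%:R * C * eta ^+ 2.
  have -> : E j = \sum_i (Y i (j + del i) - Y i j - eta * (bump (q j) * A i i
             + 2 * dbump (q j) * inner Q (ipt p j) (basis_vec R i) * (ipt p j *m A) 0 i)).
    rewrite /E /G [RHS]sumrB; congr (_ - _); rewrite -mulr_sumr; congr (_ * _).
    rewrite big_split /= -mulr_sumr; congr (_ + _).
    rewrite /D -(sum_trace_inner H _ sQ) mulrA mulr_sumr.
    by apply: eq_bigr => i _; rewrite mulrA.
  apply: le_trans (ler_norm_sum _ _ _) _.
  apply: (@le_trans _ _ (\sum_(i < m) C * eta ^+ 2)); last first.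
    by rewrite sumr_const card_ord -[leLHS]mulr_natl mulrA.
  apply: ler_sum => i _.
  by rewrite /Y /q iptD ipt_basis; exact: HC.
have sumY : lavg p (fun j => \sum_i (Y i (j + del i) - Y i j)) = 0.
  rewrite (@lavg_sum _ (b.+1 * p)%N); last first.
    by move=> i j jb; rewrite Ys' // (bsupp_le bb (Ys i)) // subrr.
  rewrite big1 // => i _; rewrite (@lavgB _ (b.+1 * p)%N) //; last exact: bsupp_le bb (Ys i).
  by rewrite lavg_shift subrr.
have sumYs : bsupp (b.+1 * p) (fun j => \sum_i (Y i (j + del i) - Y i j)).
  by move=> j jb; rewrite big1 // => i _; rewrite Ys' // (bsupp_le bb (Ys i)) // subrr.
have avgE : lavg p E = - (eta * lavg p G).
  rewrite /E (@lavgB _ (b.+1 * p)%N) //; last first.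
    by move=> j jb; rewrite (bsupp_le bb Gs) ?mulr0.
  by rewrite sumY sub0r (@lavgZ _ (b.+1 * p)%N) //; exact: bsupp_le bb Gs.
have avgG : lavg p G = \tr A * lmass p Q + 2 * lavg p D.
  rewrite /G (_ : (fun j => _) = (fun j => \tr A * bump (q j) + 2 * D j)); last first.
    by apply/funext => j; rewrite mulrC.
  rewrite (@lavgE _ (b * p)%N) ?(@lavgZ _ (b * p)%N) //.
  by move=> j jb; rewrite bump_s ?mulr0.
have Ebound : `|lavg p E| <= m%:R * C * eta ^+ 2 * (3 * b.+2%:R) ^+ m.
  apply: lavg_le0 => //; first by rewrite mulr_ge0 ?sqr_ge0 // mulr_ge0.
  have bs : bsupp (b.+2 * p) E.
    move=> j jb; have jb1 : j \notin box m (b.+1 * p).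
      by apply: contra jb; apply: box_subset; rewrite leq_mul2r leqnSn orbT.
    by rewrite /E sumYs // (bsupp_le bb Gs) // mulr0 subr0.
  by move=> j h; apply: bs; rewrite ipt_box // -ltNge.
have -> : lavg p D + 2^-1 * \tr A * lmass p Q = 2^-1 * lavg p G by rewrite avgG; field.
have eta0 : 0 < eta by rewrite invr_gt0.
rewrite -(ler_pM2l eta0); apply: (@le_trans _ _ (2^-1 * `|lavg p E|)).
  by rewrite avgE normrN !normrM (gtr0_norm eta0) (gtr0_norm (_ : 0 < 2^-1 :> R)) ?invr_gt0 // mulrCA.
apply: (@le_trans _ _ (2^-1 * (m%:R * C * eta ^+ 2 * (3 * b.+2%:R) ^+ m))).
  by rewrite ler_wpM2l ?invr_ge0.
by rewrite -/eta le_eqVlt; apply/orP; left; apply/eqP; ring.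
Qed.

(** Jacobi's formula for the derivative of det(Q)^(-1/2), in discrete form. The error is small
    compared with [e] as soon as [e] and 1/p are small; the application has e = 1/p^2. *)
Lemma lmass_diff b : (0 < b)%N -> exists2 C, 0 <= C &
  forall p Q H (e : R), (0 < p)%N -> good b Q -> good b (Q + e *: H) -> `|H| <= b%:R -> 0 <= e ->
  `|lmass p (Q + e *: H) - lmass p Q + e * (2^-1 * \tr (H *m invmx Q) * lmass p Q)|
  <= C * e * (e + p%:R^-1).
Proof.
move=> b0; have [C1 C10 H1] := lmass_taylor b0; have [C2 C20 H2] := lmass_divergence b0.
exists (C1 + C2); first exact: addr_ge0.
move=> p Q H e p0 gQ gQ' Hb e0.
have {}H1 := H1 p Q H e p0 gQ gQ' Hb; have {}H2 := H2 p Q H p0 gQ Hb.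
set D := lavg p _ in H1 H2; set T := 2^-1 * _ * _ in H2 *.
have -> : lmass p (Q + e *: H) - lmass p Q + e * T =
  (lmass p (Q + e *: H) - lmass p Q - e * D) + e * (D + T) by ring.
apply: le_trans (ler_normD _ _) _; rewrite normrM (ger0_norm e0).
apply: le_trans (lerD H1 (ler_wpM2l e0 H2)) _.
have ip : 0 <= p%:R^-1 :> R by rewrite invr_ge0.
rewrite -subr_ge0.
have -> : (C1 + C2) * e * (e + p%:R^-1) - (C1 * e ^+ 2 + e * (C2 / p%:R)) =
  C1 * e * p%:R^-1 + C2 * e * e by ring.
by rewrite addr_ge0 // !mulr_ge0.
Qed.

End LatticeMass.

Section LatticeMassBounds.
Variables (R : realType) (m : nat).
Implicit Types (p b : nat) (Q H : 'M[R]_m) (z v : 'rV[R]_m) (j : 'rV[int]_m)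
  (F : 'rV[int]_m -> R).

Lemma lmass_bsupp b p Q : (0 < b)%N -> (0 < p)%N -> good b Q ->
  bsupp (b * p) (fun j => bump (inner Q (ipt R p j) (ipt R p j))).
Proof. by move=> b0 p0 gQ; apply: ipt_bsupp => // j h; rewrite (bump_supp b0 gQ). Qed.

Lemma lmass_le b p Q : (0 < b)%N -> (0 < p)%N -> good b Q ->
  `|lmass p Q| <= (3 * b%:R) ^+ m.
Proof.
move=> b0 p0 gQ; rewrite -[leRHS]mul1r; apply: lavg_le0 => //.
  move=> j _; have q0 := spd_ge0 (ipt R p j) (let: And3 a _ _ := gQ in a).
  by rewrite ger0_norm ?bump_ge0 // bump_le1.
by move=> j h; rewrite (bump_supp b0 gQ).
Qed.

Lemma lavg_ge p q B j0 (c : R) F : (0 < p)%N -> (0 < q)%N -> 0 <= c ->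
  bsupp B F -> (forall j, 0 <= F j) ->
  (forall j, `|ipt R p (j - j0)| <= q%:R^-1 -> c <= F j) ->
  c * q%:R^-1 ^+ m <= lavg p F.
Proof.
move=> p0 q0 c0 sF F0 Fc.
have p0' : 0 < p%:R :> R by rewrite ltr0n.
have q0' : 0 < q%:R :> R by rewrite ltr0n.
have HF : forall j, j - j0 \in box m (p %/ q) -> c <= F j.
  move=> j; rewrite mem_box => /forallP H; apply: Fc.
  apply: row_norm_le => [|i]; first by rewrite invr_ge0.
  have := H i; rewrite !mxE; move: (j 0 i - j0 0 i) => a ha.
  rewrite normrM normfV normr_nat ler_pdivrMl // ler_pdivlMr // -intr_norm.
  rewrite (_ : q%:R = (q%:Z)%:~R) // (_ : p%:R = (p%:Z)%:~R) // -intrM ler_int.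
  have : ((p %/ q) * q <= p)%N by exact: leq_trunc_div.
  by move: ha; nia.
have h := lsum_count_ge sF F0 HF; rewrite /lavg.
apply: le_trans (ler_wpM2l _ h); last by rewrite exprn_ge0 // invr_ge0.
rewrite mulrCA natrX -exprMn ler_wpM2l // lerXn2r ?nnegrE ?mulr_ge0 ?invr_ge0 //.
rewrite ler_pdivlMl // ler_pdivrMr // -natrM ler_nat.
(* Since (p %/ q).+1 * q exceeds [p], a box of half-width p %/ q has at least p / q points on each
   side. *)
have := ltn_ceil p q0; move: (p %/ q)%N => a h1.
by apply: leq_trans (ltnW h1) _; rewrite ?[(q * _)%N]mulnC leq_mul2r; lia.
Qed.

Lemma lmass_ge b : (0 < b)%N -> exists2 c : R, 0 < c &
  forall p Q, (0 < p)%N -> good b Q -> c <= lmass p Q.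
Proof.
(* On the ball of radius 1/q the form is at most m^2 * b / q^2, hence at most 1/2, where [bump] is
   at least 1/4. *)
move=> b0; pose q := (2 * m.+1 * b)%N; have q0 : (0 < q)%N by rewrite !muln_gt0 b0.
exists (4^-1 * q%:R^-1 ^+ m); first by rewrite mulr_gt0 ?invr_gt0 // exprn_gt0 // invr_gt0 ltr0n.
move=> p Q p0 gQ; apply: (lavg_ge (j0 := 0) p0 q0) (lmass_bsupp b0 p0 gQ) _ _ => //.
  by move=> j; exact: bump_ge0.
move=> j; rewrite subr0 => jq; have [sQ Qb _] := gQ.
apply: bump_ge_quarter; rewrite spd_ge0 //=.
apply: le_trans (ler_norm _) _; apply: le_trans (inner_norm_le Qb jq) _.
have q0' : 0 < q%:R :> R by rewrite ltr0n.
rewrite ler_pdivrMr // ler_pdivrMr //.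
suff : 2 * (m%:R ^+ 2 * b%:R) <= q%:R * q%:R :> R by lra.
by rewrite -natrX -!natrM ler_nat /q; nia.
Qed.

Lemma lmass_lip b : (0 < b)%N -> exists2 C, 0 <= C &
  forall p Q Q', (0 < p)%N -> good b Q -> good b Q' ->
  `|lmass p Q - lmass p Q'| <= C * `|Q - Q'|.
Proof.
move=> b0; exists (2 * (m%:R ^+ 2 * b%:R * b%:R) * (3 * b%:R) ^+ m).
  by rewrite !mulr_ge0 ?exprn_ge0.
move=> p Q Q' p0 gQ gQ'; rewrite /lmass -(@lavgB _ _ _ (b * p)); try exact: lmass_bsupp.
rewrite mulrAC; apply: lavg_le0 => //.
  move=> j jb; have [sQ _ _] := gQ; have [sQ' _ _] := gQ'.
  apply: le_trans (bump_lip (spd_ge0 _ sQ) (spd_ge0 _ sQ')) _.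
  have -> : inner Q (ipt R p j) (ipt R p j) - inner Q' (ipt R p j) (ipt R p j)
      = inner (Q - Q') (ipt R p j) (ipt R p j).
    by rewrite inner_mxD -[- Q']scaleN1r inner_mxZ mulN1r.
  rewrite -[leRHS]mulrA ler_wpM2l //; apply: le_trans (inner_norm _ _ _) _.
  have -> : m%:R ^+ 2 * b%:R * b%:R * `|Q - Q'| = m%:R ^+ 2 * `|Q - Q'| * b%:R * b%:R by ring.
  have h0 : 0 <= m%:R ^+ 2 * `|Q - Q'| by rewrite mulr_ge0 ?sqr_ge0.
  by apply: ler_pM => //; exact: ler_wpM2l.
by move=> j h; rewrite (bump_supp b0 gQ) // (bump_supp b0 gQ') // subr0.
Qed.

Lemma near_lattice p (v : 'rV[R]_m) : (0 < p)%N ->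
  exists j0, `|v - ipt R p j0| <= p%:R^-1.
Proof.
move=> p0; have p0' : 0 < p%:R :> R by rewrite ltr0n.
exists (\row_i Num.floor (p%:R * v 0 i)).
apply: row_norm_le => [|i]; first by rewrite invr_ge0.
rewrite !mxE; have := floor_le (p%:R * v 0 i); have := floorD1_gt (p%:R * v 0 i).
rewrite intrD; move: (Num.floor _)%:~R => a h1 h2.
rewrite -[v 0 i](mulKf (lt0r_neq0 p0')) -mulrBr normrM ger0_norm ?invr_ge0 //.
by rewrite ler_piMr ?invr_ge0 // ler_norml; lra.
Qed.

(* A kernel centred off the lattice has the same mass up to the lattice spacing:
   translate its centre to a lattice point at distance at most [1 / p]. *)
Lemma lmass_center b : (0 < b)%N -> exists2 C, 0 <= C &
  forall p Q v, (0 < p)%N -> good b Q ->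
  `|lavg p (fun j => bump (inner Q (ipt R p j - v) (ipt R p j - v))) - lmass p Q| <= C / p%:R.
Proof.
move=> b0; pose K : R := b.+1%:R.
pose c := 2 * (2 * (m%:R ^+ 2 * b%:R * K * 1) + m%:R ^+ 2 * b%:R * 1 * 1).
have c0 : 0 <= c by rewrite mulr_ge0 // addr_ge0 // !mulr_ge0 ?sqr_ge0.
have hm : 0 <= m%:R ^+ 2 :> R by exact: sqr_ge0.
have K0 : 0 <= K by [].
exists (c * (3 * K) ^+ m); first by rewrite mulr_ge0 // exprn_ge0 // mulr_ge0.
move=> p Q v p0 gQ; have [sQ Qb _] := gQ.
have p0' : 0 < p%:R :> R by rewrite ltr0n.
pose eta : R := p%:R^-1.
have eta0 : 0 <= eta by rewrite invr_ge0.
have eta1 : eta <= 1 by rewrite invf_le1 // ler1n.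
have [j0 sE] := near_lattice v p0; pose s := v - ipt R p j0; rewrite -/s -/eta in sE.
rewrite -(lavg_shift p _ j0).
have -> : (fun j => bump (inner Q (ipt R p (j + j0) - v) (ipt R p (j + j0) - v))) =
          (fun j => bump (inner Q (ipt R p j - s) (ipt R p j - s))).
  apply/funext => j; have -> // : ipt R p (j + j0) - v = ipt R p j - s.
  by rewrite iptD /s opprB addrA addrAC.
clearbody s.
have far j : K < `|ipt R p j| -> b%:R < `|ipt R p j - s|.
  have : `|ipt R p j| <= `|ipt R p j - s| + `|s| by rewrite -{1}(subrK s (ipt R p j)) ler_normD.
  by rewrite /K -natr1; lra.
have far' j : K < `|ipt R p j| -> b%:R < `|ipt R p j| by rewrite /K -natr1; lra.
rewrite /lmass -(@lavgB _ _ _ (b.+1 * p)); last 2 first.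
- by apply: ipt_bsupp => // j /far h; rewrite (bump_supp b0 gQ).
- by apply: ipt_bsupp => // j /far' h; rewrite (bump_supp b0 gQ).
rewrite mulrAC; apply: lavg_le0 => //; first by rewrite mulr_ge0.
  move=> j jb; apply: le_trans (bump_lip (spd_ge0 _ sQ) (spd_ge0 _ sQ)) _.
  set z := ipt R p j.
  have -> : inner Q (z - s) (z - s) - inner Q z z = - (2 * inner Q z s) + inner Q s s.
    rewrite !(innerDl, innerDr, innerNl, innerNr) (spd_sym_inner s z sQ); ring.
  have zs : `|inner Q z s| <= m%:R ^+ 2 * b%:R * K * eta.
    by apply: le_trans (inner_norm _ _ _) _; do 2! (apply: ler_pM => //); exact: ler_wpM2l.
  have ss : `|inner Q s s| <= m%:R ^+ 2 * b%:R * 1 * eta.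
    apply: le_trans (inner_norm _ _ _) _; do 2! (apply: ler_pM => //); first exact: ler_wpM2l.
    exact: le_trans eta1.
  have -> : c / p%:R = 2 * (2 * (m%:R ^+ 2 * b%:R * K * eta) + m%:R ^+ 2 * b%:R * 1 * eta).
    by rewrite /c -/eta; ring.
  rewrite ler_wpM2l // (le_trans (ler_normD _ _)) // lerD //.
  by rewrite normrN normrM normr_nat ler_wpM2l.
by move=> j h; rewrite (bump_supp b0 gQ (far _ h)) (bump_supp b0 gQ (far' _ h)) subr0.
Qed.

End LatticeMassBounds.

(** * Differentiable matrix functions and uniform bounds on compact sets *)

Section MatrixCk.
Variables (R : realType) (m : nat).
Implicit Types (U : set 'rV[R]_m) (x : 'rV[R]_m).

Lemma Ck_on_det k U (p : nat) (G : 'rV[R]_m -> 'M[R]_p) : open U ->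
  Ck_on k U G -> Ck_on k U (fun x => \det (G x)).
Proof.
move=> oU /(Ck_on_mx _ _ oU) CG.
apply: (@Ck_on_sum _ _ R k U _ _ _ (fun (s : {perm 'I_p}) x => (-1) ^+ s * \prod_i G x i (s i)) oU) => s _.
apply: (@Ck_onM _ _ k U (cst ((-1) ^+ s))) => //; first exact: Ck_on_cst.
by apply: Ck_on_prod => // i _; exact: CG.
Qed.

Lemma Ck_on_invmx k U (p : nat) (G : 'rV[R]_m -> 'M[R]_p) : open U ->
  (forall x, U x -> G x \in unitmx) ->
  Ck_on k U G -> Ck_on k U (fun x => invmx (G x)).
Proof.
move=> oU uG CG; apply/Ck_on_mx => // i j.
apply: (@Ck_on_eq _ _ R k U (fun x => (\det (G x))^-1 * cofactor (G x) j i)) => //.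
  by move=> x Ux; rewrite /invmx uG // !mxE.
apply: Ck_onM => //.
  apply: Ck_onV => //; last exact: Ck_on_det.
  by move=> x Ux; rewrite -unitfE -unitmxE; exact: uG.
rewrite /cofactor; apply: (@Ck_onM _ _ k U (cst ((-1) ^+ (j + i)))) => //; first exact: Ck_on_cst.
apply: Ck_on_det => //; apply/Ck_on_mx => // a c.
apply: (@Ck_on_eq _ _ R k U (fun x => G x (lift j a) (lift i c))) => //.
  by move=> x _; rewrite !mxE.
by move/(Ck_on_mx _ _ oU) : CG.
Qed.

Lemma near_good U (G : 'rV[R]_m -> 'M[R]_m) x0 : open U ->
  Ck_on 0 U G -> (forall x, U x -> spd (G x)) -> U x0 ->
  exists2 b, (0 < b)%N & \forall x \near x0, U x /\ good b (G x).
Proof.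
move=> oU CG sG Ux0.
have Ci : Ck_on 0 U (fun x => invmx (G x)).
  by apply: Ck_on_invmx => // x /sG/spd_unitmx.
have near_le (F : 'rV[R]_m -> 'M[R]_m) : Ck_on 0 U F -> \forall x \near x0, `|F x| <= `|F x0| + 1.
  move=> /Ck_on_continuous/(_ x0 Ux0)/cvgrPdist_le/(_ 1 ltr01); apply: filterS => x h.
  by rewrite -[F x](subrK (F x0)) addrC (le_trans (ler_normD _ _)) // lerD2l distrC.
pose b := (Num.truncn (Num.max (`|G x0| + 1) (`|invmx (G x0)| + 1))).+1.
have bE : Num.max (`|G x0| + 1) (`|invmx (G x0)| + 1) <= b%:R.
  exact/ltW/truncnS_gt.
exists b => //; have oN : \forall x \near x0, U x by exact: open_nbhs_nbhs.
apply: filterS (near_and oN (near_and (near_le _ CG) (near_le _ Ci))) => x [Ux [h1 h2]].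
split => //; split; first exact: sG.
  by rewrite (le_trans h1) // (le_trans _ bE) // le_max lexx.
by rewrite (le_trans h2) // (le_trans _ bE) // le_max lexx orbT.
Qed.

Lemma good_le b b' (Q : 'M[R]_m) : (b <= b')%N -> good b Q -> good b' Q.
Proof.
move=> bb' [sQ h1 h2]; have bb : b%:R <= b'%:R :> R by rewrite ler_nat.
by split => //; [exact: le_trans h1 bb|exact: le_trans h2 bb].
Qed.

(** A local bound remains valid for all larger [b], so that compactness in near-covering form, along
    [b] tending to infinity, provides a single one. *)
Lemma compact_good U (K : set 'rV[R]_m) (G : 'rV[R]_m -> 'M[R]_m) : open U ->
  Ck_on 0 U G -> (forall x, U x -> spd (G x)) -> compact K -> K `<=` U ->
  exists2 b, (0 < b)%N & forall x, K x -> good b (G x).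
Proof.
move=> oU CG sG /compact_near_coveringP cK KU.
have : \forall b \near \oo, K `<=` (fun x => (0 < b)%N /\ good b (G x)).
  apply: cK => x /KU Ux; have [b b0 gb] := near_good oU CG sG Ux.
  exists ([set x | U x /\ good b (G x)], [set b' | (b <= b')%N]); first split => //=.
    by exists b.
  move=> [y b'] /= [[_ gy] bb']; split; first exact: leq_trans bb'.
  exact: good_le gy.
case=> B _ HB; exists B.+1 => // x Kx.
by have [] := HB B.+1 (leqnSn B) x Kx.
Qed.

Lemma compact_bounded_nat (K : set 'rV[R]_m) : compact K ->
  exists2 b, (0 < b)%N & forall x, K x -> `|x| <= b%:R.
Proof.
move=> /compact_near_coveringP cK.
have : \forall b \near \oo, K `<=` (fun x => `|x| <= b%:R).
  apply: cK => x Kx; pose b := (Num.truncn (`|x| + 1)).+1.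
  exists (ball x 1, [set b' | (b <= b')%N]).
    by split; [exact: nbhsx_ballx|exists b].
  move=> [y b'] /= [xy bb']; move: xy; rewrite -ball_normE /= => xy.
  have h : `|x| + 1 < b%:R by exact: truncnS_gt.
  have hb : b%:R <= b'%:R :> R by rewrite ler_nat.
  have : `|y| <= `|x - y| + `|x|.
    by rewrite -[X in X + _]normrN opprB -{1}(subrK x y) ler_normD.
  by lra.
case=> B _ HB; exists B.+1 => // x Kx.
exact: (HB B.+1 (leqnSn B) x Kx).
Qed.

End MatrixCk.

(** * Joint limits in the scale and the point *)

Section Eventually.
Variables (T : topologicalType) (x0 : T).
Implicit Types E : nat -> T -> Prop.

(** The limit is joint, for [p] tending to infinity and the point tending to [x0]; this is what
    turns local estimates into uniform ones on a compact set. *)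
Definition ev E := filter_prod \oo (nbhs x0) [set q | E q.1 q.2].

Lemma evS E E' : (forall p x, E p x -> E' p x) -> ev E -> ev E'.
Proof. by move=> EE'; apply: filterS => -[p x]; exact: EE'. Qed.

Lemma evI E E' : ev E -> ev E' -> ev (fun p x => E p x /\ E' p x).
Proof. by move=> h1 h2; apply: filterS (filterI h1 h2) => -[p x]. Qed.

Lemma ev_forall (I : finType) (E : I -> nat -> T -> Prop) :
  (forall i, ev (E i)) -> ev (fun p x => forall i, E i p x).
Proof.
move=> H; suff : filter_prod \oo (nbhs x0) [set q | forall i, E i q.1 q.2] by [].
exact: (@filter_forall _ I (fun i => [set q | E i q.1 q.2]) (filter_prod \oo (nbhs x0)) _ H).
Qed.

Lemma ev_near (P : T -> Prop) : (\forall x \near x0, P x) -> ev (fun _ x => P x).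
Proof. by move=> H; exists (setT, [set x | P x]) => [|[p x] [_]] //; split => //; exact: filterT. Qed.

Lemma ev_oo (P : nat -> Prop) : (\forall p \near \oo, P p) -> ev (fun p _ => P p).
Proof. by move=> H; exists ([set p | P p], setT) => [|[p x] []] //; split => //; exact: filterT. Qed.

End Eventually.

Section EventuallyRow.
Variables (R : realType) (m : nat).
Implicit Types (x : 'rV[R]_m) (K : set 'rV[R]_m).

Lemma near_ball x0 (P : 'rV[R]_m -> Prop) : (\forall x \near x0, P x) ->
  exists2 r : R, 0 < r & forall x, `|x - x0| < r -> P x.
Proof.
move=> /nbhs_ballP[r /= r0 rP]; exists r => // x xr; apply: rP.
by rewrite -ball_normE /= distrC.
Qed.

Lemma ball_near x0 (r : R) (P : 'rV[R]_m -> Prop) : 0 < r ->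
  (forall x, `|x - x0| < r -> P x) -> \forall x \near x0, P x.
Proof.
move=> r0 rP; apply/nbhs_ballP; exists r => // x; rewrite -ball_normE /= distrC.
exact: rP.
Qed.

Lemma near_invn (e : R) : 0 < e -> \forall p \near \oo, (0 < p)%N /\ p%:R^-1 <= e.
Proof.
move=> e0; exists (Num.truncn e^-1).+1 => // p /= Np.
have p0 : (0 < p)%N by exact: leq_trans Np.
have p0' : 0 < p%:R :> R by rewrite ltr0n.
split => //; rewrite -[e]invrK lef_pV2 ?posrE ?invr_gt0 //.
by apply: le_trans (ltW (truncnS_gt _)) _; rewrite ler_nat.
Qed.

(** The estimate reaches points at distance 1/p from [K]: a step of the lattice may start outside a
    support and end inside it. *)
Lemma ev_compact K (E : nat -> 'rV[R]_m -> Prop) : compact K ->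
  (forall x0, K x0 -> ev x0 E) ->
  \forall p \near \oo, forall x, K x -> forall y, `|y - x| <= p%:R^-1 -> E p y.
Proof.
move=> /compact_near_coveringP cK H.
suff : \forall p \near \oo, K `<=` (fun x => forall y, `|y - x| <= p%:R^-1 -> E p y) by [].
apply: cK => x0 /H [[A B] [/= oA nB] AB].
have [r r0 rB] := near_ball nB.
have r2 : 0 < r / 2 by rewrite divr_gt0.
exists (ball x0 (r / 2), [set p | A p /\ ((0 < p)%N /\ p%:R^-1 <= r / 2)]).
  by split; [exact: nbhsx_ballx|apply: filterI => //; exact: near_invn].
move=> [x p] /= [xb [Ap [p0 pr]]] y yx; apply: (AB (p, y)); split => //=; apply: rB.
move: xb; rewrite -ball_normE /= distrC => xb.
have : `|y - x0| <= `|y - x| + `|x - x0| by rewrite -{1}(subrK x y) -addrA ler_normD.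
by lra.
Qed.

Lemma ev_translate x0 (P : 'rV[R]_m -> Prop) (v : nat -> 'rV[R]_m) :
  (forall p, (0 < p)%N -> `|v p| <= p%:R^-1) ->
  (\forall x \near x0, P x) -> ev x0 (fun p x => P (x + v p)).
Proof.
move=> vp /near_ball[r r0 rP].
have r2 : 0 < r / 2 by rewrite divr_gt0.
have near_r : \forall x \near x0, `|x - x0| < r / 2 by exact: (@ball_near _ (r / 2)).
apply: evS (evI (ev_oo x0 (near_invn r2)) (ev_near near_r)) => p x [[p0 pr] xr].
apply: rP; rewrite addrAC (le_lt_trans (ler_normD _ _)) //; have := vp p p0; lra.
Qed.

End EventuallyRow.

(** Discrete quotient rule for X / N. [N] and [N'] stand for the masses at two neighbouring lattice
    points, [tH] and [tD] for the traces obtained from the difference quotient and from the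
    derivative of the metric, [e] for the step, [eta] for 1/p and [th] for a tolerance. *)
Lemma flux_estimate (R : realType) (c C T B : R) : 0 < c -> 0 <= C -> 0 <= T -> 0 <= B ->
  exists2 K, 0 <= K & forall N N' tH tD X X' dX e eta th : R,
  c <= N -> c <= N' -> 0 <= e <= 1 -> 0 <= eta <= 1 -> 0 <= th ->
  `|N' - N + e * (2^-1 * tH * N)| <= C * e * (e + eta) ->
  `|tH| <= T -> `|tH - tD| <= th -> `|X| <= B -> `|dX| <= B -> `|X' - X - e * dX| <= e * th ->
  `|N'^-1 * X' - N^-1 * X - e * (N^-1 * (dX + 2^-1 * tD * X))| <= e * (K * (th + e + eta)).
Proof.
move=> c0 C0 T0 B0; pose L := T / c + 2 * C / (c * c).
have c0' := ltW c0; have cc0 : 0 <= c * c by exact: mulr_ge0.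
have L0 : 0 <= L by apply: addr_ge0; apply: divr_ge0 => //; exact: mulr_ge0.
have ci : 0 <= c^-1 by rewrite invr_ge0 ltW.
pose K := c^-1 + L * B + B * T * L + B * c^-1 + B * (C / (c * c)).
have CC : 0 <= C / (c * c) by exact: divr_ge0.
have K0 : 0 <= K.
  rewrite /K; move: (C / (c * c)) CC => a ha; move: (c^-1) ci => d hd.
  by clearbody L; rewrite !addr_ge0 // !mulr_ge0.
exists K => // N N' tH tD X X' dX e eta th cN cN' /andP[e0 e1] /andP[eta0 eta1] th0.
move=> hN hT hTD hX hdX hX'.
have N0 : 0 < N by exact: lt_le_trans cN.
have N'0 : 0 < N' by exact: lt_le_trans cN'.
set err := _ + _ in hN.
have W : 0 < N^-1 <= c^-1 by rewrite invr_gt0 N0 lef_pV2 ?posrE.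
have W' : 0 < N'^-1 <= c^-1 by rewrite invr_gt0 N'0 lef_pV2 ?posrE.
have dW : N'^-1 - N^-1 = e * (2^-1 * tH) * N'^-1 - N'^-1 * N^-1 * err.
  by rewrite /err; field; rewrite !lt0r_neq0.
have hNN : 0 <= N'^-1 * N^-1 <= (c * c)^-1.
  move/andP: W => [w0 w1]; move/andP: W' => [w0' w1'].
  apply/andP; split; first by rewrite mulr_ge0 // ltW.
  by rewrite invfM; apply: ler_pM => //; exact: ltW.
move: (N^-1) (N'^-1) W W' dW hNN => w w' /andP[w0 w1] /andP[w0' w1'] dW /andP[ww0 ww1].
have herr : `|w' * w * err| <= e * ((C / (c * c)) * (e + eta)).
  rewrite normrM (ger0_norm ww0); apply: le_trans (ler_pM ww0 (normr_ge0 _) ww1 hN) _.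
  by rewrite le_eqVlt; apply/orP; left; apply/eqP; ring.
have hdW : `|w' - w| <= e * L.
  rewrite dW; apply: le_trans (ler_normB _ _) _; rewrite /L [leRHS]mulrDr; apply: lerD.
    rewrite !normrM (ger0_norm e0) (gtr0_norm w0') -mulrA ler_wpM2l //.
    rewrite ler_pM // ?(ltW w0') //.
    rewrite (gtr0_norm (_ : 0 < 2^-1 :> R)) ?invr_gt0 //; move: hT (normr_ge0 tH); lra.
  apply: le_trans herr _; rewrite ler_wpM2l //.
  have -> : 2 * C / (c * c) = C / (c * c) * 2 by ring.
  by rewrite ler_wpM2l //; lra.
(* Each term of this decomposition is [e] times a small quantity, because [dW] isolates the
   first-order part of the increment of the inverse mass. *)
have -> : w' * X' - w * X - e * (w * (dX + 2^-1 * tD * X)) =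
  w' * (X' - X - e * dX) + e * (w' - w) * dX
  + X * (e * (2^-1 * tH) * (w' - w) + e * (2^-1 * (tH - tD)) * w - w' * w * err).
  have -> : w' * w * err = e * (2^-1 * tH) * w' - (w' - w) by rewrite dW; ring.
  by ring.
have b1 : `|w' * (X' - X - e * dX)| <= e * (c^-1 * th).
  by rewrite normrM (gtr0_norm w0') mulrCA ler_pM // ltW.
have b2 : `|e * (w' - w) * dX| <= e * (L * B * e).
  rewrite !normrM (ger0_norm e0) -mulrA ler_wpM2l //.
  have -> : L * B * e = e * L * B by ring.
  exact: ler_pM.
have b3 : `|e * (2^-1 * tH) * (w' - w)| <= e * (T * L * e).
  rewrite !normrM (ger0_norm e0) -mulrA ler_wpM2l //.
  have -> : T * L * e = T * (e * L) by ring.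
  rewrite ler_pM ?mulr_ge0 //.
  rewrite (gtr0_norm (_ : 0 < 2^-1 :> R)) ?invr_gt0 //; move: hT (normr_ge0 tH); lra.
have b4 : `|e * (2^-1 * (tH - tD)) * w| <= e * (c^-1 * th).
  rewrite !normrM (ger0_norm e0) -mulrA ler_wpM2l // (gtr0_norm w0) mulrC ler_pM ?mulr_ge0 // ?(ltW w0) //.
  rewrite (gtr0_norm (_ : 0 < 2^-1 :> R)) ?invr_gt0 //; move: hTD (normr_ge0 (tH - tD)); lra.
have b5 : `|X * (e * (2^-1 * tH) * (w' - w) + e * (2^-1 * (tH - tD)) * w - w' * w * err)| <=
   B * (e * (T * L * e) + e * (c^-1 * th) + e * ((C / (c * c)) * (e + eta))).
  rewrite normrM ler_pM //; apply: le_trans (ler_normB _ _) _; rewrite lerD //.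
  by apply: le_trans (ler_normD _ _) _; rewrite lerD.
apply: le_trans (ler_normD _ _) _; apply: le_trans (lerD (ler_normD _ _) b5) _.
apply: le_trans (lerD (lerD b1 b2) (lexx _)) _.
rewrite -subr_ge0.
have -> : e * (K * (th + e + eta)) - (e * (c^-1 * th) + e * (L * B * e) +
   B * (e * (T * L * e) + e * (c^-1 * th) + e * (C / (c * c) * (e + eta)))) =
  e * (c^-1 * (e + eta) + L * B * (th + eta) + B * T * L * (th + eta) + B * c^-1 * (e + eta) + B * (C / (c * c)) * th).
  by rewrite /K; ring.
clearbody L; move: (C / (c * c)) CC => a ha; move: (c^-1) ci => d hd.
by rewrite mulr_ge0 // !addr_ge0 // !mulr_ge0 // addr_ge0.
Qed.

(** * Lattice sums of divergences *)

Section DivergenceInChart.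
Variables (R : realType) (m : nat).
Implicit Types (U K : set 'rV[R]_m) (x : 'rV[R]_m).

Notation "\d_ i u" := ('D_(basis_vec R i) u) (at level 10, i at level 2, u at level 9).

(** The lattice is finer than the bumps, whose radius is of order 1/p: a bump spans about [p] steps,
    while one step moves a C^1 metric by order 1/p^2 only. *)
Definition mesh (p : nat) : R := (p ^ 2)%:R^-1.

Lemma mesh_gt0 p : (0 < p)%N -> 0 < mesh p.
Proof. by move=> p0; rewrite invr_gt0 ltr0n expn_gt0 p0. Qed.

Lemma mesh_le p : (0 < p)%N -> mesh p <= p%:R^-1.
Proof.
move=> p0; rewrite /mesh lef_pV2 ?posrE ?ltr0n ?expn_gt0 ?p0 // ler_nat.
by rewrite expnS expn1 leq_pmulr.
Qed.

Lemma invn_le1 p : p%:R^-1 <= 1 :> R.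
Proof. by case: p => [|p]; [rewrite invr0|rewrite invf_le1 ?ltr0n // ler1n]. Qed.

Lemma mesh_basis_norm p i : (0 < p)%N -> `|mesh p *: basis_vec R i : 'rV[R]_m| <= p%:R^-1.
Proof.
move=> p0; apply: le_trans (norm_scale_basis _ _) _.
by rewrite gtr0_norm ?mesh_gt0 // mesh_le.
Qed.

Lemma ev_strict U u x0 i (d : R) : open U -> Ck_on 1 U u -> U x0 -> 0 < d ->
  ev x0 (fun p x => `|u (x + mesh p *: basis_vec R i) - u x - mesh p * \d_ i u x0| <= mesh p * d).
Proof.
move=> oU Cu Ux0 d0; have [r r0 sd] := C1_strict_diff oU Cu Ux0 d0.
have near_r : \forall x \near x0, `|x - x0| < r by exact: (@ball_near _ _ _ r).
have h := ev_translate (v := fun p => mesh p *: basis_vec R i) (fun p => @mesh_basis_norm p i) near_r.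
apply: evS (evI (ev_oo x0 (near_invn (ltr01 : 0 < (1 : R)))) (evI h (ev_near near_r))).
move=> p x [[p0 _] [yr xr]]; have [_] := sd _ _ xr yr.
have -> : x + mesh p *: basis_vec R i - x = mesh p *: basis_vec R i by rewrite addrAC subrr add0r.
rewrite sum_scale_basis => /le_trans; apply.
rewrite mulrC ler_pM2r //; apply: le_trans (norm_scale_basis _ _) _.
by rewrite gtr0_norm ?mesh_gt0.
Qed.

Lemma mxtrace_norm (A : 'M[R]_m) : `|\tr A| <= m%:R * `|A|.
Proof.
apply: le_trans (ler_norm_sum _ _ _) _.
apply: le_trans (ler_sum _ (fun i _ => mx_entry_le A i i)) _.
by rewrite sumr_const card_ord mulr_natl.
Qed.

Variables (U : set 'rV[R]_m) (G : 'rV[R]_m -> 'M[R]_m) (X : 'rV[R]_m -> 'rV[R]_m).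

(* [weight p] is the discrete substitute for the Riemannian density [sqrt (det G)]:
   it has the same logarithmic derivative in the limit, and it changes in the same
   way under a change of chart. *)
Definition weight p x : R := (lmass p (G x))^-1.

(* Divergence for the density [sqrt (det G)], whose logarithmic derivative along
   [v] is [2^-1 * \tr ('D_v G x *m invmx (G x))]. *)
Definition coord_div i x : R :=
  \d_ i (fun y => X y 0 i) x + 2^-1 * \tr ('D_(basis_vec R i) G x *m invmx (G x)) * X x 0 i.

Definition chart_div x : R := \sum_i coord_div i x.

Definition flux p i x : R := weight p x * X x 0 i.

Hypotheses (oU : open U) (CG : Ck_on 1 U G) (sG : forall x, U x -> spd (G x)).
Hypothesis CX : Ck_on 1 U X.

Lemma continuous_near_le (u : 'rV[R]_m -> R) x0 (d : R) : {for x0, continuous u} -> 0 < d ->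
  \forall x \near x0, `|u x - u x0| <= d.
Proof.
by move=> /cvgrPdist_le cu d0; apply: filterS (cu d d0) => x; rewrite distrC.
Qed.

Lemma continuous_near_mx (p q : nat) (F : 'rV[R]_m -> 'M[R]_(p, q)) x0 (d : R) :
  {for x0, continuous F} -> 0 < d -> \forall x \near x0, `|F x - F x0| <= d.
Proof.
by move=> /cvgrPdist_le cu d0; apply: filterS (cu d d0) => x; rewrite distrC.
Qed.

(** The variation of the weight accounts for the trace term of [coord_div], by [lmass_diff], and
    that of the field for the other term. Near [x0] all bounds hold with one [b]. *)
Lemma flux_step_local i x0 (e : R) : U x0 -> 0 < e ->
  ev x0 (fun p x => `|flux p i (x + mesh p *: basis_vec R i) - flux p i x
                      - mesh p * (weight p x * coord_div i x)| <= mesh p * e).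
Proof.
move=> Ux0 e0; have [b1 b10 gb1] := near_good oU (Ck_onW CG) sG Ux0.
pose D := 'D_(basis_vec R i) G; pose D0 := D x0.
pose b := (b1 + (Num.truncn (`|D0| + 1)).+1)%N.
have b0 : (0 < b)%N by rewrite addn_gt0 b10.
have D0b : `|D0| + 1 <= b%:R.
  by rewrite (le_trans (ltW (truncnS_gt _))) // ler_nat leq_addl.
have gb : \forall x \near x0, U x /\ good b (G x).
  by apply: filterS gb1 => x [Ux g]; split => //; apply: good_le g; rewrite leq_addr.
have [c c0 Hc] := @lmass_ge R m _ b0.
have [C C0 HC] := @lmass_diff R m _ b0.
have CXi := (Ck_on_mx _ _ oU).1 CX 0 i.
pose xi x := X x 0 i; pose dxi := \d_ i xi.
pose B := Num.max `|xi x0| `|dxi x0| + 1.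
have B1 : 1 <= B by rewrite lerDr le_max normr_ge0.
pose T : R := m%:R * (m%:R * b%:R * b%:R).
have T0 : 0 <= T by rewrite !mulr_ge0.
have [K K0 HK] := flux_estimate c0 C0 T0 (le_trans ler01 B1).
(* [th] will bound the mesh, the spacing 1/p and the approximation errors at the same time, whence
   the factor 3. *)
pose th := Num.min 1 (e / (3 * (K + 1))).
have K1 : 0 < K + 1 by rewrite ltr_wpDl.
have th0 : 0 < th by rewrite lt_min ltr01 divr_gt0 // mulr_gt0.
have th1 : th <= 1 by rewrite ge_min lexx.
have thK : K * (th + th + th) <= e.
  have : th * (3 * (K + 1)) <= e by rewrite -ler_pdivlMr ?mulr_gt0 // ge_min lexx orbT.
  nra.
(* Tolerance on the variation of the metric: the traces taken with [H] and with [D x] will differ by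
   at most 2 * d * (m * m * b), which stays below [th]. *)
pose d := th / (2 * (T + 1)).
have T1 : 0 < T + 1 by rewrite ltr_wpDl.
have d0 : 0 < d by rewrite divr_gt0 // mulr_gt0.
have dT : 2 * d * (m%:R * m%:R * b%:R) <= th.
  have : d * (2 * (T + 1)) = th by rewrite divfK // lt0r_neq0 // mulr_gt0.
  have b1' : 1 <= b%:R :> R by rewrite ler1n.
  have : m%:R * m%:R * b%:R <= T.
    by rewrite /T -mulrA mulrA; have : 0 <= m%:R * m%:R * b%:R :> R by []; nra.
  nra.
have d1 : d <= 1.
  have : d * (2 * (T + 1)) = th by rewrite divfK // lt0r_neq0 // mulr_gt0.
  nra.
have th2 : 0 < th / 2 by rewrite divr_gt0.
have cD : {for x0, continuous D} := Ck_on_continuous (Ck_on_partial i CG) Ux0.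
have cx : {for x0, continuous xi} := Ck_on_continuous CXi Ux0.
have cdx : {for x0, continuous dxi} := Ck_on_continuous (Ck_on_partial i CXi) Ux0.
have evG : ev x0 (fun p x => forall kl : 'I_m * 'I_m,
  `|G (x + mesh p *: basis_vec R i) kl.1 kl.2 - G x kl.1 kl.2 - mesh p * D0 kl.1 kl.2| <= mesh p * d).
  apply: ev_forall => -[k l] /=.
  have Ckl := (Ck_on_mx _ _ oU).1 CG k l.
  have -> : D0 k l = \d_ i (fun y => G y k l) x0.
    by rewrite /D0 /D derive_mx ?mxE //; exact: Ck_on_derivable CG Ux0.
  exact: (ev_strict i oU Ckl Ux0 d0).
have gb' := ev_translate (v := fun p => mesh p *: basis_vec R i) (fun p => @mesh_basis_norm p i) gb.
apply: evS (evI (evI (ev_oo x0 (near_invn th0)) (evI (ev_near gb) gb'))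
  (evI (evI evG (ev_strict i oU CXi Ux0 th2))
  (evI (evI (ev_near (continuous_near_le cx ltr01)) (ev_near (continuous_near_le cdx ltr01)))
  (evI (ev_near (continuous_near_le cdx th2)) (ev_near (continuous_near_mx cD d0)))))).
move=> p x [[[p0 pth] [[Ux gx] [Uy gy]]] [[hG hX] [[hx1 hdx1] [hdx hD]]]].
set y := x + mesh p *: basis_vec R i in Uy gy hG hX *.
have ep0 := mesh_gt0 p0; have ep1 : mesh p <= th by rewrite (le_trans (mesh_le p0)).
(* The difference quotient makes [G y] exactly [G x + mesh p *: H], the form that [lmass_diff]
   requires; passing to the derivative [D x] costs 2 * d. *)
pose H := (mesh p)^-1 *: (G y - G x).
have GH : G y = G x + mesh p *: H by rewrite /H scalerA divff ?lt0r_neq0 // scale1r addrC subrK.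
have HD0 : `|H - D0| <= d.
  apply: mx_norm_le => [|k l]; first exact: ltW.
  rewrite /H !mxE; have := hG (k, l) => /=.
  have -> : G y k l - G x k l - mesh p * D0 k l = mesh p * ((mesh p)^-1 * (G y k l - G x k l) - D0 k l).
    by rewrite mulrBr mulVKf // lt0r_neq0.
  by rewrite normrM (gtr0_norm ep0) ler_pM2l.
have Hb : `|H| <= b%:R.
  apply: le_trans D0b; rewrite -[H](subrK D0) (le_trans (ler_normD _ _)) // addrC lerD2l.
  exact: le_trans d1.
have [_ _ ib] := gx.
have HDx : `|H - D x| <= 2 * d.
  have -> : H - D x = (H - D0) - (D x - D0) by rewrite opprB addrA subrK.
  by rewrite (le_trans (ler_normB _ _)) // mulr2n mulrDl mul1r lerD.
apply: le_trans (HK (lmass p (G x)) (lmass p (G y)) (\tr (H *m invmx (G x)))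
   (\tr (D x *m invmx (G x))) (xi x) (xi y) (dxi x) (mesh p) p%:R^-1 th _ _ _ _ _ _ _ _ _ _ _) _.
- exact: Hc.
- exact: Hc.
- by rewrite (ltW ep0) (le_trans ep1).
- by rewrite invr_ge0 ler0n invn_le1.
- exact: ltW.
- by rewrite GH; apply: HC => //; [rewrite -GH|exact: ltW].
- apply: le_trans (mxtrace_norm _) _; rewrite ler_wpM2l //.
  by apply: le_trans (mulmx_norm _ _) _; rewrite ler_pM // ler_wpM2l.
- rewrite -linearB /= -mulmxBl; apply: le_trans (mxtrace_norm _) _.
  apply: le_trans dT; apply: le_trans (ler_wpM2l _ (mulmx_norm _ _)) _ => //.
  have -> : 2 * d * (m%:R * m%:R * b%:R) = m%:R * (m%:R * (2 * d) * b%:R) by ring.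
  by rewrite ler_wpM2l // ler_pM // ler_wpM2l.
- rewrite -[xi x](subrK (xi x0)) (le_trans (ler_normD _ _)) // addrC /B lerD //.
  by rewrite le_max lexx.
- rewrite -[dxi x](subrK (dxi x0)) (le_trans (ler_normD _ _)) // addrC /B lerD //.
  by rewrite le_max lexx orbT.
- have -> : xi y - xi x - mesh p * dxi x =
    (xi y - xi x - mesh p * dxi x0) - mesh p * (dxi x - dxi x0) by ring.
  apply: le_trans (ler_normB _ _) _; rewrite (splitr th) [leRHS]mulrDr; apply: lerD => //.
  by rewrite normrM (gtr0_norm ep0) ler_pM2l.
rewrite ler_pM2l //; apply: le_trans thK; rewrite ler_wpM2l // !lerD //.
Qed.

End DivergenceInChart.

Section DivergenceSum.
Variables (R : realType) (m : nat).
Implicit Types (x : 'rV[R]_m).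
Variables (U K : set 'rV[R]_m) (G : 'rV[R]_m -> 'M[R]_m) (X : 'rV[R]_m -> 'rV[R]_m).
Hypotheses (oU : open U) (CG : Ck_on 1 U G) (sG : forall x, U x -> spd (G x)).
Hypothesis CX : Ck_on 1 U X.
Hypotheses (cK : compact K) (KU : K `<=` U) (X0 : forall x, ~ K x -> X x = 0).

Lemma coord_div_eq0 i x : ~ K x -> coord_div G X i x = 0.
Proof.
move=> nK; have cl : closed K by apply: compact_closed cK; exact: norm_hausdorff.
rewrite /coord_div X0 // mxE mulr0 addr0.
rewrite (_ : 'D_(basis_vec R i) (fun y => X y 0 i) x = 'D_(basis_vec R i) (cst (0 : R)) x).
  exact: derive_cst.
apply: near_eq_derive; apply: (@open_near _ (~` K)) => //; first by rewrite openC.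
by move=> y Ky; rewrite X0 // mxE.
Qed.

Lemma chart_div_eq0 x : ~ K x -> chart_div G X x = 0.
Proof. by move=> nK; rewrite /chart_div big1 // => i _; exact: coord_div_eq0. Qed.

(** The fluxes telescope to 0, and at each lattice point their differences equal the mesh times
    weight times divergence up to [mesh R p * e'] in every direction. Only points near [K]
    contribute, so that division by the mesh leaves a multiple of [e'] independent of [p]. *)
Lemma sum_chart_div_small (e : R) : 0 < e -> \forall p \near \oo,
  `|lavg (p ^ 2) (fun j => weight G p (ipt R (p ^ 2) j) * chart_div G X (ipt R (p ^ 2) j))| <= e.
Proof.
move=> e0; have [b b0 Kb] := compact_bounded_nat cK.
pose B : R := (3 * b.+1%:R) ^+ m.
have B0 : 0 < B by rewrite exprn_gt0 // mulr_gt0 // ltr0n.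
pose e' := e / (m.+1%:R * B).
have e'0 : 0 < e' by rewrite divr_gt0 // mulr_gt0 // ltr0n.
pose step i p x := flux G X p i (x + mesh R p *: basis_vec R i) - flux G X p i x
                      - mesh R p * (weight G p x * coord_div G X i x).
have est : \forall p \near \oo, forall x, K x -> forall y, `|y - x| <= p%:R^-1 ->
    forall i, `|step i p y| <= mesh R p * e'.
  apply: ev_compact => // x0 /KU Ux0; apply: ev_forall => i. apply: (flux_step_local oU CG sG CX i Ux0 e'0).
apply: filterS (filterI est (near_invn (ltr01 : 0 < (1 : R)))) => p [Hp [p0 _]].
have ep0 := mesh_gt0 R p0.
have pp0 : (0 < p ^ 2)%N by rewrite expn_gt0 p0.
have pi1 := @invn_le1 R p.
pose y (j : 'rV[int]_m) := ipt R (p ^ 2) j.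
have stepE i x : ~ K x -> ~ K (x + mesh R p *: basis_vec R i) -> step i p x = 0.
  move=> nx ny; rewrite /step /flux coord_div_eq0 // !X0 // !mxE !mulr0 !subr0 //.
have step_le i x : `|step i p x| <= mesh R p * e'.
  have h0 : 0 <= mesh R p * e' by rewrite mulr_ge0 // ltW.
  have [Kx|nx] := pselect (K x).
    by apply: (Hp x Kx); rewrite subrr normr0 invr_ge0.
  have [Ky|ny] := pselect (K (x + mesh R p *: basis_vec R i)).
    apply: (Hp _ Ky); rewrite opprD addrA subrr add0r normrN.
    exact: mesh_basis_norm.
  by rewrite stepE // normr0.
have far i x : b.+1%:R < `|x| -> ~ K x /\ ~ K (x + mesh R p *: basis_vec R i).
  rewrite -natr1 => xb; split => [/Kb|/Kb]; first lra.
  have := mesh_basis_norm R i p0.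
  have : `|x| <= `|x + mesh R p *: basis_vec R i| + `|mesh R p *: basis_vec R i : 'rV[R]_m|.
    by rewrite -{1}(addrK (mesh R p *: basis_vec R i) x) ler_normB.
  lra.
pose bb := (b.+1 * p ^ 2)%N.
have supp (F : 'rV[int]_m -> R) : (forall j, b.+1%:R < `|y j| -> F j = 0) -> bsupp bb F.
  by move=> HF; exact: ipt_bsupp.
pose fl i j := flux G X p i (y j); pose fl' i j := flux G X p i (y j + mesh R p *: basis_vec R i).
have sfl i : bsupp bb (fl i).
  by apply: supp => j /(far i)[nx _]; rewrite /fl /flux X0 // mxE mulr0.
have sfl' i : bsupp bb (fl' i).
  by apply: supp => j /(far i)[_ ny]; rewrite /fl' /flux X0 // mxE mulr0.
have fl'E i : fl' i = (fun j => fl i (j + delta_mx 0 i)).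
  by apply/funext => j; rewrite /fl' /fl /y iptD ipt_basis.
have telescope : lavg (p ^ 2) (fun j => \sum_i (fl' i j - fl i j)) = 0.
  rewrite (@lavg_sum _ _ _ bb); last by move=> i j jb; rewrite sfl ?sfl' // subrr.
  by apply: big1 => i _; rewrite (@lavgB _ _ _ bb) // fl'E lavg_shift subrr.
have sdiv : bsupp bb (fun j => weight G p (y j) * chart_div G X (y j)).
  apply: supp => j jb; rewrite /chart_div big1 ?mulr0 // => i _.
  by rewrite coord_div_eq0 //; have [] := far i _ jb.
have sstep : bsupp bb (fun j => \sum_i step i p (y j)).
  apply: supp => j jb; rewrite big1 // => i _.
  by have [h1 h2] := far i _ jb; rewrite stepE.
have E : lavg (p ^ 2) (fun j => \sum_i step i p (y j)) =
   - (mesh R p * lavg (p ^ 2) (fun j => weight G p (y j) * chart_div G X (y j))).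
  rewrite (_ : (fun j => _) = (fun j => \sum_i (fl' i j - fl i j)
      - mesh R p * (weight G p (y j) * chart_div G X (y j)))).
    rewrite (@lavgB _ _ _ bb) ?telescope ?sub0r ?(@lavgZ _ _ _ bb) //.
      by move=> j jb; rewrite big1 // => i _; rewrite sfl ?sfl' // subrr.
    by move=> j jb; rewrite sdiv ?mulr0.
  apply/funext => j; rewrite /step /chart_div sumrB; congr (_ - _).
  by rewrite !mulr_sumr.
rewrite -(ler_pM2l ep0) -(gtr0_norm ep0) -normrM (gtr0_norm ep0) -normrN -E.
apply: le_trans (lavg_le0 (b := b.+1) (c := m%:R * (mesh R p * e')) _ _ _ _ _) _ => //.
- by rewrite mulr_ge0 // mulr_ge0 // ltW.
- move=> j _; apply: le_trans (ler_norm_sum _ _ _) _.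
  apply: le_trans (ler_sum _ (fun i _ => step_le i (y j))) _.
  by rewrite sumr_const card_ord mulr_natl.
- by move=> j jb; rewrite big1 // => i _; have [h1 h2] := far i _ jb; rewrite stepE.
have -> : m%:R * (mesh R p * e') * (3 * b.+1%:R) ^+ m = mesh R p * (m%:R * e' * B) by rewrite /B; ring.
rewrite ler_pM2l //.
have e'E : e = m.+1%:R * e' * B.
  by rewrite /e' mulrAC mulrC divfK // lt0r_neq0 // mulr_gt0 // ltr0n.
rewrite [leRHS]e'E ler_pM2r // ler_pM2r // ler_nat //.
Qed.

End DivergenceSum.

(** * Independence of the chart *)

Lemma ler_pM4 (R : realType) (a b c d a' b' c' d' : R) :
  0 <= a -> 0 <= b -> 0 <= c -> 0 <= d -> a <= a' -> b <= b' -> c <= c' -> d <= d' ->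
  a * b * c * d <= a' * b' * c' * d'.
Proof.
move=> a0 b0 c0 d0 ha hb hc hd.
by apply: ler_pM (ler_pM _ _ (ler_pM _ _ ha hb) hc) hd; rewrite ?mulr_ge0.
Qed.

Lemma prod4_diff (R : realType) (M t a1 a2 a3 a4 b1 b2 b3 b4 : R) :
  `|a1| <= M -> `|a2| <= M -> `|a3| <= M -> `|b2| <= M -> `|b3| <= M -> `|b4| <= M ->
  `|a4| <= M -> `|b1| <= M ->
  `|a1 - b1| <= t -> `|a2 - b2| <= t -> `|a3 - b3| <= t -> `|a4 - b4| <= t ->
  `|a1 * a2 * a3 * a4 - b1 * b2 * b3 * b4| <= 4 * M ^+ 3 * t.
Proof.
move=> ha1 ha2 ha3 hb2 hb3 hb4 ha4 hb1 h1 h2 h3 h4.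
have -> : a1 * a2 * a3 * a4 - b1 * b2 * b3 * b4 =
  (a1 - b1) * (a2 * a3 * a4) + (a2 - b2) * (b1 * a3 * a4)
  + (a3 - b3) * (b1 * b2 * a4) + (a4 - b4) * (b1 * b2 * b3) by ring.
have term x p q r : `|x| <= t -> `|p| <= M -> `|q| <= M -> `|r| <= M ->
    `|x * (p * q * r)| <= t * M ^+ 3.
  move=> hx hp hq hr; rewrite normrM; apply: ler_pM => //.
  rewrite !normrM; have -> : M ^+ 3 = M * M * M by ring.
  by rewrite ler_pM // ?mulr_ge0 // ler_pM.
have -> : 4 * M ^+ 3 * t = t * M ^+ 3 + t * M ^+ 3 + t * M ^+ 3 + t * M ^+ 3 by ring.
by do 3! (apply: le_trans (ler_normD _ _) _; apply: lerD; last exact: term); exact: term.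
Qed.

Lemma compact_bounded_fun (R : realType) (m : nat) (K : set 'rV[R]_m) (u : 'rV[R]_m -> R) :
  compact K -> (forall x, K x -> {for x, continuous u}) ->
  exists2 M : R, 0 <= M & forall x, K x -> `|u x| <= M.
Proof.
move=> /compact_near_coveringP cK cu.
have : \forall b \near \oo, K `<=` (fun x => `|u x| <= b%:R).
  apply: cK => x Kx; pose b := (Num.truncn (`|u x| + 1)).+1.
  exists ([set y | `|u y - u x| <= 1], [set b' | (b <= b')%N]).
    by split; [exact: continuous_near_le (cu x Kx) ltr01|exists b].
  move=> [y b'] /= [xy bb'].
  have h : `|u x| + 1 < b%:R by exact: truncnS_gt.
  have hb : b%:R <= b'%:R :> R by rewrite ler_nat.
  have : `|u y| <= `|u y - u x| + `|u x| by rewrite -{1}(subrK (u x) (u y)) ler_normD.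
  by lra.
case=> B _ HB; exists B%:R => // x Kx.
exact: (HB B (leqnn B) x Kx).
Qed.

Section ChangeOfChart.
Variables (R : realType) (m : nat).
Implicit Types (x y z u : 'rV[R]_m).
Variables (Ua Ub Oa Ob Sa Sb : set 'rV[R]_m) (Ga Gb : 'rV[R]_m -> 'M[R]_m).
Variables (theta sigma : 'rV[R]_m -> 'rV[R]_m) (va vb : 'rV[R]_m -> R).
Hypotheses (oUa : open Ua) (oUb : open Ub) (oOa : open Oa) (oOb : open Ob).
Hypotheses (OUa : Oa `<=` Ua) (OUb : Ob `<=` Ub).
Hypotheses (CGa : Ck_on 0 Ua Ga) (sGa : forall x, Ua x -> spd (Ga x)).
Hypotheses (CGb : Ck_on 0 Ub Gb) (sGb : forall x, Ub x -> spd (Gb x)).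
Hypotheses (thetaO : forall x, Oa x -> Ob (theta x)).
Hypotheses (thetaK : forall x, Oa x -> sigma (theta x) = x).
Hypothesis ctheta : forall x, Oa x -> {for x, continuous theta}.
Hypothesis Csigma : Ck_on 1 Ob sigma.
Hypothesis isom : forall y u, Ob y ->
  inner (Gb y) u u = inner (Ga (sigma y)) ('D_u sigma y) ('D_u sigma y).
Hypotheses (cSa : compact Sa) (SOa : Sa `<=` Oa) (va0 : forall x, ~ Sa x -> va x = 0).
Hypotheses (cSb : compact Sb) (SOb : Sb `<=` Ob) (vb0 : forall x, ~ Sb x -> vb x = 0).
Hypotheses (va_ge0 : forall x, 0 <= va x) (vb_ge0 : forall x, 0 <= vb x).
Hypothesis cva : forall x, Oa x -> {for x, continuous va}.
Hypothesis vab : forall y, Ob y -> vb y = va (sigma y).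

(** For fixed [x], the product of the last two factors has average close to 1 in [y], wherever
    [theta x] lies relative to the lattice ([lmass_center]); averaging over [y] returns the weighted
    [va]. [kernel_b] is the mirror image, and each of the two measures distances with the metric at
    its own centre. *)
Definition kernel_a p x y : R :=
  va x * weight Ga p x * weight Gb p (theta x)
  * bump (inner (Gb (theta x)) (p%:R *: (y - theta x)) (p%:R *: (y - theta x))).

Definition kernel_b p x y : R :=
  vb y * weight Ga p (sigma y) * weight Gb p y
  * bump (inner (Ga (sigma y)) (p%:R *: (x - sigma y)) (p%:R *: (x - sigma y))).

Lemma derive_sigma y u : Ob y ->
  'D_u sigma y = \row_i \sum_k u 0 k * 'D_(basis_vec R k) (fun z => sigma z 0 i) y.
Proof.
move=> Oy; have Ci i := (Ck_on_mx _ _ oOb).1 Csigma 0 i.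
rewrite derive_mx; last first.
  by apply/derivable_mxP => i j; rewrite !ord1; have [] := C1_derive u oOb (Ci j) Oy.
by apply/rowP => i; rewrite [LHS]mxE [RHS]mxE (C1_deriveE _ oOb (Ci i) Oy).
Qed.

(** At scale 1/p the map [sigma] is close to its differential [L], which is an isometry, so that the
    two quadratic forms nearly agree; the other factors agree by continuity. Nothing is said beyond
    radius [b], where [kernel_a] will vanish. *)
Lemma kernel_local b x0 (e : R) : Oa x0 -> 0 < e ->
  ev x0 (fun p x => forall y, `|p%:R *: (y - theta x)| <= b%:R -> kernel_a p x y - kernel_b p x y <= e).
Proof.
move=> Ox0 e0; pose y0 := theta x0.
have Oy0 : Ob y0 by exact: thetaO.
have sy0 : sigma y0 = x0 by exact: thetaK.
have [ba ba0 nga] := near_good oUa CGa sGa (OUa Ox0).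
have [bb bb0 ngb] := near_good oUb CGb sGb (OUb Oy0).
pose b1 := (ba + bb)%N.
have b10 : (0 < b1)%N by rewrite addn_gt0 ba0.
have {}nga : \forall x \near x0, good b1 (Ga x).
  by apply: filterS nga => x [_]; apply: good_le; rewrite leq_addr.
have {}ngb : \forall x \near y0, good b1 (Gb x).
  by apply: filterS ngb => x [_]; apply: good_le; rewrite leq_addl.
have [c c0 Hc] := @lmass_ge R m _ b10.
have [C C0 HC] := @lmass_lip R m _ b10.
have Ci i := (Ck_on_mx _ _ oOb).1 Csigma 0 i.
pose dsig i k := 'D_(basis_vec R k) (fun z => sigma z 0 i) y0.
pose Lam : R := \sum_i \sum_k `|dsig i k|.
have Lam0 : 0 <= Lam by apply: sumr_ge0 => i _; apply: sumr_ge0.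
pose L u : 'rV[R]_m := \row_i \sum_k u 0 k * dsig i k.
have Lnorm u : `|L u| <= Lam * `|u|.
  apply: row_norm_le => [|i]; first exact: mulr_ge0.
  rewrite mxE; apply: le_trans (ler_norm_sum _ _ _) _.
  apply: (@le_trans _ _ (\sum_k `|dsig i k| * `|u|)).
    by apply: ler_sum => k _; rewrite normrM mulrC ler_wpM2l // row_coord_le.
  rewrite -mulr_suml ler_wpM2r // /Lam [leRHS](bigD1 i) //= lerDl.
  by apply: sumr_ge0 => l _; apply: sumr_ge0.
(* [M] bounds each of the four factors of either kernel, as [prod4_diff] requires. *)
pose M : R := 1 + (`|va x0| + 1) + c^-1.
have ci : 0 < c^-1 by rewrite invr_gt0.
have M1 : 1 <= M by rewrite /M; move: (normr_ge0 (va x0)) ci; lra.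
have Mva : `|va x0| + 1 <= M by rewrite /M; move: ci; lra.
have Mc : c^-1 <= M by rewrite /M; move: (normr_ge0 (va x0)); lra.
pose m2 : R := m%:R ^+ 2.
have m20 : 0 <= m2 by exact: sqr_ge0.
pose b' : R := b%:R; have b'0 : 0 <= b' by [].
(* Sum of the coefficients of [d] in the bounds of the four terms into which [s1 - s2] is split
   below. *)
pose Q : R := m2 * 1 * b' * b' + m2 * 1 * (Lam * b') * (Lam * b')
   + 2 * (m2 * b1%:R * (Lam * b') * b') + m2 * b1%:R * b' * b'.
have Q0 : 0 <= Q by rewrite /Q; clearbody m2 Lam b'; rewrite !addr_ge0 // !mulr_ge0.
pose D := 2 + 2 * C * c^-1 * c^-1 + 2 * Q.
have D0 : 2 <= D.
  have : 0 <= 2 * C * c^-1 * c^-1 by rewrite !mulr_ge0 // ltW.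
  by rewrite /D; move: Q0; lra.
have DC : 2 * C * c^-1 * c^-1 <= D by rewrite /D; move: Q0; lra.
have DQ : 2 * Q <= D.
  have : 0 <= 2 * C * c^-1 * c^-1 by rewrite !mulr_ge0 // ltW.
  by rewrite /D; lra.
have M3 : 0 < 4 * M ^+ 3 * D.
  by rewrite mulr_gt0 ?mulr_gt0 ?exprn_gt0 // ?(lt_le_trans _ M1) // (lt_le_trans _ D0).
pose d := Num.min 1 (e / (4 * M ^+ 3 * D)).
have d0 : 0 < d by rewrite lt_min ltr01 divr_gt0.
have d1 : d <= 1 by rewrite ge_min lexx.
have de : 4 * M ^+ 3 * (D * d) <= e.
  by rewrite mulrA mulrC -ler_pdivlMr // ge_min lexx orbT.
have nxa : \forall x \near x0, [/\ good b1 (Ga x), `|Ga x - Ga x0| <= d & `|va x - va x0| <= d].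
  have h1 := continuous_near_mx (Ck_on_continuous CGa (OUa Ox0)) d0.
  have h2 := continuous_near_le (cva Ox0) d0.
  by apply: filterS (near_and nga (near_and h1 h2)) => x [g [h h']].
have csig : {for y0, continuous sigma} := Ck_on_continuous Csigma Oy0.
have nyb : \forall y \near y0, [/\ Ob y, good b1 (Gb y), `|Gb y - Gb y0| <= d &
   [/\ good b1 (Ga (sigma y)), `|Ga (sigma y) - Ga x0| <= d & `|va (sigma y) - va x0| <= d]].
  have h1 := continuous_near_mx (Ck_on_continuous CGb (OUb Oy0)) d0.
  have h2 : \forall y \near y0, [/\ good b1 (Ga (sigma y)), `|Ga (sigma y) - Ga x0| <= d & `|va (sigma y) - va x0| <= d].
    have nxa' := nxa; rewrite -{1}sy0 in nxa'.
    exact: (csig _ nxa').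
  have h3 : \forall y \near y0, Ob y by exact: open_nbhs_nbhs.
  by apply: filterS (near_and (near_and h3 ngb) (near_and h1 h2)) => y [[? ?] [? ?]].
have [r1 r10 Hr1] := near_ball nyb.
have strict : exists2 r2, 0 < r2 & forall y y', `|y - y0| < r2 -> `|y' - y0| < r2 ->
    `|sigma y' - sigma y - L (y' - y)| <= d * `|y' - y|.
  have : forall i, exists r, 0 < r /\ forall y y', `|y - y0| < r -> `|y' - y0| < r ->
    `|sigma y' 0 i - sigma y 0 i - \sum_k (y' - y) 0 k * dsig i k| <= d * `|y' - y|.
    move=> i; have [r r0 Hr] := C1_strict_diff oOb (Ci i) Oy0 d0; exists r; split => // y y' h h'.
    by have [] := Hr y y' h h'.
  move=> /choice[r Hr]; pose r2 := \big[Num.min/1]_i r i.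
  exists r2 => [|y y' hy hy'].
    by rewrite /r2; elim/big_ind: _ => // [a a' h h'|i _]; [rewrite lt_min h|have [] := Hr i].
  apply: row_norm_le => [|i]; first by rewrite mulr_ge0 // ltW.
  have r2i : r2 <= r i by rewrite /r2; apply: (@bigmin_inf _ _ _ _ i).
  have [_ /(_ y y')] := Hr i; rewrite !mxE; apply.
    exact: lt_le_trans hy r2i.
  exact: lt_le_trans hy' r2i.
have [r2 r20 Hr2] := strict.
pose r := Num.min r1 r2 / 2.
have r0 : 0 < r by rewrite divr_gt0 // lt_min r10.
have rr1 : r + r <= r1 by rewrite -splitr ge_min lexx.
have rr2 : r + r <= r2 by rewrite -splitr ge_min lexx orbT.
have nth : \forall x \near x0, `|theta x - y0| < r.
  have := ctheta Ox0 => /cvgrPdist_lt/(_ r r0); apply: filterS => x; by rewrite distrC.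
have rb : 0 < r / (b' + 1) by rewrite divr_gt0 // ltr_wpDl.
have nO : \forall x \near x0, Oa x by exact: open_nbhs_nbhs.
apply: evS (evI (ev_oo x0 (near_invn rb)) (evI (ev_near nO) (evI (ev_near nth) (ev_near nxa)))).
move=> p x [[p0 pr] [Ox [xr [gx hGx hvx]]]] y hy.
have p0' : 0 < p%:R :> R by rewrite ltr0n.
have ytheta : `|y - theta x| < r.
  have : `|y - theta x| <= p%:R^-1 * b'.
    by rewrite ler_pdivlMl //; move: hy; rewrite normrZ normr_nat.
  move=> /le_lt_trans; apply; apply: (@le_lt_trans _ _ (r / (b' + 1) * b')).
    by rewrite ler_wpM2r.
  by rewrite -mulrA gtr_pMr // mulrC ltr_pdivrMr ?ltr_wpDl // mul1r ltrDl.
have yy0 : `|y - y0| < r + r.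
  have -> : y - y0 = (y - theta x) + (theta x - y0) by rewrite addrA subrK.
  by rewrite (le_lt_trans (ler_normD _ _)) // ltrD.
have ty0 : `|theta x - y0| < r + r by rewrite (lt_le_trans xr) // lerDl ltW.
have [Oy gby hby [gay hay hvy]] := Hr1 y (lt_le_trans yy0 rr1).
have [_ gbt hbt _] := Hr1 (theta x) (lt_le_trans ty0 rr1).
have hs := Hr2 y (theta x) (lt_le_trans yy0 rr2) (lt_le_trans ty0 rr2).
rewrite thetaK // in hs.
pose dd := p%:R *: (theta x - y).
have ddb : `|dd| <= b' by rewrite /dd -opprB scalerN normrN.
(* [eta] is the magnified error of the linearization of [sigma]. Strict differentiability gives it
   the bound d * b', because the magnified displacement [dd] is bounded by [b']. *)
pose eta := p%:R *: (x - sigma y) - L dd.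
have LZ (a : R) u : L (a *: u) = a *: L u.
  by apply/rowP => i; rewrite !mxE mulr_sumr; apply: eq_bigr => k _; rewrite mxE mulrA.
have etaE : `|eta| <= d * b'.
  rewrite /eta /dd LZ -scalerBr normrZ normr_nat.
  apply: (@le_trans _ _ (p%:R * (d * `|theta x - y|))); first by rewrite ler_wpM2l.
  by rewrite mulrCA ler_pM2l //; move: ddb; rewrite /dd normrZ normr_nat.
have xE : p%:R *: (x - sigma y) = L dd + eta by rewrite /eta [RHS]addrC subrK.
have yE : p%:R *: (y - theta x) = - dd by rewrite /dd -scalerN opprB.
have Ldd : `|L dd| <= Lam * b' by apply: le_trans (Lnorm _) _; rewrite ler_wpM2l.
clearbody eta dd.
pose s1 := inner (Gb (theta x)) dd dd.
pose s2 := inner (Ga (sigma y)) (L dd + eta) (L dd + eta).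
have key : inner (Gb y0) dd dd = inner (Ga x0) (L dd) (L dd).
  by rewrite isom // derive_sigma // sy0.
have s12 : `|s1 - s2| <= Q * d.
  have -> : s1 - s2 = inner (Gb (theta x) - Gb y0) dd dd
     - inner (Ga (sigma y) - Ga x0) (L dd) (L dd)
     - 2 * inner (Ga (sigma y)) (L dd) eta - inner (Ga (sigma y)) eta eta.
    rewrite /s1 /s2 !inner_mxD -[- Gb y0]scaleN1r -[- Ga x0]scaleN1r !inner_mxZ key.
    rewrite !(innerDl, innerDr) (spd_sym_inner eta (L dd)); last by have [] := gay.
    by ring.
  have i1 := inner_norm (Gb (theta x) - Gb y0) dd dd.
  have i2 := inner_norm (Ga (sigma y) - Ga x0) (L dd) (L dd).
  have i3 := inner_norm (Ga (sigma y)) (L dd) eta.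
  have i4 := inner_norm (Ga (sigma y)) eta eta.
  have [_ gayb _] := gay.
  apply: le_trans (ler_normB _ _) _; apply: le_trans (lerD (ler_normB _ _) i4) _.
  apply: le_trans (lerD (lerD (ler_normB _ _) (lexx _)) (lexx _)) _.
  apply: le_trans (lerD (lerD (lerD i1 i2) (lexx _)) (lexx _)) _.
  rewrite -/m2 in i1 i2 i3 i4 *; rewrite normrM normr_nat.
  have -> : Q * d = m2 * d * b' * b' + m2 * d * (Lam * b') * (Lam * b')
     + 2 * (m2 * b1%:R * (Lam * b') * (d * b')) + m2 * b1%:R * b' * (d * b') by rewrite /Q; ring.
  apply: lerD; [apply: lerD; [apply: lerD|]|].
  - exact: ler_pM4.
  - exact: ler_pM4.
  - by rewrite ler_wpM2l // (le_trans i3) //; exact: ler_pM4.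
  - apply: ler_pM4 => //; apply: le_trans etaE _; rewrite ler_piMl //.
have w_le (Q' : 'M[R]_m) : good b1 Q' -> `|(lmass p Q')^-1| <= M.
  move=> g; have h := Hc p Q' p0 g; have l0 : 0 < lmass p Q' by exact: lt_le_trans h.
  by apply: le_trans Mc; rewrite gtr0_norm ?invr_gt0 // lef_pV2 ?posrE.
have w_diff (Q1 Q2 : 'M[R]_m) : good b1 Q1 -> good b1 Q2 -> `|Q1 - Q2| <= d + d ->
    `|(lmass p Q1)^-1 - (lmass p Q2)^-1| <= D * d.
  move=> g1 g2 h; have h1 := Hc p Q1 p0 g1; have h2 := Hc p Q2 p0 g2.
  have l1 : 0 < lmass p Q1 by exact: lt_le_trans h1.
  have l2 : 0 < lmass p Q2 by exact: lt_le_trans h2.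
  have -> : (lmass p Q1)^-1 - (lmass p Q2)^-1 =
     (lmass p Q2 - lmass p Q1) * (lmass p Q1)^-1 * (lmass p Q2)^-1.
    by field; rewrite !lt0r_neq0.
  apply: (@le_trans _ _ (2 * C * c^-1 * c^-1 * d)); last by rewrite ler_wpM2r // ltW.
  have -> : 2 * C * c^-1 * c^-1 * d = C * (d + d) * c^-1 * c^-1 by ring.
  have i1 : 0 <= (lmass p Q1)^-1 <= c^-1 by rewrite ltW ?invr_gt0 //= lef_pV2 ?posrE.
  have i2 : 0 <= (lmass p Q2)^-1 <= c^-1 by rewrite ltW ?invr_gt0 //= lef_pV2 ?posrE.
  move/andP: i1 => [i1 i1']; move/andP: i2 => [i2 i2'].
  rewrite !normrM (ger0_norm i1) (ger0_norm i2); 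
  have hN : `|lmass p Q2 - lmass p Q1| <= C * (d + d).
    by rewrite distrC; apply: le_trans (HC p Q1 Q2 p0 g1 g2) _; rewrite ler_wpM2l.
  exact: ler_pM (mulr_ge0 (normr_ge0 _) i1) i2 (ler_pM (normr_ge0 _) i1 hN i1') i2'.
have near2 (T : normedModType R) (a a0 a' : T) : `|a - a0| <= d -> `|a' - a0| <= d -> `|a - a'| <= d + d.
  move=> h h'; have -> : a - a' = (a - a0) - (a' - a0) by rewrite opprB addrA subrK.
  by rewrite (le_trans (ler_normB _ _)) // lerD.
have dD : d + d <= D * d by rewrite -mulr2n -mulr_natl ler_wpM2r // ltW.
have s10 : 0 <= s1 by apply: spd_ge0; have [] := gbt.
have s20 : 0 <= s2 by apply: spd_ge0; have [] := gay.
apply: le_trans (ler_norm _) _; apply: le_trans de.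
rewrite /kernel_a /kernel_b vab // xE yE innerNl innerNr opprK -/s1 -/s2.
apply: prod4_diff.
- rewrite -[va x](subrK (va x0)); apply: le_trans (ler_normD _ _) _.
  by apply: le_trans Mva; rewrite addrC lerD2l; exact: le_trans hvx d1.
- exact: w_le.
- exact: w_le.
- exact: w_le.
- exact: w_le.
- by rewrite ger0_norm ?bump_ge0 // (le_trans _ M1) // bump_le1.
- by rewrite ger0_norm ?bump_ge0 // (le_trans _ M1) // bump_le1.
- rewrite -[va (sigma y)](subrK (va x0)); apply: le_trans (ler_normD _ _) _.
  by apply: le_trans Mva; rewrite addrC lerD2l; exact: le_trans hvy d1.
- by apply: le_trans dD; apply: (near2 R^o) hvx hvy.
- by apply: w_diff => //; exact: near2 hGx hay.
- by apply: w_diff => //; exact: near2 hbt hby.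
apply: le_trans (bump_lip s10 s20) _; apply: (@le_trans _ _ (2 * (Q * d))).
  by rewrite ler_wpM2l.
by rewrite mulrA ler_wpM2r // ltW.
Qed.

Lemma bump_kernel_bsupp b p (Q : 'M[R]_m) z : (0 < p)%N -> (0 < b)%N -> good b Q -> `|z| <= b%:R ->
  bsupp ((p.+1 * b) * p)
    (fun k => bump (inner Q (ipt R p k - p%:R *: z) (ipt R p k - p%:R *: z))).
Proof.
move=> p0 b0 gQ zb; apply: ipt_bsupp => // k hk; apply: (bump_supp b0 gQ).
have : `|ipt R p k| <= `|ipt R p k - p%:R *: z| + `|p%:R *: z|.
  by rewrite -{1}(subrK (p%:R *: z) (ipt R p k)) ler_normD.
move: hk; rewrite [`|p%:R *: z|]normrZ normr_nat natrM -natr1.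
by have : p%:R * `|z| <= p%:R * b%:R by [rewrite ler_wpM2l]; lra.
Qed.

(** Magnified [p] times, the lattice of spacing 1/p^2 becomes the one of spacing 1/p on which
    [lmass] is computed. *)
Lemma ipt_square p (j : 'rV[int]_m) : (0 < p)%N -> p%:R *: ipt R (p ^ 2) j = ipt R p j.
Proof.
move=> p0; rewrite /ipt scalerA; congr (_ *: _); rewrite natrX expr2 invfM mulrA divff ?mul1r //.
by rewrite pnatr_eq0 -lt0n.
Qed.

Lemma ler_lavg q B (F F' : 'rV[int]_m -> R) : bsupp B F -> bsupp B F' ->
  (forall j, F j <= F' j) -> lavg q F <= lavg q F'.
Proof.
by move=> sF sF' FF'; rewrite /lavg ler_wpM2l ?exprn_ge0 ?invr_ge0 //; exact: ler_lsum sF sF' FF'.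
Qed.

(** Both sums are replaced by double sums of kernels, whose order is then exchanged. Only an
    inequality results: far from [theta x] the sole information on [kernel_b] is its sign, which is
    enough since [kernel_a] vanishes there. The reverse inequality comes from exchanging the
    charts. *)
Lemma lattice_sum_chart_le (e : R) : 0 < e -> \forall p \near \oo,
  lavg (p ^ 2) (fun j => va (ipt R (p ^ 2) j) * weight Ga p (ipt R (p ^ 2) j))
  - lavg (p ^ 2) (fun j => vb (ipt R (p ^ 2) j) * weight Gb p (ipt R (p ^ 2) j)) <= e.
Proof.
move=> e0.
have [n1 n10 Hn1] := compact_bounded_nat cSa; have [n2 n20 Hn2] := compact_bounded_nat cSb.
have [n3 n30 Hn3] := compact_good oUa CGa sGa cSa (subset_trans SOa OUa).
have [n4 n40 Hn4] := compact_good oUb CGb sGb cSb (subset_trans SOb OUb).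
have [M M0 HM] := compact_bounded_fun cSa (fun x Sx => cva (SOa Sx)).
pose b := (n1 + n2 + n3 + n4)%N.
have b0 : (0 < b)%N by rewrite !addn_gt0 n10.
have bSa x : Sa x -> `|x| <= b%:R.
  by move=> /Hn1/le_trans; apply; rewrite ler_nat /b -!addnA leq_addr.
have bSb x : Sb x -> `|x| <= b%:R.
  by move=> /Hn2/le_trans; apply; rewrite ler_nat /b -!addnA addnCA leq_addr.
have ga x : Sa x -> good b (Ga x).
  by move=> /Hn3; apply: good_le; rewrite /b addnAC leq_addl.
have gb x : Sb x -> good b (Gb x).
  by move=> /Hn4; apply: good_le; rewrite /b leq_addl.
have SaE x : va x != 0 -> [/\ Sa x, Oa x & Sb (theta x)].
  move=> vx; have Sx : Sa x by apply: contrapT => /va0 h; rewrite h eqxx in vx.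
  have Ox := SOa Sx; split => //; apply: contrapT => /vb0.
  by rewrite vab ?thetaK //; [move=> h; rewrite h eqxx in vx|exact: thetaO].
have SbE y : vb y != 0 -> [/\ Sb y, Ob y & Sa (sigma y)].
  move=> vy; have Sy : Sb y by apply: contrapT => /vb0 h; rewrite h eqxx in vy.
  have Oy := SOb Sy; split => //; apply: contrapT => /va0.
  by rewrite -vab //; move=> h; rewrite h eqxx in vy.
have [c c0 Hc] := @lmass_ge R m _ b0.
have [C C0 HC] := @lmass_center R m _ b0.
pose P3 : R := (3 * b%:R) ^+ m; pose P4 : R := (3 * b.+1%:R) ^+ m.
have P30 : 0 <= P3 by rewrite exprn_ge0 // mulr_ge0.
have P40 : 0 <= P4 by rewrite exprn_ge0 // mulr_ge0.
have ci : 0 < c^-1 by rewrite invr_gt0.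
have ci0 := ltW ci.
pose C1 := M * c^-1 * c^-1 * C * P3.
have C10 : 0 <= C1 by rewrite /C1; clearbody P3; rewrite !mulr_ge0.
(* The error is shared as e / 4 + e / 2 + e / 4: [e1] bounds 1/p in the two errors of centring, [e2]
   bounds the difference of the kernels. *)
pose e1 := e / (4 * (C1 + 1)).
have C11 : 0 < C1 + 1 by rewrite ltr_wpDl.
have e10 : 0 < e1 by rewrite divr_gt0 // mulr_gt0.
have He1 : C1 * e1 <= e / 4.
  have : e1 * (4 * (C1 + 1)) = e by rewrite divfK // lt0r_neq0 // mulr_gt0.
  nra.
pose e2 := e / (2 * (P4 * P3 + 1)).
have PP : 0 < P4 * P3 + 1 by rewrite ltr_wpDl // mulr_ge0.
have e20 : 0 < e2 by rewrite divr_gt0 // mulr_gt0.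
have He2 : e2 * P4 * P3 <= e / 2.
  have : e2 * (2 * (P4 * P3 + 1)) = e by rewrite divfK // lt0r_neq0 // mulr_gt0.
  by rewrite -mulrA; move: (P4 * P3) (mulr_ge0 P40 P30) => PQ; nra.
have loc : \forall p \near \oo, forall x, Sa x -> forall x', `|x' - x| <= p%:R^-1 ->
   forall y, `|p%:R *: (y - theta x')| <= b%:R -> kernel_a p x' y - kernel_b p x' y <= e2.
  by apply: ev_compact => // x0 /SOa Ox0; exact: kernel_local.
clearbody e1 e2 b.
clear n1 n2 n3 n4 n10 n20 n30 n40 Hn1 Hn2 Hn3 Hn4.
apply: filterS (filterI loc (near_invn e10)) => p [Hloc [p0 pe1]]; clear loc.
have p0' : 0 < p%:R :> R by rewrite ltr0n.
have pp0 : (0 < p ^ 2)%N by rewrite expn_gt0 p0.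
pose y (j : 'rV[int]_m) := ipt R (p ^ 2) j.
have yE j z : ipt R p j - p%:R *: z = p%:R *: (y j - z) by rewrite scalerBr ipt_square.
have wpos (Q : 'M[R]_m) : good b Q -> 0 < (lmass p Q)^-1 <= c^-1.
  move=> g; have h := Hc p Q p0 g; have l0 : 0 < lmass p Q by exact: lt_le_trans h.
  by rewrite invr_gt0 l0 lef_pV2 ?posrE.
pose BB := ((p.+1 * b) * p)%N.
have bBB : (b * p ^ 2 <= BB)%N.
  by rewrite /BB expnS expn1 mulnA (mulnC b) leq_mul2r leq_mul2r leqnSn !orbT.
pose A := lavg (p ^ 2) (fun j => va (y j) * weight Ga p (y j)).
pose B := lavg (p ^ 2) (fun j => vb (y j) * weight Gb p (y j)).
pose ka j k := kernel_a p (y j) (y k); pose kb j k := kernel_b p (y j) (y k).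
have center (Q : 'M[R]_m) z : good b Q -> `|z| <= b%:R ->
  `|lavg p (fun k => bump (inner Q (p%:R *: (y k - z)) (p%:R *: (y k - z)))) - lmass p Q| <= C / p%:R.
  move=> gQ zb; under eq_fun do rewrite -yE.
  exact: HC.
have scenter (Q : 'M[R]_m) z : good b Q -> `|z| <= b%:R ->
  bsupp BB (fun k => bump (inner Q (p%:R *: (y k - z)) (p%:R *: (y k - z)))).
  move=> gQ zb; under eq_fun do rewrite -yE.
  exact: bump_kernel_bsupp.
have box2 j : j \notin box m BB -> b%:R < `|y j|.
  move=> jB; have : j \notin box m (b * p ^ 2) by apply: contra jB; exact: box_subset.
  by rewrite (ipt_box R) // -ltNge.
have va_out j : b%:R < `|y j| -> va (y j) = 0.
  by move=> h; apply: va0 => /bSa; rewrite leNgt h.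
have vb_out j : b%:R < `|y j| -> vb (y j) = 0.
  by move=> h; apply: vb0 => /bSb; rewrite leNgt h.
have ska j : bsupp BB (ka j).
  have [v0|/SaE[Sx Ox Sy]] := eqVneq (va (y j)) 0; first by move=> k _; rewrite /ka /kernel_a v0 !mul0r.
  move=> k kB; rewrite /ka /kernel_a.
  by have -> := scenter _ _ (gb _ Sy) (bSb _ Sy) k kB; rewrite mulr0.
have skb k : bsupp BB (kb ^~ k).
  have [v0|/SbE[Sy Oy Sx]] := eqVneq (vb (y k)) 0; first by move=> j _; rewrite /kb /kernel_b v0 !mul0r.
  move=> j jB; rewrite /kb /kernel_b.
  by have -> := scenter _ _ (ga _ Sx) (bSa _ Sx) j jB; rewrite mulr0.
have ska' j : j \notin box m BB -> forall k, ka j k = 0.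
  by move=> /box2/va_out h k; rewrite /ka /kernel_a h !mul0r.
have skb' k : k \notin box m BB -> forall j, kb j k = 0.
  by move=> /box2/vb_out h j; rewrite /kb /kernel_b h !mul0r.
have lavg0 q (F : 'rV[int]_m -> R) : (forall k, F k = 0) -> lavg q F = 0.
  by move=> F0; rewrite /lavg lsum_eq0 ?mulr0.
(* The inner average is divided by p^m and not by p^(2m): only about p^m points of the lattice lie
   within 1/p of a given point. *)
pose A' := lavg (p ^ 2) (fun j => lavg p (ka j)).
pose B' := lavg (p ^ 2) (fun k => lavg p (kb ^~ k)).
have main_err (v : R) (Q1 Q2 : 'M[R]_m) z : 0 <= v <= M -> good b Q1 -> good b Q2 -> `|z| <= b%:R ->
   `|v * (lmass p Q1)^-1 - lavg p (fun k => v * (lmass p Q1)^-1 * (lmass p Q2)^-1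
       * bump (inner Q2 (p%:R *: (y k - z)) (p%:R *: (y k - z))))| <= M * c^-1 * c^-1 * (C / p%:R).
  move=> /andP[v0 vM] g1 g2 zb.
  rewrite (lavgZ _ _ (scenter _ _ g2 zb)).
  have /andP[h1 h1'] := wpos _ g1; have /andP[h2 h2'] := wpos _ g2.
  have l2 : lmass p Q2 != 0 by rewrite -invr_eq0 lt0r_neq0.
  set la := lavg p _.
  have -> : v / lmass p Q1 - v / lmass p Q1 / lmass p Q2 * la =
     v * (lmass p Q1)^-1 * (lmass p Q2)^-1 * (lmass p Q2 - la).
    by rewrite mulrBr; congr (_ - _); rewrite divfK.
  rewrite !normrM (ger0_norm v0) (gtr0_norm h1) (gtr0_norm h2).
  by apply: ler_pM4 => //; rewrite ?(ltW h1) ?(ltW h2) // distrC; exact: center.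
have errP3 : M * c^-1 * c^-1 * (C / p%:R) * P3 <= e / 4.
  apply: le_trans He1; rewrite /C1.
  have -> : M / c / c * (C / p%:R) * P3 = M / c / c * C * P3 * p%:R^-1 by ring.
  by rewrite ler_wpM2l.
have er0 : 0 <= M * c^-1 * c^-1 * (C / p%:R) by rewrite !mulr_ge0 // invr_ge0.
have AA' : `|A - A'| <= e / 4.
  rewrite /A /A' -(@lavgB _ _ _ BB); last 2 first.
  - by move=> j /box2/va_out ->; rewrite mul0r.
  - by move=> j jB; apply: lavg0 => k; exact: ska'.
  apply: le_trans errP3; apply: lavg_le0 => //.
    move=> j jb; have [v0|/SaE[Sx Ox Sy]] := eqVneq (va (y j)) 0.
      by rewrite v0 mul0r lavg0 ?subr0 ?normr0 // => k; rewrite /ka /kernel_a v0 !mul0r.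
    apply: main_err; [|exact: ga|exact: gb|exact: bSb].
    by rewrite va_ge0 (le_trans (ler_norm _)) // HM.
  move=> j /va_out v0; rewrite v0 mul0r lavg0 ?subr0 // => k.
  by rewrite /ka /kernel_a v0 !mul0r.
have BB' : `|B - B'| <= e / 4.
  rewrite /B /B' -(@lavgB _ _ _ BB); last 2 first.
  - by move=> k /box2/vb_out ->; rewrite mul0r.
  - by move=> k kB; apply: lavg0 => j; exact: skb'.
  apply: le_trans errP3; apply: lavg_le0 => //.
    move=> k kb0; have [v0|/SbE[Sy Oy Sx]] := eqVneq (vb (y k)) 0.
      by rewrite v0 mul0r lavg0 ?subr0 ?normr0 // => j; rewrite /kb /kernel_b v0 !mul0r.
    rewrite (_ : kb^~ k = (fun j => vb (y k) * (lmass p (Gb (y k)))^-1 * (lmass p (Ga (sigma (y k))))^-1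
       * bump (inner (Ga (sigma (y k))) (p%:R *: (y j - sigma (y k))) (p%:R *: (y j - sigma (y k)))))); last first.
      by apply/funext => j; rewrite /kb /kernel_b /weight; congr (_ * _); exact: mulrAC.
    apply: main_err; [|exact: gb|exact: ga|exact: bSa].
    by rewrite vb_ge0 vab // (le_trans (ler_norm _)) // HM.
  move=> k /vb_out v0; rewrite v0 mul0r lavg0 ?subr0 // => j.
  by rewrite /kb /kernel_b v0 !mul0r.
have B'E : B' = lavg (p ^ 2) (fun j => lavg p (kb j)).
  rewrite /B' /lavg.
  have sumZ q (F : 'rV[int]_m -> 'rV[int]_m -> R) : (forall j, j \notin box m BB -> forall k, F j k = 0) ->
     lsum (fun j => q * lsum (F j)) = q * lsum (fun j => lsum (F j)).
    by move=> HF; apply: (@lsumZ _ _ BB) => j /HF h; rewrite lsum_eq0.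
  rewrite (sumZ _ (fun k j => kb j k)) // [in RHS](@lsumZ _ _ BB); last first.
    by move=> j jB; rewrite lsum_eq0 // => k; exact: skb.
  congr (_ * (_ * _)); apply: (@exchange_lsum _ _ BB BB) => [k /skb'|j jB k] //.
  exact: skb.
have diff : A' - B' <= e / 2.
  clear AA' BB' errP3 er0 main_err center scenter.
  rewrite B'E /A' -(@lavgB _ _ _ BB); last 2 first.
  - by move=> j jB; apply: lavg0 => k; exact: ska'.
  - by move=> j jB; apply: lavg0 => k; exact: skb.
  pose h j := if `|y j| <= b%:R then e2 * P4 else 0.
  have eP : 0 <= e2 * P4 by rewrite mulr_ge0 // ltW.
  apply: (@le_trans _ _ (lavg (p ^ 2) h)); last first.
    apply: le_trans He2; apply: le_trans (ler_norm _) _; apply: lavg_le0 => // j hj.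
      by rewrite /h hj ger0_norm.
    by rewrite /h leNgt hj.
  apply: (@ler_lavg _ BB).
  - move=> j jB; rewrite !lavg0 ?subr0 // => k; [exact: skb|exact: ska'].
  - by move=> j /box2; rewrite /h ltNge => /negbTE ->.
  move=> j; have [v0|/SaE[Sx Ox Sy]] := eqVneq (va (y j)) 0.
    rewrite (@lavg0 p (ka j)); last by move=> k; rewrite /ka /kernel_a v0 !mul0r.
    rewrite sub0r; apply: (@le_trans _ _ 0); last by rewrite /h; case: ifP.
    rewrite oppr_le0 -(@lavg0 p (fun=> 0)) //; apply: (@ler_lavg _ BB) => //.
      by move=> k kB; exact: skb'.
    move=> k; rewrite /kb /kernel_b.
    have [w0|/SbE[Sy Oy Sx]] := eqVneq (vb (y k)) 0; first by rewrite w0 !mul0r.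
    have /andP[h1 _] := wpos _ (gb _ Sy); have /andP[h2 _] := wpos _ (ga _ Sx).
    exact: (mulr_ge0 (mulr_ge0 (mulr_ge0 (vb_ge0 _) (ltW h2)) (ltW h1)) (bump_ge0 _)).
  rewrite /h bSa //.
  have skbj : bsupp BB (kb j) by move=> k kB; exact: skb'.
  rewrite -(@lavgB _ _ _ BB) //.
  pose g k := if `|p%:R *: (y k - theta (y j))| <= b%:R then e2 else 0.
  have sg : bsupp BB g.
    apply: ipt_bsupp => // k hk; rewrite /g leNgt -yE.
    have -> // : b%:R < `|ipt R p k - p%:R *: theta (y j)|.
    have : `|ipt R p k| <= `|ipt R p k - p%:R *: theta (y j)| + `|p%:R *: theta (y j)|.
      by rewrite -{1}(subrK (p%:R *: theta (y j)) (ipt R p k)) ler_normD.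
    move: hk; rewrite [`|p%:R *: theta _|]normrZ normr_nat natrM -natr1.
    by have : p%:R * `|theta (y j)| <= p%:R * b%:R by [rewrite ler_wpM2l // bSb]; lra.
  apply: (@le_trans _ _ (lavg p g)).
    apply: (@ler_lavg _ BB) => //.
      by move=> k kB; rewrite ska // skbj // subrr.
    move=> k; rewrite /g; have [hk|hk] := leP `|p%:R *: (y k - theta (y j))| b%:R.
      by apply: (Hloc _ Sx) => //; rewrite subrr normr0 invr_ge0.
    rewrite /ka /kernel_a (bump_supp b0 (gb _ Sy) hk) mulr0 sub0r oppr_le0 /kb /kernel_b.
    have [w0|/SbE[Sy' Oy' Sx']] := eqVneq (vb (y k)) 0; first by rewrite w0 !mul0r.
    have /andP[h1 _] := wpos _ (gb _ Sy'); have /andP[h2 _] := wpos _ (ga _ Sx').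
    exact: (mulr_ge0 (mulr_ge0 (mulr_ge0 (vb_ge0 _) (ltW h2)) (ltW h1)) (bump_ge0 _)).
  (* The points where [g] is nonzero surround a point off the lattice; recentring at a lattice point
     enlarges the radius from [b] to b + 1, whence [P4]. *)
  have [k0 hk0] := near_lattice (p%:R *: theta (y j)) p0.
  apply: le_trans (ler_norm _) _; apply: (lavg_le (j0 := k0)) => //; first exact: ltW.
    by move=> k; rewrite /g; case: ifP => _; rewrite ?normr0 ?(ltW e20) // gtr0_norm.
  move=> k; rewrite /g; case: ifP => [hk _|_]; last by rewrite eqxx.
  rewrite iptD iptN; have -> : ipt R p k - ipt R p k0 =
     p%:R *: (y k - theta (y j)) + (p%:R *: theta (y j) - ipt R p k0) by rewrite -yE addrA subrK.
  rewrite (le_trans (ler_normD _ _)) // -natr1 lerD // (le_trans hk0) //.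
  exact: invn_le1.
apply: (@le_trans _ _ (e / 4 + e / 2 + e / 4)); last by lra.
have -> : A - B = (A - A') + (A' - B') + (B' - B) by ring.
apply: lerD; last by rewrite distrC in BB'; exact: le_trans (ler_norm _) BB'.
by apply: lerD => //; exact: le_trans (ler_norm _) AA'.
Qed.

End ChangeOfChart.

Section Composition.
Variables (R : realType).

Lemma Ck_on_local (m : nat) (W : normedModType R) k (U : set 'rV[R]_m) (F : 'rV[R]_m -> W) :
  (forall x, U x -> exists2 V, open V /\ V x & Ck_on k V F) -> Ck_on k U F.
Proof.
elim: k F => [|k IH] F H; split => //.
- by move=> x /H[V [_ Vx] CF]; exact: Ck_on_continuous CF _ Vx.
- by move=> x /H[V [_ Vx] CF]; exact: Ck_on_continuous CF _ Vx.
move=> i; split; first by move=> x /H[V [_ Vx] CF]; exact: Ck_on_derivable CF Vx.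
by apply: IH => x /H[V oV CF]; exists V => //; exact: Ck_on_partial.
Qed.

Lemma Ck_on_comp (m n : nat) k (U : set 'rV[R]_m) (U' : set 'rV[R]_n) (F : 'rV[R]_m -> 'rV[R]_n)
    (u : 'rV[R]_n -> R) : open U -> open U' -> (forall x, U x -> U' (F x)) ->
  Ck_on k U F -> Ck_on k U' u -> Ck_on k U (u \o F).
Proof.
move=> oU oU' FU; elim: k u => [|k IH] u CF Cu.
  split => // x Ux; apply: continuous_comp; first exact: Ck_on_continuous CF _ Ux.
  exact: Ck_on_continuous Cu _ (FU x Ux).
have C1u : Ck_on 1 U' u by elim: (k) Cu => [|l IHl] // /Ck_onW.
have chain x i : U x -> is_derive x (basis_vec R i) (u \o F)
    (\sum_j ('D_(basis_vec R i) F x) 0 j * 'D_(basis_vec R j) u (F x)).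
  move=> Ux; apply: (C1_chain oU' C1u (FU x Ux)); apply: derivableP.
  exact: Ck_on_derivable CF Ux.
split.
  move=> x Ux; apply: continuous_comp; first exact: Ck_on_continuous CF _ Ux.
  exact: Ck_on_continuous Cu _ (FU x Ux).
move=> i; split; first by move=> x /chain; move=> /(_ i)[].
apply: (@Ck_on_eq _ _ R k U (fun x => \sum_j ('D_(basis_vec R i) F x) 0 j * ('D_(basis_vec R j) u \o F) x)) => //.
  by move=> x Ux; have [_ <-] := chain x i Ux.
apply: Ck_on_sum => // j _; apply: Ck_onM => //.
  by apply: (Ck_on_mx _ _ oU).1; exact: Ck_on_partial.
by apply: IH; [exact: Ck_onW|exact: Ck_on_partial].
Qed.

(** Class C^1 is as much as the profile allows; the divergence of a field multiplied by such a
    cut-off asks for no more. *)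
Lemma Ck_on_bump (m : nat) (U : set 'rV[R]_m) (q : 'rV[R]_m -> R) : open U ->
  Ck_on 1 U q -> Ck_on 1 U (fun x => bump (q x)).
Proof.
move=> oU Cq.
have cont (h : R -> R) x : {for q x, continuous h} -> U x -> {for x, continuous (fun y => h (q y))}.
  by move=> ch Ux; apply: (@continuous_comp _ _ _ q h) => //; exact: Ck_on_continuous Cq _ Ux.
have cb s : {for s, continuous (@bump R)}.
  apply/differentiable_continuous/derivable1_diffP.
  by have [] := is_derive_bump s.
have cdb s : {for s, continuous (@dbump R)}.
  apply: (@continuousM _ _ (cst (-2)) (fun s : R => Num.max 0 (1 - s))); first exact: cst_continuous.
  apply: (@continuous_comp _ _ _ (fun s : R => 1 - s) (fun t : R => Num.max 0 t)).
    by apply: continuousB; [exact: cst_continuous|exact: cvg_id].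
  by apply: continuous_max; [exact: cst_continuous|exact: cvg_id].
have D x i : U x -> is_derive x (basis_vec R i) ((@bump R) \o q) (dbump (q x) * 'D_(basis_vec R i) q x).
  by move=> Ux; apply: derivable_comp1; [exact: Ck_on_derivable Cq Ux|exact: is_derive_bump].
split; first by move=> x Ux; exact: cont.
move=> i; split; first by move=> x /D; move=> /(_ i)[].
apply: (@Ck_on_eq _ _ R 0 U (fun x => dbump (q x) * 'D_(basis_vec R i) q x)) => //.
  by move=> x Ux; have [_ <-] := D x i Ux.
apply: Ck_onM => //; last exact: Ck_on_partial.
by split => // x Ux; exact: cont.
Qed.

Lemma Ck_on_coord (m : nat) k (U : set 'rV[R]_m) i : open U -> Ck_on k U (fun x => x 0 i).
Proof.
move=> oU; have cc x : {for x, continuous (fun x : 'rV[R]_m => x 0 i)} by exact: coord_continuous.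
case: k => [|k]; split => //; try by move=> x _; exact: cc.
have D x j : is_derive x (basis_vec R j) (fun x : 'rV[R]_m => x 0 i) ((basis_vec R j : 'rV[R]_m) 0 i).
  have h := @is_derive_id R 'rV[R]_m x (basis_vec R j).
  have dd : derivable (@id 'rV[R]_m) x (basis_vec R j) by have [] := h.
  split; first by have /derivable_mxP/(_ 0 i) := dd.
  have := congr1 (fun v : 'rV[R]_m => v 0 i) (@derive_id _ 'rV[R]_m x (basis_vec R j)).
  by rewrite (derive_mx dd) mxE.
move=> j; split; first by move=> x _; have [] := D x j.
apply: (@Ck_on_eq _ _ R k U (cst ((basis_vec R j : 'rV[R]_m) 0 i))) => //; last exact: Ck_on_cst.
by move=> x _; have [_ <-] := D x j.
Qed.

End Composition.

(** * Charts and partitions of unity *)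

Section Charts.
Variables (R : realType) (m : nat) (M : smoothManifold R m).
Implicit Types (a b c : atlas_index M) (z : M) (x : 'rV[R]_m).

Notation dom a := (chart_dom (atlas a)).
Notation cmap a := (chart_map (atlas a)).
Notation cinv a := (chart_inv (atlas a)).
Notation img a := (chart_img (atlas a)).

Definition transition a b : 'rV[R]_m -> 'rV[R]_m := cmap b \o cinv a.

Definition overlap a b : set 'rV[R]_m := cmap a @` (dom a `&` dom b).

Lemma cmapK a z : dom a z -> cinv a (cmap a z) = z.
Proof. exact: chart_mapK. Qed.

Lemma cmap_img a z : dom a z -> img a (cmap a z).
Proof. by move=> za; exists z. Qed.

Lemma cinv_dom a x : img a x -> dom a (cinv a x).
Proof. by case=> z za <-; rewrite cmapK. Qed.

Lemma cinvK a x : img a x -> cmap a (cinv a x) = x.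
Proof. by case=> z za <-; rewrite cmapK. Qed.

Lemma img_open a : open (img a).
Proof. exact: chart_img_open. Qed.

Lemma cmap_open_image a (V : set M) : open V -> open (cmap a @` (dom a `&` V)).
Proof.
move=> oV; rewrite openE => x [z [za Vz] <-]; rewrite /interior /=.
have ix := cmap_img za.
have ci := chart_inv_continuous ix.
have nV : nbhs (cinv a (cmap a z)) V by rewrite cmapK //; exact: open_nbhs_nbhs.
have ni : \forall y \near cmap a z, img a y by apply: open_nbhs_nbhs; split => //; exact: img_open.
apply: filterS (near_and ni (ci _ nV)) => y [iy Vy].
by exists (cinv a y); [split => //; exact: cinv_dom|exact: cinvK].
Qed.

Lemma overlap_open a b : open (overlap a b).
Proof. exact/cmap_open_image/chart_dom_open. Qed.

Lemma overlapP a b x : overlap a b x -> img a x /\ dom b (cinv a x).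
Proof. by case=> z [za zb] <-; rewrite cmapK //; split => //; exact: cmap_img. Qed.

Lemma overlap_img a b : overlap a b `<=` img a.
Proof. by move=> x /overlapP[]. Qed.

Lemma overlap_cmap a b z : dom a z -> dom b z -> overlap a b (cmap a z).
Proof. by move=> za zb; exists z. Qed.

Lemma transition_overlap a b x : overlap a b x -> overlap b a (transition a b x).
Proof. by case=> z [za zb] <-; rewrite /transition /= cmapK //; exact: overlap_cmap. Qed.

Lemma transitionK a b x : overlap a b x -> transition b a (transition a b x) = x.
Proof. by case=> z [za zb] <-; rewrite /transition /= cmapK // cmapK. Qed.

Lemma transition_cmap a b z : dom a z -> transition a b (cmap a z) = cmap b z.
Proof. by move=> za; rewrite /transition /= cmapK. Qed.

Lemma transition_Ck k a b : Ck_on k (overlap a b) (transition a b).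
Proof. exact: atlas_compatible. Qed.

Lemma continuous_of_chart (T : topologicalType) (u : M -> T) a z : dom a z ->
  {for cmap a z, continuous (u \o cinv a)} -> {for z, continuous u}.
Proof.
move=> za cu; have cm := chart_map_continuous za.
apply: (@near_eq_continuous _ _ ((u \o cinv a) \o cmap a)).
  by apply: open_near (chart_dom_open (atlas a)) za _ => y ya /=; rewrite cmapK.
exact: continuous_comp.
Qed.

Lemma continuous_in_chart (T : topologicalType) (u : M -> T) a x : img a x ->
  {for cinv a x, continuous u} -> {for x, continuous (u \o cinv a)}.
Proof. by move=> ix cu; apply: continuous_comp => //; exact: chart_inv_continuous. Qed.

Lemma compact_cmap_image a (K : set M) : compact K -> K `<=` dom a -> compact (cmap a @` K).
Proof.
move=> cK Ka; apply: continuous_compact => //; apply: continuous_in_subspaceT.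
by move=> z; rewrite inE => /Ka; exact: chart_map_continuous.
Qed.

Lemma compact_cinv_image a (K : set 'rV[R]_m) : compact K -> K `<=` img a -> compact (cinv a @` K).
Proof.
move=> cK Ka; apply: continuous_compact => //; apply: continuous_in_subspaceT.
by move=> x; rewrite inE => /Ka; exact: chart_inv_continuous.
Qed.

Definition chart_C1 (u : M -> R) := forall c, Ck_on 1 (img c) (u \o cinv c).

Lemma chart_C1_continuous u z : chart_C1 u -> {for z, continuous u}.
Proof.
move=> Cu; have [a za] := atlas_cover z; apply: (continuous_of_chart za).
exact: Ck_on_continuous (Cu a) _ (cmap_img za).
Qed.

Lemma cball_compact (x0 : 'rV[R]_m) (r : R) : compact [set x | `|x - x0| <= r].
Proof.
have cont : continuous (fun x : 'rV[R]_m => `|x - x0|).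
  move=> x; apply: (@continuous_comp _ _ _ (fun x : 'rV[R]_m => x - x0) (fun y : 'rV[R]_m => `|y|)).
    by apply: continuousB; [exact: cvg_id|exact: cst_continuous].
  exact: norm_continuous.
apply: bounded_closed_compact.
  exists (r + `|x0|); split; first exact: num_real.
  move=> B hB x /= hx; apply: le_trans (ltW hB).
  by rewrite -[x](subrK x0) (le_trans (ler_normD _ _)) // lerD2r.
have -> : [set x | `|x - x0| <= r] = (fun x : 'rV[R]_m => `|x - x0|) @^-1` [set t | t <= r] by [].
by apply: (closed_comp (fun x _ => cont x)); exact: closed_le.
Qed.

Definition supported_in (u : M -> R) a (K : set 'rV[R]_m) :=
  [/\ compact K, K `<=` img a & forall z, u z != 0 -> dom a z /\ K (cmap a z)].

(* Extension by zero: a function supported in a compact subset of one chart is of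
   class C^1 in every chart, because this subset is closed. *)
Lemma extension_C1 (u : M -> R) a K : supported_in u a K ->
  Ck_on 1 (img a) (u \o cinv a) -> chart_C1 u.
Proof.
move=> [cK Ka su] Cu c; have cKM : compact (cinv a @` K) by exact: compact_cinv_image.
have clK : closed (cinv a @` K) by apply: compact_closed => //; exact: space_hausdorff.
apply: Ck_on_local => x ix; have [za|nza] := pselect (dom a (cinv c x)).
  exists (overlap c a).
    split; first exact: overlap_open.
    by exists (cinv c x); [split => //; exact: cinv_dom|exact: cinvK].
  apply: (@Ck_on_eq _ _ R 1 _ ((u \o cinv a) \o transition c a)); first exact: overlap_open.
    by move=> y /overlapP[iy ya]; rewrite /transition /= cmapK.
  apply: (@Ck_on_comp R m m 1 _ (img a)); [exact: overlap_open|exact: img_open| |exact: transition_Ck|exact: Cu].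
  by move=> y /transition_overlap/overlap_img.
exists (cmap c @` (dom c `&` ~` (cinv a @` K))).
  split; first by apply: cmap_open_image; rewrite openC.
  exists (cinv c x); last exact: cinvK.
  split; [exact: cinv_dom|move=> [y Ky yx]; apply: nza; rewrite -yx].
  exact/cinv_dom/Ka.
have oV : open (cmap c @` (dom c `&` ~` (cinv a @` K))) by apply: cmap_open_image; rewrite openC.
apply: (@Ck_on_eq _ _ R 1 _ (cst (0 : R))) => //; last exact: Ck_on_cst.
move=> y [z [zc nz] <-] /=; rewrite cmapK //.
have [-> //|/su[za Kz]] := eqVneq (u z) 0.
by case: nz; exists (cmap a z) => //; exact: cmapK.
Qed.

Lemma spd1 : spd (1%:M : 'M[R]_m).
Proof.
split; first exact: trmx1.
move=> u u0; rewrite /inner mulmx1 mxE.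
have [i ui] : exists i, u 0 i != 0.
  apply: contrapT => H; move/negP: u0; apply; apply/eqP/rowP => i; rewrite mxE.
  by apply: contrapT => h; apply: H; exists i; apply/eqP.
rewrite (bigD1 i) //= mxE ltr_pwDl //; first by rewrite -expr2 exprn_even_gt0 //=.
by apply: sumr_ge0 => j _; rewrite mxE -expr2 sqr_ge0.
Qed.

Lemma good1 : good 1 (1%:M : 'M[R]_m).
Proof.
have n1 : `|1%:M : 'M[R]_m| <= 1%:R.
  by apply: mx_norm_le => // i j; rewrite mxE; case: (_ == _); rewrite ?normr1 ?normr0.
by split; [exact: spd1| |rewrite invmx1].
Qed.

Lemma manifold_bump (p : M) : exists a K (u : M -> R),
  [/\ supported_in u a K, chart_C1 u, forall z, 0 <= u z & 0 < u p].
Proof.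
have [a pa] := atlas_cover p; pose x0 := cmap a p.
have ni : \forall x \near x0, img a x.
  by apply: open_nbhs_nbhs; split; [exact: img_open|exact: cmap_img].
have [r r0 rP] := near_ball ni.
pose K := [set x : 'rV[R]_m | `|x - x0| <= r / 2].
have r2 : 0 < r / 2 by rewrite divr_gt0.
have Ka : K `<=` img a.
  move=> x /= xr; apply: rP; apply: le_lt_trans xr _.
  by rewrite ltr_pdivrMr // ltr_pMr // ltr1n.
pose sc x := (r / 2)^-1 *: (x - x0).
pose be x := bump (inner 1%:M (sc x) (sc x)).
pose u z := if pselect (dom a z) is left _ then be (cmap a z) else 0.
have su : supported_in u a K.
  split => //; first exact: cball_compact.
  move=> z; rewrite /u; case: pselect => [za hz|]; last by rewrite eqxx.
  split => //; rewrite /K /= leNgt; apply/negP => hr; move/negP: hz; apply; apply/eqP.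
  apply: (bump_supp (b := 1)) => //; first exact: good1.
  by rewrite /sc normrZ normfV (gtr0_norm r2) ltr_pdivlMl // mulr1.
exists a, K, u; split => //.
- apply: (extension_C1 su); apply: (@Ck_on_eq _ _ R 1 _ be); first exact: img_open.
    move=> x ix /=; rewrite /u; case: pselect => [za|nza]; first by rewrite cinvK.
    by case: nza; exact: cinv_dom.
  apply: Ck_on_bump; first exact: img_open.
  have oi := @img_open a.
  apply: (@Ck_on_eq _ _ R 1 _ (fun x => \sum_i (r / 2)^-1 * (x 0 i - x0 0 i) * ((r / 2)^-1 * (x 0 i - x0 0 i)))) => //.
    by move=> x _; rewrite /inner mulmx1 mxE; apply: eq_bigr => i _; rewrite !mxE.
  apply: Ck_on_sum => // i _.
  have Cs : Ck_on 1 (img a) (fun x : 'rV[R]_m => (r / 2)^-1 * (x 0 i - x0 0 i)).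
    apply: (@Ck_onM _ _ 1 _ (cst (r / 2)^-1)) => //; first exact: Ck_on_cst.
    by apply: Ck_onB => //; [exact: Ck_on_coord|exact: (Ck_on_cst 1 _ (x0 0 i))].
  exact: Ck_onM.
- by move=> z; rewrite /u; case: pselect => // _; exact: bump_ge0.
rewrite /u; case: pselect => // _; rewrite /be /sc subrr scaler0 inner0l /bump subr0.
by rewrite (max_idPr ler01) expr1n.
Qed.

(** Finitely many bumps have a positive sum, and dividing by it preserves class C^1 as well as the
    supports. *)
Lemma partition_of_unity : compact [set: M] ->
  exists (N : nat) (ai : 'I_N -> atlas_index M) (K : 'I_N -> set 'rV[R]_m) (rho : 'I_N -> M -> R),
  [/\ forall i, supported_in (rho i) (ai i) (K i), forall i, chart_C1 (rho i),
       forall i z, 0 <= rho i z & forall z, \sum_i rho i z = 1].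
Proof.
move=> /compact_near_coveringP cM.
have [f Hf] := choice (fun p => manifold_bump p).
have [g Hg] := choice Hf; have [u Hu] := choice Hg.
(* Eventually along [F] means for all lists that contain some given points. Compactness along this
   filter yields one finite list whose bumps cover the manifold. *)
pose F : set_system (seq M) := fun A => exists s0 : seq M, forall s : seq M, {subset s0 <= s} -> A s.
have FF : Filter F.
  split; first by exists [::].
  - move=> A B [s1 H1] [s2 H2]; exists (s1 ++ s2) => s hs; split.
      by apply: H1 => z z1; apply: hs; rewrite mem_cat z1.
    by apply: H2 => z z1; apply: hs; rewrite mem_cat z1 orbT.
  by move=> A B AB [s1 H1]; exists s1 => s /H1/AB.
have : \near F, [set: M] `<=` (fun z => exists2 p, p \in F & 0 < u p z).
  apply: cM => z _; have [_ Cz _ uz] := Hu z.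
  have nz : \forall y \near z, 0 < u z y.
    have := chart_C1_continuous (z := z) Cz; move=> /cvgr_gt/(_ _ uz).
    exact.
  exists ([set y | 0 < u z y], [set s : seq M | z \in s]); first split => //=.
    by exists [:: z] => s; apply; rewrite inE.
  by move=> [y s] /= [uy zs]; exists z.
move=> [s /(_ s (fun z h => h)) Hs].
pose P (i : 'I_(size s)) := tnth (in_tuple s) i.
pose B z := \sum_i u (P i) z.
have u0 p z : 0 <= u p z by have [_ _] := Hu p.
have B0 z : 0 < B z.
  have [p ps upz] := Hs z I.
  have /tnthP[i pE] : p \in in_tuple s by [].
  rewrite /B (bigD1 i) //= ltr_pwDl //; first by rewrite /P -pE.
  by apply: sumr_ge0.
exists (size s), (fun i => f (P i)), (fun i => g (P i)), (fun i z => u (P i) z / B z); split.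
- move=> i; have [[cK Ka su] _ _ _] := Hu (P i); split => // z hz; apply: su.
  by apply: contraNneq hz => ->; rewrite mul0r.
- move=> i c; have oi := @img_open c.
  apply: (@Ck_onM _ _ 1 _ (u (P i) \o cinv c)) => //; first by have [_ Cu _ _] := Hu (P i); exact: Cu.
  apply: (@Ck_onV _ _ 1 _ (B \o cinv c)) => //; first by move=> x _; exact: lt0r_neq0 (B0 _).
  apply: (@Ck_on_sum _ _ R 1 _ _ _ _ (fun i => u (P i) \o cinv c)) => // j _.
  by have [_ Cu _ _] := Hu (P j); exact: Cu.
- by move=> i z; rewrite divr_ge0 // ltW.
by move=> z; rewrite -mulr_suml -/(B z) divff // lt0r_neq0.
Qed.

End Charts.

(** * Lattice sums of functions on the manifold *)

Section ChartSums.
Variables (R : realType) (m : nat) (M : riemannianManifold R m).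
Implicit Types (a b c : atlas_index M) (z : M) (x : 'rV[R]_m).

Notation dom a := (chart_dom (atlas a)).
Notation cmap a := (chart_map (atlas a)).
Notation cinv a := (chart_inv (atlas a)).
Notation img a := (chart_img (atlas a)).

Lemma metric_spd a x : img a x -> spd (metric a x).
Proof. by move=> ix; split; [exact: metric_sym|move=> u; exact: metric_pos]. Qed.

Lemma metric_Ck k a : Ck_on k (img a) (metric a).
Proof. exact: metric_smooth. Qed.

Lemma metric_transition a b x u v : overlap a b x ->
  inner (metric a x) u v =
  inner (metric b (transition a b x)) ('D_u (transition a b) x) ('D_v (transition a b) x).
Proof. by case=> z [za zb] <-; exact: metric_change. Qed.

(** The value 0 off the chart lets sums run over the whole lattice. The transfer between charts is
    applied to functions supported in a compact subset of both domains. *)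
Definition in_chart (v : M -> R) a x : R := if pselect (img a x) is left _ then v (cinv a x) else 0.

Definition chart_sum p a (v : M -> R) : R :=
  lavg (p ^ 2) (fun j => in_chart v a (ipt R (p ^ 2) j) * weight (metric a) p (ipt R (p ^ 2) j)).

Lemma in_chartE v a x : img a x -> in_chart v a x = v (cinv a x).
Proof. by rewrite /in_chart; case: pselect. Qed.

Lemma in_chart_out v a (K : set 'rV[R]_m) x : (forall z, v z != 0 -> dom a z /\ K (cmap a z)) ->
  ~ K x -> in_chart v a x = 0.
Proof.
move=> sv nK; rewrite /in_chart; case: pselect => // ix.
by have [-> //|/sv[_]] := eqVneq (v (cinv a x)) 0; rewrite cinvK.
Qed.

Lemma chart_sum_le_pos a b (K : set M) (v : M -> R) (e : R) : compact K -> 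
  K `<=` dom a `&` dom b -> (forall z, 0 <= v z) -> (forall z, v z != 0 -> K z) ->
  (forall z, dom a z -> dom b z -> {for z, continuous v}) -> 0 < e ->
  \forall p \near \oo, chart_sum p a v - chart_sum p b v <= e.
Proof.
move=> cK Kab v0 Kv cv e0.
have Ka : K `<=` dom a by move=> z /Kab[].
have Kb : K `<=` dom b by move=> z /Kab[].
have in0 c x : 0 <= in_chart v c x by rewrite /in_chart; case: pselect.
have out c : K `<=` dom c -> forall x, ~ (cmap c @` K) x -> in_chart v c x = 0.
  move=> Kc x nx; apply: in_chart_out nx => z /Kv Kz; split; [exact: Kc|by exists z].
apply: (@lattice_sum_chart_le R m (img a) (img b) (overlap a b) (overlap b a) (cmap a @` K) (cmap b @` K)
  (metric a) (metric b) (transition a b) (transition b a)).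
- exact: img_open.
- exact: img_open.
- exact: overlap_open.
- exact: overlap_open.
- exact: overlap_img.
- exact: overlap_img.
- exact: metric_Ck.
- exact: metric_spd.
- exact: metric_Ck.
- exact: metric_spd.
- exact: transition_overlap.
- exact: transitionK.
- by move=> x; exact: Ck_on_continuous (transition_Ck 0 a b) _.
- exact: transition_Ck.
- by move=> y u; exact: metric_transition.
- exact: compact_cmap_image.
- by move=> x [z Kz <-]; apply: overlap_cmap; [exact: Ka|exact: Kb].
- exact: out.
- exact: compact_cmap_image.
- by move=> x [z Kz <-]; apply: overlap_cmap; [exact: Kb|exact: Ka].
- exact: out.
- exact: in0.
- exact: in0.
- move=> x Ox; have [ix xb] := overlapP Ox.
  apply: (@near_eq_continuous _ _ (v \o cinv a)).
    by apply: open_near (@img_open _ _ _ a) ix _ => y iy; rewrite in_chartE.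
  by apply: continuous_in_chart => //; apply: cv => //; exact: cinv_dom.
- by move=> y Oy; have [iy ya] := overlapP Oy; rewrite !in_chartE ?/transition /= ?cmapK //; exact: cmap_img.
exact: e0.
Qed.

Lemma chart_sumB p a u v (K : set 'rV[R]_m) : compact K ->
  (forall z, u z != 0 -> dom a z /\ K (cmap a z)) ->
  (forall z, v z != 0 -> dom a z /\ K (cmap a z)) -> (0 < p)%N ->
  chart_sum p a (fun z => u z - v z) = chart_sum p a u - chart_sum p a v.
Proof.
move=> cK su sv p0; have [b b0 Kb] := compact_bounded_nat cK.
have pp0 : (0 < p ^ 2)%N by rewrite expn_gt0 p0.
have supp (w : M -> R) : (forall z, w z != 0 -> dom a z /\ K (cmap a z)) ->
    bsupp (b * p ^ 2) (fun j => in_chart w a (ipt R (p ^ 2) j) * weight (metric a) p (ipt R (p ^ 2) j)).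
  move=> sw; apply: ipt_bsupp => // j hj; rewrite (in_chart_out sw) ?mul0r // => /Kb.
  by rewrite leNgt hj.
rewrite /chart_sum -(@lavgB _ _ _ (b * p ^ 2)%N); [|exact: supp|exact: supp].
congr lavg; apply/funext => j; rewrite -mulrBl; congr (_ * _).
by rewrite /in_chart; case: pselect => // _; rewrite subr0.
Qed.

Lemma chart_sum_sum p a (I : Type) (r : seq I) (v : I -> M -> R) (K : set 'rV[R]_m) : compact K ->
  (forall i z, v i z != 0 -> dom a z /\ K (cmap a z)) -> (0 < p)%N ->
  chart_sum p a (fun z => \sum_(i <- r) v i z) = \sum_(i <- r) chart_sum p a (v i).
Proof.
move=> cK sv p0; have [b b0 Kb] := compact_bounded_nat cK.
have pp0 : (0 < p ^ 2)%N by rewrite expn_gt0 p0.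
rewrite /chart_sum -(@lavg_sum _ _ _ (b * p ^ 2)%N).
  congr lavg; apply/funext => j; rewrite -mulr_suml; congr (_ * _).
  by rewrite /in_chart; case: pselect => // _; rewrite big1.
move=> i; apply: ipt_bsupp => // j hj; rewrite (in_chart_out (sv i)) ?mul0r // => /Kb.
by rewrite leNgt hj.
Qed.

(** Four uses of the one-sided comparison: positive and negative parts, with the charts in either
    order. *)
Lemma chart_sum_eq a b (K : set M) (v : M -> R) (e : R) : compact K ->
  K `<=` dom a `&` dom b -> (forall z, v z != 0 -> K z) ->
  (forall z, dom a z -> dom b z -> {for z, continuous v}) -> 0 < e ->
  \forall p \near \oo, `|chart_sum p a v - chart_sum p b v| <= e.
Proof.
move=> cK Kab Kv cv e0; have e2 : 0 < e / 2 by rewrite divr_gt0.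
pose vp z := Num.max (v z) 0; pose vn z := Num.max (- v z) 0.
have vE z : v z = vp z - vn z.
  by rewrite /vp /vn; case: (leP (v z) 0) => h1; case: (leP (- v z) 0) => h2; lra.
have vp0 z : 0 <= vp z by rewrite /vp le_max lexx orbT.
have vn0 z : 0 <= vn z by rewrite /vn le_max lexx orbT.
have Kp z : vp z != 0 -> K z.
  by move=> h; apply: Kv; apply: contraNneq h => h; rewrite /vp h maxxx.
have Kn z : vn z != 0 -> K z.
  by move=> h; apply: Kv; apply: contraNneq h => h; rewrite /vn h oppr0 maxxx.
have cp z : dom a z -> dom b z -> {for z, continuous vp}.
  by move=> za zb; apply: continuous_max; [exact: cv|exact: cst_continuous].
have cn z : dom a z -> dom b z -> {for z, continuous vn}.
  by move=> za zb; apply: continuous_max; [apply: continuousN; exact: cv|exact: cst_continuous].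
have Kba : K `<=` dom b `&` dom a by rewrite setIC.
have h1 := chart_sum_le_pos cK Kab vp0 Kp cp e2.
have h2 := chart_sum_le_pos cK Kab vn0 Kn cn e2.
have h3 := chart_sum_le_pos cK Kba vp0 Kp (fun z zb za => cp z za zb) e2.
have h4 := chart_sum_le_pos cK Kba vn0 Kn (fun z zb za => cn z za zb) e2.
have Ka : K `<=` dom a by move=> z /Kab[].
have Kb : K `<=` dom b by move=> z /Kab[].
have split_sum c p : K `<=` dom c -> (0 < p)%N -> chart_sum p c v = chart_sum p c vp - chart_sum p c vn.
  move=> Kc p0; rewrite (_ : v = fun z => vp z - vn z); last exact/funext.
  apply: (chart_sumB (compact_cmap_image cK Kc)) => //.
    by move=> z /Kp Kz; split; [exact: Kc|exists z].
  by move=> z /Kn Kz; split; [exact: Kc|exists z].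
apply: filterS (filterI (filterI (filterI h1 h2) (filterI h3 h4)) (near_invn e2)) => p.
move=> [[[{}h1 {}h2] [{}h3 {}h4]] [p0 _]].
by rewrite !split_sum // ler_norml; lra.
Qed.

Lemma lsum_ge0 (F : 'rV[int]_m -> R) : (forall j, 0 <= F j) -> 0 <= lsum F.
Proof. by move=> F0; rewrite lsum.unlock; apply: fsumr_ge0. Qed.

Lemma weight_ge0 a p x : img a x -> 0 <= weight (metric a) p x.
Proof.
by move=> ix; rewrite invr_ge0 mulr_ge0 ?exprn_ge0 ?invr_ge0 //; apply: lsum_ge0 => j; exact: bump_ge0.
Qed.

Lemma chart_sum_ge0 p a v : (forall z, 0 <= v z) -> 0 <= chart_sum p a v.
Proof.
move=> v0; rewrite mulr_ge0 ?exprn_ge0 ?invr_ge0 //; apply: lsum_ge0 => j.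
rewrite /in_chart; case: pselect => [ix|_]; last by rewrite mul0r.
by rewrite mulr_ge0 // weight_ge0.
Qed.

(** A fixed proportion of the lattice lies where [v] exceeds half of its value at [z0], and the
    weight is bounded below there by the upper bound on the mass. A nonzero function thus keeps its
    sums away from 0. *)
Lemma chart_sum_lower a v K z0 : supported_in v a K -> (forall z, 0 <= v z) ->
  {for z0, continuous v} -> 0 < v z0 ->
  exists2 c : R, 0 < c & \forall p \near \oo, c <= chart_sum p a v.
Proof.
move=> [cK Ka sv] v0 cv vz; have [za Kz] : dom a z0 /\ K (cmap a z0) by apply: sv; rewrite lt0r_neq0.
pose x0 := cmap a z0; have ix0 : img a x0 by exact: cmap_img.
have [b b0 Kb] := compact_bounded_nat cK.
have [b1 b10 ng] := near_good (@img_open _ _ _ a) (metric_Ck 0 a) (@metric_spd a) ix0.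
pose c1 := v z0 / 2; have c10 : 0 < c1 by rewrite divr_gt0.
have nv : \forall x \near x0, c1 < v (cinv a x).
  have cva : {for x0, continuous (v \o cinv a)}.
    by apply: continuous_in_chart => //; rewrite /x0 cmapK.
  have : c1 < (v \o cinv a) x0 by rewrite /= /x0 cmapK // /c1 ltr_pdivrMr // ltr_pMr // ltr1n.
  by move=> /(cvgr_gt _ cva).
have [r r0 rP] := near_ball (near_and ng nv).
pose w0 : R := ((3 * b1%:R) ^+ m)^-1.
have w00 : 0 < w0 by rewrite invr_gt0 exprn_gt0 // mulr_gt0 // ltr0n.
have r4 : 0 < r / 4 by rewrite divr_gt0.
(* [q] is chosen before [p], so that the bound does not depend on [p]. The ball of radius 1/q about
   a lattice point within r / 4 of [x0] stays in the ball of radius [r]. *)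
have [q [q0 qr]] : exists q : nat, (0 < q)%N /\ q%:R^-1 <= r / 4.
  by case: (near_invn r4) => B _ HB; exists B; apply: HB => /=.
exists (c1 * w0 * q%:R^-1 ^+ m).
  by rewrite mulr_gt0 ?exprn_gt0 ?invr_gt0 ?ltr0n // mulr_gt0.
apply: filterS (near_invn r4) => p [p0 pr].
have pp0 : (0 < p ^ 2)%N by rewrite expn_gt0 p0.
have [j0 hj0] := near_lattice x0 pp0.
have cw0 : 0 <= c1 * w0 by rewrite mulr_ge0 // ltW.
apply: (@lavg_ge R m (p ^ 2) q (b * p ^ 2)%N j0) => //.
- apply: ipt_bsupp => // j hj; rewrite (in_chart_out sv) ?mul0r // => /Kb.
  by rewrite leNgt hj.
- move=> j; rewrite /in_chart; case: pselect => [ix|_]; last by rewrite mul0r.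
  by rewrite mulr_ge0 // weight_ge0.
move=> j hj; set x := ipt R (p ^ 2) j.
have xr : `|x - x0| < r.
  have -> : x - x0 = ipt R (p ^ 2) (j - j0) - (x0 - ipt R (p ^ 2) j0).
    by rewrite iptD iptN opprB addrA subrK.
  have h1 : `|x0 - ipt R (p ^ 2) j0| <= r / 4 by apply: le_trans hj0 (le_trans (mesh_le R p0) pr).
  have h2 := le_trans hj qr.
  apply: le_lt_trans (ler_normB _ _) _; apply: le_lt_trans (lerD h2 h1) _.
  by clear -r0; lra.
have [[ix gx] vx] := rP x xr; rewrite in_chartE //.
apply: ler_pM; [exact: ltW|exact: ltW|exact: ltW|].
have [c c0 Hc] := @lmass_ge R m _ b10.
have l0 : 0 < lmass p (metric a x) by exact: lt_le_trans (Hc p _ p0 gx).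
have w0' : 0 < (3 * b1%:R) ^+ m :> R by rewrite -invr_gt0.
rewrite /weight /w0 lef_pV2 ?posrE //.
exact: le_trans (ler_norm _) (lmass_le b10 p0 gx).
Qed.

End ChartSums.

(** * The divergence theorem *)

Section VectorCalculus.
Variables (R : realType).

Lemma C1_derivable (m n : nat) (U : set 'rV[R]_m) (F : 'rV[R]_m -> 'rV[R]_n) x v :
  open U -> Ck_on 1 U F -> U x -> derivable F x v.
Proof.
move=> oU CF Ux; apply/derivable_mxP => i j.
by have [] := C1_derive v oU ((Ck_on_mx _ _ oU).1 CF i j) Ux.
Qed.

Lemma C1_derivable_fun (m : nat) (U : set 'rV[R]_m) (u : 'rV[R]_m -> R) x v :
  open U -> Ck_on 1 U u -> U x -> derivable u x v.
Proof. by move=> oU Cu Ux; have [] := C1_derive v oU Cu Ux. Qed.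

Lemma chart_divZ (m : nat) (U : set 'rV[R]_m) (G : 'rV[R]_m -> 'M[R]_m) (X : 'rV[R]_m -> 'rV[R]_m)
    (r : 'rV[R]_m -> R) x : open U -> Ck_on 1 U X -> Ck_on 1 U r -> U x ->
  chart_div G (fun y => r y *: X y) x = r x * chart_div G X x + 'D_(X x) r x.
Proof.
move=> oU CX Cr Ux; have CXi i := (Ck_on_mx _ _ oU).1 CX 0 i.
rewrite (C1_deriveE _ oU Cr Ux) /chart_div mulr_sumr -big_split /=.
apply: eq_bigr => i _; rewrite /coord_div mxE.
have -> : (fun y => (r y *: X y) 0 i) = (fun y => r y * X y 0 i) by apply/funext => y; rewrite mxE.
rewrite (@deriveM _ _ r (fun y => X y 0 i)); [|exact: Ck_on_derivable Cr Ux|exact: Ck_on_derivable (CXi i) Ux].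
by rewrite /GRing.scale /=; ring.
Qed.

Lemma chart_div_Ck0 (m : nat) (U : set 'rV[R]_m) (G : 'rV[R]_m -> 'M[R]_m) (X : 'rV[R]_m -> 'rV[R]_m) :
  open U -> Ck_on 1 U G -> (forall x, U x -> spd (G x)) -> Ck_on 1 U X -> Ck_on 0 U (chart_div G X).
Proof.
move=> oU CG sG CX; have CXi i := (Ck_on_mx _ _ oU).1 CX 0 i.
have Ci : Ck_on 0 U (fun x => invmx (G x)).
  by apply: Ck_on_invmx (Ck_onW CG) => // x /sG/spd_unitmx.
apply: (@Ck_on_sum _ _ R 0 U _ _ _ (fun i => coord_div G X i)) => // i _.
apply: (@Ck_onD _ _ R 0 U) => //; first exact: Ck_on_partial (CXi i).
apply: Ck_onM => //; last exact: Ck_onW (CXi i).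
apply: (@Ck_onM _ _ 0 U (cst 2^-1)); [exact: oU|exact: Ck_on_cst|].
apply: (@Ck_on_eq _ _ R 0 U (fun x => \sum_k \sum_l 'D_(basis_vec R i) G x k l * invmx (G x) l k)) => //.
  by move=> x _; apply: eq_bigr => k _; rewrite mxE.
apply: Ck_on_sum => // k _; apply: Ck_on_sum => // l _; apply: Ck_onM => //.
  exact: (Ck_on_mx _ _ oU).1 (Ck_on_partial i CG) k l.
exact: (Ck_on_mx _ _ oU).1 Ci l k.
Qed.

End VectorCalculus.

(** * Vector fields cut off to one chart *)

Section LocalizedDivergence.
Variables (R : realType) (m : nat) (M : riemannianManifold R m).
Implicit Types (a b c : atlas_index M) (z : M) (x : 'rV[R]_m).

Notation dom a := (chart_dom (atlas a)).
Notation cmap a := (chart_map (atlas a)).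
Notation cinv a := (chart_inv (atlas a)).
Notation img a := (chart_img (atlas a)).

Variable W : atlas_index M -> 'rV[R]_m -> 'rV[R]_m.
Hypothesis CW : forall a, Ck_on 1 (img a) (W a).
Hypothesis W_transition : forall a b x, overlap a b x ->
  W b (transition a b x) = 'D_(W a x) (transition a b) x.
Hypothesis div_transition : forall a b x, overlap a b x ->
  chart_div (metric b) (W b) (transition a b x) = chart_div (metric a) (W a) x.

Lemma supported_near0 (u : M -> R) a K z : supported_in u a K -> ~ dom a z ->
  \forall y \near z, u y = 0.
Proof.
move=> [cK Ka su] nz; have cKM : compact (cinv a @` K) by exact: compact_cinv_image.
have clK : closed (cinv a @` K) by apply: compact_closed => //; exact: space_hausdorff.
apply: (@open_near _ (~` (cinv a @` K))) => //; first by rewrite openC.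
  by move=> [x Kx xz]; apply: nz; rewrite -xz; exact/cinv_dom/Ka.
move=> y ny; have [-> //|/su[ya Ky]] := eqVneq (u y) 0.
by case: ny; exists (cmap a y) => //; exact: cmapK.
Qed.

Lemma derive_transition (u : M -> R) a b z : chart_C1 u -> dom a z -> dom b z ->
  'D_(W a (cmap a z)) (u \o cinv a) (cmap a z) = 'D_(W b (cmap b z)) (u \o cinv b) (cmap b z).
Proof.
move=> Cu za zb; have Ox := overlap_cmap za zb.
rewrite -(transition_cmap b za) W_transition //.
have dt := @C1_derivable R m m _ (transition a b) _ (W a (cmap a z)) (@overlap_open _ _ _ a b) (transition_Ck 1 a b) Ox.
have ib : img b (transition a b (cmap a z)) by rewrite transition_cmap //; exact: cmap_img.
have [_ <-] := C1_derive_comp (@img_open _ _ _ b) (Cu b) ib dt.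
apply: near_eq_derive; apply: open_near (@overlap_open _ _ _ a b) Ox _ => x /overlapP[ix xb] /=.
by rewrite /transition /= cmapK.
Qed.

(** The chart at [z] is an arbitrary choice, immaterial by [div_transition]. That hypothesis is met
    later, when the divergence is recognized as the trace of the covariant derivative. *)
Definition total_div z : R :=
  let a := projT1 (cid (atlas_cover z)) in chart_div (metric a) (W a) (cmap a z).

Lemma total_divE a z : dom a z -> total_div z = chart_div (metric a) (W a) (cmap a z).
Proof.
move=> za; rewrite /total_div; case: cid => b zb /=.
by rewrite -(transition_cmap b za) div_transition //; exact: overlap_cmap.
Qed.

Definition localized (rho : M -> R) a : 'rV[R]_m -> 'rV[R]_m :=
  fun x => in_chart rho a x *: W a x.

Definition localized_div (rho : M -> R) a z : R :=
  if pselect (dom a z) is left _ then chart_div (metric a) (localized rho a) (cmap a z) else 0.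

Variables (rho : M -> R) (a : atlas_index M) (K : set 'rV[R]_m).
Hypotheses (srho : supported_in rho a K) (Crho : chart_C1 rho).

Lemma in_chart_Ck : Ck_on 1 (img a) (in_chart rho a).
Proof.
apply: (@Ck_on_eq _ _ R 1 _ (rho \o cinv a)); [exact: img_open| |exact: Crho].
by move=> x ix; rewrite in_chartE.
Qed.

Lemma localized_Ck : Ck_on 1 (img a) (localized rho a).
Proof.
have oi := @img_open _ _ _ a; apply/Ck_on_mx => // i j.
apply: (@Ck_on_eq _ _ R 1 _ (fun x => in_chart rho a x * W a x i j)) => //.
  by move=> x _; rewrite mxE.
by apply: Ck_onM => //; [exact: in_chart_Ck|exact: (Ck_on_mx _ _ oi).1].
Qed.

Lemma localized_eq0 x : ~ K x -> localized rho a x = 0.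
Proof.
by move=> nK; have [_ _ su] := srho; rewrite /localized (in_chart_out su) // scale0r.
Qed.

Lemma localized_div_supp z : localized_div rho a z != 0 -> dom a z /\ K (cmap a z).
Proof.
have [cK Ka su] := srho; rewrite /localized_div; case: pselect => [za h|]; last by rewrite eqxx.
split => //; apply: contrapT => nK; move/negP: h; apply; apply/eqP.
exact: (chart_div_eq0 (metric a) cK localized_eq0).
Qed.

(** Leibniz rule, read in any chart [c] at [z] and not only in [a]: the pieces of a partition of
    unity can then be added in a common chart. Off the domain of [a], the function [rho] vanishes
    near [z] and both sides are 0. *)
Lemma localized_divE c z : dom c z ->
  localized_div rho a z = rho z * total_div z + 'D_(W c (cmap c z)) (rho \o cinv c) (cmap c z).
Proof.
move=> zc; rewrite /localized_div; case: pselect => [za|nza].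
  rewrite (chart_divZ _ (@img_open _ _ _ a) (CW a) in_chart_Ck (cmap_img za)).
  rewrite (total_divE za) in_chartE ?cmapK //; last exact: cmap_img.
  rewrite -(derive_transition Crho za zc); congr (_ + _); apply: near_eq_derive.
  by apply: open_near (@img_open _ _ _ a) (cmap_img za) _ => x ix; rewrite in_chartE.
have n0 := supported_near0 srho nza.
rewrite (nbhs_singleton n0) mul0r add0r.
have ci := chart_inv_continuous (cmap_img zc).
have n1 : \forall x \near cmap c z, (rho \o cinv c) x = cst 0 x.
  by apply: (ci [set y | rho y = 0]); rewrite cmapK.
by rewrite (near_eq_derive _ n1) derive_cst.
Qed.

Lemma localized_div_continuous z : dom a z -> {for z, continuous (localized_div rho a)}.
Proof.
move=> za; apply: (continuous_of_chart za).
have Cd := chart_div_Ck0 (@img_open _ _ _ a) (metric_Ck 1 a) (@metric_spd _ _ _ a) localized_Ck.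
apply: near_eq_continuous (Ck_on_continuous Cd (cmap_img za)).
apply: open_near (@img_open _ _ _ a) (cmap_img za) _ => x ix /=.
rewrite /localized_div; case: pselect => [_|n]; first by rewrite cinvK.
by case: n; exact: cinv_dom.
Qed.

Lemma localized_div_sum_small (e : R) : 0 < e ->
  \forall p \near \oo, `|chart_sum p a (localized_div rho a)| <= e.
Proof.
move=> e0; have [cK Ka su] := srho.
have := sum_chart_div_small (@img_open _ _ _ a) (metric_Ck 1 a) (@metric_spd _ _ _ a)
  localized_Ck cK Ka localized_eq0 e0.
apply: filterS => p; rewrite /chart_sum.
suff -> : (fun j : 'rV[int]_m => in_chart (localized_div rho a) a (ipt R (p ^ 2) j) * weight (metric a) p (ipt R (p ^ 2) j))
  = (fun j => weight (metric a) p (ipt R (p ^ 2) j) * chart_div (metric a) (localized rho a) (ipt R (p ^ 2) j)) by [].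
apply/funext => j; rewrite mulrC; congr (_ * _); set x := ipt _ _ _.
rewrite /in_chart; case: pselect => [ix|nx].
  rewrite /localized_div; case: pselect => [_|n]; first by rewrite cinvK.
  by case: n; exact: cinv_dom.
by rewrite (chart_div_eq0 (metric a) cK localized_eq0) // => /Ka.
Qed.

End LocalizedDivergence.

Section DivergenceTheorem.
Variables (R : realType) (m : nat) (M : riemannianManifold R m).
Implicit Types (a b c : atlas_index M) (z : M) (x : 'rV[R]_m).

Notation dom a := (chart_dom (atlas a)).
Notation cmap a := (chart_map (atlas a)).
Notation cinv a := (chart_inv (atlas a)).
Notation img a := (chart_img (atlas a)).

Variable W : atlas_index M -> 'rV[R]_m -> 'rV[R]_m.
Hypothesis compactM : compact [set: M].
Hypothesis CW : forall a, Ck_on 1 (img a) (W a).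
Hypothesis W_transition : forall a b x, overlap a b x ->
  W b (transition a b x) = 'D_(W a x) (transition a b) x.
Hypothesis div_transition : forall a b x, overlap a b x ->
  chart_div (metric b) (W b) (transition a b x) = chart_div (metric a) (W a) x.

Let D := total_div W.

Lemma total_div_continuous z : {for z, continuous D}.
Proof.
have [a za] := atlas_cover z; apply: (continuous_of_chart za).
have Cd := chart_div_Ck0 (@img_open _ _ _ a) (metric_Ck 1 a) (@metric_spd _ _ _ a) (CW a).
apply: near_eq_continuous (Ck_on_continuous Cd (cmap_img za)).
apply: open_near (@img_open _ _ _ a) (cmap_img za) _ => x ix /=.
by rewrite /D (total_divE div_transition (cinv_dom ix)) cinvK.
Qed.

(* Discrete form of [int div W = 0]: localize [W] by a partition of unity, sum each
   piece over the lattice of its own chart, and move the pieces from one chart to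
   another with [chart_sum_eq]. *)
Lemma divergence_theorem : (forall z, 0 <= D z) -> forall z, D z = 0.
Proof.
move=> D0 z0; apply: contrapT => /eqP Dz.
have {}Dz : 0 < D z0 by rewrite lt0r Dz D0.
have [N [ai [K [rho [srho Crho rho0 rho1]]]]] := partition_of_unity compactM.
pose v i := localized_div W (rho i) (ai i).
have cK i : compact (K i) by have [] := srho i.
have Ka i : K i `<=` img (ai i) by have [] := srho i.
have sr i z : rho i z != 0 -> dom (ai i) z /\ K i (cmap (ai i) z) by have [_ _ h] := srho i; exact: h.
have sv i z : v i z != 0 -> dom (ai i) z /\ K i (cmap (ai i) z) by move=> h; exact: (localized_div_supp (srho i) h).
have sumv z : \sum_i v i z = D z.
  have [c zc] := atlas_cover z; have ic := cmap_img zc.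
  under eq_bigr => i _ do rewrite /v (localized_divE CW W_transition div_transition (srho i) (Crho i) zc).
  rewrite big_split /= -mulr_suml rho1 mul1r -/D -[RHS]addr0; congr (_ + _).
  have dr i : derivable (rho i \o cinv c) (cmap c z) (W c (cmap c z)).
    exact: C1_derivable_fun (@img_open _ _ _ c) (Crho i c) ic.
  (* The derivatives of the cut-offs add up to the derivative of the constant 1. *)
  rewrite -(derive_sum dr); apply: etrans (derive_cst (1 : R) (cmap c z) (W c (cmap c z))).
  congr ('D_ _ _ _); apply/funext => x; rewrite fct_sumE /=.
  exact: rho1.
have [q0 rq0] : exists q, rho q z0 != 0.
  apply: contrapT => H; have := rho1 z0; rewrite big1 => [|i _]; last first.
    by apply: contrapT => h; apply: H; exists i; apply/eqP.
  by move/eqP; rewrite eq_sym oner_eq0.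
pose rD q z := rho q z * D z.
have srD q z : rD q z != 0 -> dom (ai q) z /\ K q (cmap (ai q) z).
  by move=> h; apply: sr; apply: contraNneq h => h; rewrite /rD h mul0r.
have cr q z : {for z, continuous (rho q)} := chart_C1_continuous (Crho q).
have rD0 q z : 0 <= rD q z by rewrite mulr_ge0.
have [c c0 Hc] : exists2 c : R, 0 < c & \forall p \near \oo, c <= chart_sum p (ai q0) (rD q0).
  apply: (@chart_sum_lower R m M (ai q0) (rD q0) (K q0) z0) => //.
  - by split => //; exact: srD.
  - by apply: continuousM; [exact: cr|exact: total_div_continuous].
  by rewrite mulr_gt0 // lt0r rq0 rho0.
pose F qi : M -> R := fun z => rho qi.1 z * v qi.2 z.
(* [N * N] exchanges of charts and [N] sums of divergences, each with error [e], must stay below [c]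
   in total. *)
pose e := c / (2 * (N * N + N).+1%:R).
have den : 0 < 2 * (N * N + N).+1%:R :> R by rewrite mulr_gt0 // ltr0n.
have e0 : 0 < e by rewrite divr_gt0.
have FK qi z : F qi z != 0 ->
    (dom (ai qi.1) z /\ K qi.1 (cmap (ai qi.1) z)) /\ (dom (ai qi.2) z /\ K qi.2 (cmap (ai qi.2) z)).
  move=> h; split.
    by apply: sr; apply: contraNneq h => h; rewrite /F h mul0r.
  by apply: sv; apply: contraNneq h => h; rewrite /F h mulr0.
have swap : \forall p \near \oo, forall qi : 'I_N * 'I_N,
    `|chart_sum p (ai qi.1) (F qi) - chart_sum p (ai qi.2) (F qi)| <= e.
  apply: (@filter_forall _ _ (fun (qi : 'I_N * 'I_N) p => `|chart_sum p (ai qi.1) (F qi) - chart_sum p (ai qi.2) (F qi)| <= e)) => -[q i] /=.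
  have cKM j : compact (cinv (ai j) @` K j) by exact: compact_cinv_image.
  have KM j : cinv (ai j) @` K j `<=` dom (ai j) by move=> z [x Kx <-]; exact/cinv_dom/Ka.
  apply: (@chart_sum_eq R m M (ai q) (ai i) ((cinv (ai q) @` K q) `&` (cinv (ai i) @` K i))) => //.
  - apply: (subclosed_compact _ (cKM q)); last by move=> z [].
    by apply: closedI; apply: compact_closed => //; exact: space_hausdorff.
  - by move=> z [/KM ? /KM].
  - move=> z /FK /= [[zq Kq] [zi Ki]].
    by split; [exists (cmap (ai q) z)|exists (cmap (ai i) z)] => //; rewrite cmapK.
  move=> z _ zi; apply: continuousM; first exact: cr.
  exact: (localized_div_continuous CW (Crho i) zi).
have small : \forall p \near \oo, forall i : 'I_N, `|chart_sum p (ai i) (v i)| <= e.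
  apply: (@filter_forall _ _ (fun (i : 'I_N) p => `|chart_sum p (ai i) (v i)| <= e)) => i.
  exact: (localized_div_sum_small CW (srho i) (Crho i) e0).
have : \forall p \near \oo, False; last by case=> B _ /(_ B (leqnn B)).
apply: filterS (filterI (filterI Hc swap) (filterI small (near_invn e0))) => p.
move=> [[{}Hc {}swap] [{}small [p0 _]]].
(* In the chart of index q, summing [F (q, i)] over [i] gives rho q * D; in the chart of index i,
   summing it over [q] gives [v i], whose sum is small. *)
have e1 q : chart_sum p (ai q) (rD q) = \sum_i chart_sum p (ai q) (F (q, i)).
  rewrite -(@chart_sum_sum _ _ _ _ _ _ _ _ (K q)) //; last by move=> i z /FK[].
  by congr chart_sum; apply/funext => z; rewrite /rD -sumv mulr_sumr.
have e2 i : chart_sum p (ai i) (v i) = \sum_q chart_sum p (ai i) (F (q, i)).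
  rewrite -(@chart_sum_sum _ _ _ _ _ _ _ _ (K i)) //; last by move=> q z /FK[].
  by congr chart_sum; apply/funext => z; rewrite /F /= -mulr_suml rho1 mul1r.
have up : \sum_q chart_sum p (ai q) (rD q) <= (N * N + N)%:R * e.
  apply: (@le_trans _ _ (\sum_(q < N) \sum_(i < N) (chart_sum p (ai i) (F (q, i)) + e))).
    apply: ler_sum => q _; rewrite e1; apply: ler_sum => i _.
    by rewrite -lerBlDl; exact: le_trans (ler_norm _) (swap (q, i)).
  rewrite exchange_big /=; under eq_bigr => i _ do rewrite big_split /= -e2.
  rewrite big_split /= natrD mulrDl addrC; apply: lerD.
    by rewrite !sumr_const !card_ord -mulrnA mulr_natl.
  apply: le_trans (ler_sum _ (fun i _ => le_trans (ler_norm _) (small i))) _.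
  by rewrite sumr_const card_ord mulr_natl.
have low : c <= \sum_q chart_sum p (ai q) (rD q).
  rewrite (bigD1 q0) //= -[leLHS]addr0 lerD // sumr_ge0 // => q _.
  exact: chart_sum_ge0.
have ce : e * (2 * (N * N + N).+1%:R) = c by rewrite divfK // lt0r_neq0.
have h := le_trans low up; rewrite -natr1 in ce.
have : 0 <= (N * N + N)%:R :> R by [].
by nra.
Qed.

End DivergenceTheorem.

(** * Second derivatives *)

(* Otherwise unification unfolds derivatives down to limits of difference quotients. *)
#[local] Opaque derive derivable.

Section SecondOrderCalculus.
Variables (R : realType) (m : nat).
Implicit Types (U : set 'rV[R]_m) (x u v w : 'rV[R]_m).

Lemma C1_derive_mxE (p q : nat) U (F : 'rV[R]_m -> 'M[R]_(p, q)) x v :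
  open U -> Ck_on 1 U F -> U x -> 'D_v F x = \sum_i v 0 i *: 'D_(basis_vec R i) F x.
Proof.
move=> oU CF Ux; have CFij i j := (Ck_on_mx _ _ oU).1 CF i j.
have dF w : derivable F x w.
  by apply/derivable_mxP => i j; exact: C1_derivable_fun oU (CFij i j) Ux.
apply/matrixP => i j; rewrite (derive_mx (dF v)) mxE summxE (C1_deriveE _ oU (CFij i j) Ux).
by apply: eq_bigr => k _; rewrite mxE (derive_mx (dF _)) mxE.
Qed.

Lemma C1_derivable_mx (p q : nat) U (F : 'rV[R]_m -> 'M[R]_(p, q)) x v :
  open U -> Ck_on 1 U F -> U x -> derivable F x v.
Proof.
move=> oU CF Ux; apply/derivable_mxP => i j.
exact: C1_derivable_fun oU ((Ck_on_mx _ _ oU).1 CF i j) Ux.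
Qed.

Lemma derive_mx_entry (p q : nat) U (F : 'rV[R]_m -> 'M[R]_(p, q)) x v i j :
  open U -> Ck_on 1 U F -> U x -> 'D_v (fun y => F y i j) x = 'D_v F x i j.
Proof. by move=> oU CF Ux; rewrite (derive_mx (C1_derivable_mx (v := v) oU CF Ux)) mxE. Qed.

Lemma derive_dirD (p q : nat) U (F : 'rV[R]_m -> 'M[R]_(p, q)) x u v :
  open U -> Ck_on 1 U F -> U x -> 'D_(u + v) F x = 'D_u F x + 'D_v F x.
Proof.
move=> oU CF Ux; rewrite !(C1_derive_mxE _ oU CF Ux) -big_split /=.
by apply: eq_bigr => i _; rewrite mxE scalerDl.
Qed.

Lemma derive_dirZ (p q : nat) U (F : 'rV[R]_m -> 'M[R]_(p, q)) x (a : R) v :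
  open U -> Ck_on 1 U F -> U x -> 'D_(a *: v) F x = a *: 'D_v F x.
Proof.
move=> oU CF Ux; rewrite !(C1_derive_mxE _ oU CF Ux) scaler_sumr.
by apply: eq_bigr => i _; rewrite mxE scalerA.
Qed.

Lemma derive_funD U (f : 'rV[R]_m -> R) x u v :
  open U -> Ck_on 1 U f -> U x -> 'D_(u + v) f x = 'D_u f x + 'D_v f x.
Proof.
move=> oU CF Ux; rewrite !(C1_deriveE _ oU CF Ux) -big_split /=.
by apply: eq_bigr => i _; rewrite mxE mulrDl.
Qed.

Lemma derive_funZ U (f : 'rV[R]_m -> R) x (a : R) v :
  open U -> Ck_on 1 U f -> U x -> 'D_(a *: v) f x = a * 'D_v f x.
Proof.
move=> oU CF Ux; rewrite !(C1_deriveE _ oU CF Ux) mulr_sumr.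
by apply: eq_bigr => i _; rewrite mxE mulrA.
Qed.

Lemma Ck_on_derive_along k U (f : 'rV[R]_m -> R) (X : 'rV[R]_m -> 'rV[R]_m) : open U ->
  Ck_on k.+1 U f -> Ck_on k U X -> Ck_on k U (fun y => 'D_(X y) f y).
Proof.
move=> oU Cf CX; have C1f : Ck_on 1 U f by elim: (k) Cf => // l IH /Ck_onW.
apply: (@Ck_on_eq _ _ R k U (fun y => \sum_i X y 0 i * 'D_(basis_vec R i) f y)) => //.
  by move=> y Uy; rewrite (C1_deriveE _ oU C1f Uy).
apply: Ck_on_sum => // i _; apply: Ck_onM => //; first exact: (Ck_on_mx _ _ oU).1.
exact: Ck_on_partial.
Qed.

Lemma Ck_on_derive_along_mx (p q : nat) k U (F : 'rV[R]_m -> 'M[R]_(p, q)) (X : 'rV[R]_m -> 'rV[R]_m) :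
  open U -> Ck_on k.+1 U F -> Ck_on k U X -> Ck_on k U (fun y => 'D_(X y) F y).
Proof.
move=> oU CF CX; have C1F : Ck_on 1 U F by elim: (k) CF => // l IH /Ck_onW.
apply/Ck_on_mx => // i j.
apply: (@Ck_on_eq _ _ R k U (fun y => 'D_(X y) (fun z => F z i j) y)) => //.
  by move=> y Uy; rewrite (derive_mx_entry _ _ _ oU C1F Uy).
by apply: Ck_on_derive_along => //; exact: (Ck_on_mx _ _ oU).1.
Qed.

Lemma derive_along U (f : 'rV[R]_m -> R) (X : 'rV[R]_m -> 'rV[R]_m) x v : open U ->
  Ck_on 2 U f -> Ck_on 1 U X -> U x ->
  'D_v (fun y => 'D_(X y) f y) x = 'D_('D_v X x) f x + 'D_v ('D_(X x) f) x.
Proof.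
move=> oU Cf CX Ux; have C1f : Ck_on 1 U f by exact: Ck_onW.
have Xi i := (Ck_on_mx _ _ oU).1 CX 0 i.
have Ci i : Ck_on 1 U ('D_(basis_vec R i) f) by exact: Ck_on_partial.
have E (Y : 'rV[R]_m -> 'rV[R]_m) : Ck_on 1 U Y -> 'D_v (fun y => 'D_(Y y) f y) x =
    \sum_i ('D_v Y x 0 i * 'D_(basis_vec R i) f x + Y x 0 i * 'D_v ('D_(basis_vec R i) f) x).
  move=> CY; have Yi i := (Ck_on_mx _ _ oU).1 CY 0 i.
  rewrite (_ : 'D_v (fun y => 'D_(Y y) f y) x = 'D_v (\sum_i (fun y => Y y 0 i * 'D_(basis_vec R i) f y)) x); last first.
    apply: near_eq_derive; apply: (open_near oU Ux) => y Uy.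
    by rewrite (C1_deriveE _ oU C1f Uy) fct_sumE.
  have dY i : derivable (fun y => Y y 0 i) x v by exact: C1_derivable_fun oU (Yi i) Ux.
  have df i : derivable ('D_(basis_vec R i) f) x v by exact: C1_derivable_fun oU (Ci i) Ux.
  rewrite derive_sum; last by move=> i; apply: derivableM.
  apply: eq_bigr => i _; rewrite (@deriveM _ _ (fun y => Y y 0 i) _ _ _ (dY i) (df i)).
  rewrite (derive_mx_entry _ _ _ oU CY Ux) /GRing.scale /= addrC; congr (_ + _).
  by rewrite mulrC.
rewrite E // big_split /= -(C1_deriveE _ oU C1f Ux); congr (_ + _).
rewrite (E (cst (X x))); last exact: Ck_on_cst.
by apply: eq_bigr => i _; rewrite derive_cst mxE mul0r add0r.
Qed.

Lemma derive_along_mx (p q : nat) U (F : 'rV[R]_m -> 'M[R]_(p, q)) (X : 'rV[R]_m -> 'rV[R]_m) x v :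
  open U -> Ck_on 2 U F -> Ck_on 1 U X -> U x ->
  'D_v (fun y => 'D_(X y) F y) x = 'D_('D_v X x) F x + 'D_v ('D_(X x) F) x.
Proof.
move=> oU CF CX Ux; have C1F : Ck_on 1 U F by exact: Ck_onW.
have C1D Y : Ck_on 1 U Y -> Ck_on 1 U (fun y => 'D_(Y y) F y).
  by move=> CY; exact: Ck_on_derive_along_mx.
have E Y i j : Ck_on 1 U Y -> 'D_v (fun y => 'D_(Y y) F y) x i j =
    'D_v (fun y => 'D_(Y y) (fun z => F z i j) y) x.
  move=> CY; rewrite -(derive_mx_entry _ i j oU (C1D Y CY) Ux).
  apply: near_eq_derive; apply: (open_near oU Ux) => y Uy.
  by rewrite (derive_mx_entry _ _ _ oU C1F Uy).
apply/matrixP => i j; rewrite E // (derive_along _ oU _ CX Ux); last exact: (Ck_on_mx _ _ oU).1.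
rewrite mxE (derive_mx_entry _ _ _ oU C1F Ux); congr (_ + _).
by symmetry; exact: (E (cst (X x)) i j (Ck_on_cst 1 U (X x))).
Qed.

Lemma derive_dir_sym U (F : 'rV[R]_m -> R) x u v : open U -> Ck_on 2 U F -> U x ->
  'D_u ('D_v F) x = 'D_v ('D_u F) x.
Proof.
move=> oU CF Ux; have C1f : Ck_on 1 U F by exact: Ck_onW.
have E a b : 'D_a ('D_b F) x = \sum_i \sum_j a 0 i * b 0 j * 'D_(basis_vec R i) ('D_(basis_vec R j) F) x.
  have Cb : Ck_on 1 U ('D_b F) by apply: (@Ck_on_derive_along 1 U F (cst b)) => //; exact: Ck_on_cst.
  rewrite (C1_deriveE _ oU Cb Ux); apply: eq_bigr => i _.
  rewrite (_ : 'D_(basis_vec R i) ('D_b F) x = 'D_(basis_vec R i) (\sum_j (b 0 j \*: 'D_(basis_vec R j) F)) x); last first.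
    apply: near_eq_derive; apply: (open_near oU Ux) => y Uy.
    by rewrite (C1_deriveE _ oU C1f Uy) fct_sumE.
  have dj j : derivable ('D_(basis_vec R j) F) x (basis_vec R i).
    exact: Ck_on_derivable (Ck_on_partial j CF) Ux.
  rewrite derive_sum; last by move=> j; apply: derivableZ.
  by rewrite mulr_sumr; apply: eq_bigr => j _; rewrite deriveZ // /GRing.scale /= mulrA.
rewrite !E exchange_big /=; apply: eq_bigr => i _; apply: eq_bigr => j _.
by rewrite (schwarz _ _ oU CF Ux) (mulrC (u 0 j)).
Qed.

Lemma derive_dir_sym_mx (p q : nat) U (F : 'rV[R]_m -> 'M[R]_(p, q)) x u v :
  open U -> Ck_on 2 U F -> U x -> 'D_u ('D_v F) x = 'D_v ('D_u F) x.
Proof.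
move=> oU CF Ux; have C1F : Ck_on 1 U F by exact: Ck_onW.
have C1D w : Ck_on 1 U ('D_w F).
  by apply: (@Ck_on_derive_along_mx p q 1 U F (cst w)) => //; exact: Ck_on_cst.
have E a b i j : 'D_a ('D_b F) x i j = 'D_a ('D_b (fun z => F z i j)) x.
  rewrite -(derive_mx_entry _ i j oU (C1D b) Ux).
  apply: near_eq_derive; apply: (open_near oU Ux) => y Uy.
  by rewrite (derive_mx_entry _ _ _ oU C1F Uy).
apply/matrixP => i j; apply: etrans (E u v i j) (etrans _ (esym (E v u i j))).
exact: (derive_dir_sym u v oU ((Ck_on_mx _ _ oU).1 CF i j) Ux).
Qed.

Lemma second_derive_mxE (p q : nat) U (F : 'rV[R]_m -> 'M[R]_(p, q)) x u v :
  open U -> Ck_on 2 U F -> U x ->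
  'D_u ('D_v F) x = \sum_i v 0 i *: 'D_u ('D_(basis_vec R i) F) x.
Proof.
move=> oU CF Ux; have C1F : Ck_on 1 U F by exact: Ck_onW.
rewrite (_ : 'D_u ('D_v F) x = 'D_u (\sum_i (v 0 i \*: 'D_(basis_vec R i) F)) x); last first.
  apply: near_eq_derive; apply: (open_near oU Ux) => y Uy.
  by rewrite (C1_derive_mxE _ oU C1F Uy) fct_sumE.
have di i : derivable ('D_(basis_vec R i) F) x u by exact: C1_derivable_mx oU (Ck_on_partial i CF) Ux.
rewrite derive_sum; last by move=> i; apply: derivableZ.
by apply: eq_bigr => i _; rewrite deriveZ.
Qed.

Lemma Ck_on_derive_dir (p q : nat) k U (F : 'rV[R]_m -> 'M[R]_(p, q)) v :
  open U -> Ck_on k.+1 U F -> Ck_on k U ('D_v F).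
Proof.
by move=> oU CF; apply: (@Ck_on_derive_along_mx p q k U F (cst v)) => //; exact: Ck_on_cst.
Qed.

End SecondOrderCalculus.

Section CompositionCalculus.
Variables (R : realType) (m : nat).
Implicit Types (U : set 'rV[R]_m) (x u v w : 'rV[R]_m).

Lemma derive_comp_mx (n p q : nat) U (U' : set 'rV[R]_n) (F : 'rV[R]_n -> 'M[R]_(p, q))
    (th : 'rV[R]_m -> 'rV[R]_n) x v : open U -> open U' ->
  Ck_on 1 U' F -> Ck_on 1 U th -> U x -> U' (th x) ->
  is_derive x v (F \o th) ('D_('D_v th x) F (th x)).
Proof.
move=> oU oU' CF Cth Ux Ux'.
have D i j := C1_derive_comp oU' ((Ck_on_mx _ _ oU').1 CF i j) Ux' (C1_derivable_mx (v := v) oU Cth Ux).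
have dd : derivable (F \o th) x v by apply/derivable_mxP => i j; have [] := D i j.
split; first exact: dd.
apply/matrixP => i j; rewrite (derive_mx dd) mxE.
by have [_ ->] := D i j; rewrite (derive_mx_entry _ _ _ oU' CF Ux').
Qed.

Lemma Ck_on_comp_mx (n p q : nat) k U (U' : set 'rV[R]_n) (F : 'rV[R]_n -> 'M[R]_(p, q))
    (th : 'rV[R]_m -> 'rV[R]_n) : open U -> open U' -> (forall x, U x -> U' (th x)) ->
  Ck_on k U th -> Ck_on k U' F -> Ck_on k U (F \o th).
Proof.
move=> oU oU' UU' Cth CF; apply/Ck_on_mx => // i j.
exact: (@Ck_on_comp _ _ _ k U U' th (fun z => F z i j) oU oU' UU' Cth ((Ck_on_mx _ _ oU').1 CF i j)).
Qed.

Lemma second_derive_comp (n p q : nat) U (U' : set 'rV[R]_n) (F : 'rV[R]_n -> 'M[R]_(p, q))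
    (th : 'rV[R]_m -> 'rV[R]_n) x u v : open U -> open U' -> (forall y, U y -> U' (th y)) ->
  Ck_on 2 U' F -> Ck_on 2 U th -> U x ->
  'D_u ('D_v (F \o th)) x =
  'D_('D_u th x) ('D_('D_v th x) F) (th x) + 'D_('D_u ('D_v th) x) F (th x).
Proof.
move=> oU oU' UU' CF Cth Ux.
have C1F : Ck_on 1 U' F by exact: Ck_onW.
have C1th : Ck_on 1 U th by exact: Ck_onW.
have Cv : Ck_on 1 U ('D_v th) by exact: (Ck_on_derive_dir v oU Cth).
have Ci i : Ck_on 1 U' ('D_(basis_vec R i) F) by exact: Ck_on_partial.
have Cvi i := (Ck_on_mx _ _ oU).1 Cv 0 i.
rewrite (_ : 'D_u ('D_v (F \o th)) x =
   'D_u (\sum_i (fun y => 'D_v th y 0 i *: ('D_(basis_vec R i) F \o th) y)) x); last first.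
  apply: near_eq_derive; apply: (open_near oU Ux) => y Uy.
  have [_ ->] := derive_comp_mx v oU oU' C1F C1th Uy (UU' y Uy).
  by rewrite (C1_derive_mxE _ oU' C1F (UU' y Uy)) fct_sumE.
have entry_der i : is_derive x u (fun y => 'D_v th y 0 i *: ('D_(basis_vec R i) F \o th) y)
   ('D_u ('D_v th) x 0 i *: 'D_(basis_vec R i) F (th x)
    + 'D_v th x 0 i *: 'D_('D_u th x) ('D_(basis_vec R i) F) (th x)).
  have [d1 E1] := derive_comp_mx u oU oU' (Ci i) C1th Ux (UU' x Ux).
  have d2 : derivable (fun y => 'D_v th y 0 i) x u by exact: C1_derivable_fun oU (Cvi i) Ux.
  have E2 := derive_mx_entry u 0 i oU Cv Ux.
  have dk k l : is_derive x u (fun y => ('D_v th y 0 i *: ('D_(basis_vec R i) F \o th) y) k l)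
     ('D_u ('D_v th) x 0 i * 'D_(basis_vec R i) F (th x) k l
     + 'D_v th x 0 i * 'D_('D_u th x) ('D_(basis_vec R i) F) (th x) k l).
    have -> : (fun y => ('D_v th y 0 i *: ('D_(basis_vec R i) F \o th) y) k l) =
       (fun y => 'D_v th y 0 i * ('D_(basis_vec R i) F \o th) y k l) by apply/funext => y; rewrite mxE.
    have dkl : derivable (fun y => ('D_(basis_vec R i) F \o th) y k l) x u by have /derivable_mxP/(_ k l) := d1.
    split; first exact: derivableM.
    rewrite (@deriveM _ _ (fun y => 'D_v th y 0 i) _ _ _ d2 dkl) E2 -E1 (derive_mx d1) mxE.
    by rewrite /GRing.scale /= addrC; congr (_ + _); rewrite mulrC.
  have dd : derivable (fun y => 'D_v th y 0 i *: ('D_(basis_vec R i) F \o th) y) x u.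
    by apply/derivable_mxP => k l; have [] := dk k l.
  split; first exact: dd.
  apply/matrixP => k l; rewrite (derive_mx dd) mxE.
  by have [_ ->] := dk k l; rewrite [RHS]mxE; congr (_ + _); rewrite [RHS]mxE.
rewrite derive_sum; last by move=> i; have [] := entry_der i.
under eq_bigr => i _ do (have [_ ->] := entry_der i).
rewrite big_split /= -(C1_derive_mxE _ oU' C1F (UU' x Ux)) addrC; congr (_ + _).
by rewrite (second_derive_mxE _ _ oU' CF (UU' x Ux)).
Qed.

End CompositionCalculus.

(** * The Levi-Civita connection *)

Section DeriveInner.
Variables (R : realType) (W : normedModType R) (n : nat).

Lemma is_derive_inner (Q : W -> 'M[R]_n) (A B : W -> 'rV[R]_n) (x v : W) :
  derivable Q x v -> derivable A x v -> derivable B x v ->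
  is_derive x v (fun y => inner (Q y) (A y) (B y))
    (inner ('D_v Q x) (A x) (B x) + inner (Q x) ('D_v A x) (B x) + inner (Q x) (A x) ('D_v B x)).
Proof.
move=> dQ dA dB.
have dQ' i j : derivable (fun y => Q y i j) x v by have /derivable_mxP/(_ i j) := dQ.
have dA' i j : derivable (fun y => A y i j) x v by have /derivable_mxP/(_ i j) := dA.
have dB' i j : derivable (fun y => B y i j) x v by have /derivable_mxP/(_ i j) := dB.
have EQ i j : 'D_v Q x i j = 'D_v (fun y => Q y i j) x by rewrite (derive_mx dQ) mxE.
have EA i j : 'D_v A x i j = 'D_v (fun y => A y i j) x by rewrite (derive_mx dA) mxE.
have EB i j : 'D_v B x i j = 'D_v (fun y => B y i j) x by rewrite (derive_mx dB) mxE.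
have innerE (Q' : 'M[R]_n) (a b : 'rV[R]_n) : inner Q' a b = \sum_j \sum_i a 0 i * Q' i j * b 0 j.
  by rewrite /inner mxE; apply: eq_bigr => j _; rewrite mxE mulr_suml; apply: eq_bigr => i _; rewrite mxE.
have -> : (fun y => inner (Q y) (A y) (B y)) =
    \sum_j \sum_i (fun y => A y 0 i * Q y i j * B y 0 j).
  apply/funext => y; rewrite innerE fct_sumE; apply: eq_bigr => j _.
  by rewrite fct_sumE.
have dterm i j : is_derive x v (fun y => A y 0 i * Q y i j * B y 0 j)
    ('D_v Q x i j * A x 0 i * B x 0 j + 'D_v A x 0 i * Q x i j * B x 0 j + A x 0 i * Q x i j * 'D_v B x 0 j).
  have d1 : derivable (fun y => A y 0 i * Q y i j) x v by apply: derivableM; [exact: dA'|exact: dQ'].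
  split; first by apply: derivableM; [exact: d1|exact: dB'].
  rewrite (@deriveM _ _ (fun y => A y 0 i * Q y i j) _ _ _ d1 (dB' 0 j)).
  rewrite (@deriveM _ _ (fun y => A y 0 i) _ _ _ (dA' 0 i) (dQ' i j)) EQ EA EB /GRing.scale /=.
  by ring.
have dcol j : is_derive x v (\sum_i (fun y => A y 0 i * Q y i j * B y 0 j))
  (\sum_i ('D_v Q x i j * A x 0 i * B x 0 j + 'D_v A x 0 i * Q x i j * B x 0 j + A x 0 i * Q x i j * 'D_v B x 0 j)).
  split; first by apply: derivable_sum => i; have [] := dterm i j.
  rewrite derive_sum; last by move=> i; have [] := dterm i j.
  by apply: eq_bigr => i _; have [_ ->] := dterm i j.
split; first by apply: derivable_sum => j; have [] := dcol j.
rewrite derive_sum; last by move=> j; have [] := dcol j.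
rewrite !innerE -!big_split /=; apply: eq_bigr => j _; have [_ ->] := dcol j.
by rewrite -!big_split /=; apply: eq_bigr => i _; ring.
Qed.

End DeriveInner.

Section InnerSums.
Variables (R : realType) (m : nat).
Implicit Types (u v : 'rV[R]_m).

Lemma inner_mx_sum (I : Type) (r : seq I) (P : pred I) (Q : I -> 'M[R]_m) u v :
  inner (\sum_(i <- r | P i) Q i) u v = \sum_(i <- r | P i) inner (Q i) u v.
Proof. by rewrite /inner mulmx_sumr mulmx_suml summxE. Qed.

Lemma inner_suml (Q : 'M[R]_m) (I : Type) (r : seq I) (P : pred I) (a : I -> 'rV[R]_m) v :
  inner Q (\sum_(i <- r | P i) a i) v = \sum_(i <- r | P i) inner Q (a i) v.
Proof. by rewrite /inner !mulmx_suml summxE. Qed.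

Lemma inner_sumr (Q : 'M[R]_m) (I : Type) (r : seq I) (P : pred I) (a : I -> 'rV[R]_m) v :
  inner Q v (\sum_(i <- r | P i) a i) = \sum_(i <- r | P i) inner Q v (a i).
Proof. by rewrite /inner linear_sum /= mulmx_sumr summxE. Qed.

Lemma inner_coordl (Q : 'M[R]_m) u v : inner Q u v = \sum_i u 0 i * inner Q (basis_vec R i) v.
Proof.
rewrite [X in inner Q X v](row_sum_basis u) inner_suml.
by apply: eq_bigr => i _; rewrite innerZl.
Qed.

Lemma inner_coordr (Q : 'M[R]_m) u v : inner Q u v = \sum_i v 0 i * inner Q u (basis_vec R i).
Proof.
rewrite [X in inner Q u X](row_sum_basis v) inner_sumr.
by apply: eq_bigr => i _; rewrite innerZr.
Qed.

Lemma inner_mulinv (Q : 'M[R]_m) u v : Q \in unitmx -> inner Q (u *m invmx Q) v = \sum_l u 0 l * v 0 l.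
Proof.
move=> uQ; rewrite /inner -(mulmxA _ (invmx _)) mulVmx // mulmx1 mxE.
by apply: eq_bigr => l _; rewrite mxE.
Qed.

Lemma inner_mulmxl (Q A : 'M[R]_m) u v : inner Q (u *m A) v = inner (A *m Q) u v.
Proof. by rewrite /inner !mulmxA. Qed.

Lemma inner_mulmxr (Q A : 'M[R]_m) u v : inner Q u (v *m A) = inner (Q *m A^T) u v.
Proof. by rewrite /inner trmx_mul !mulmxA. Qed.

End InnerSums.

#[local] Opaque inner.

Lemma inner_inj (R : realType) (m : nat) (Q : 'M[R]_m) (u v : 'rV[R]_m) : spd Q -> (forall w, inner Q u w = inner Q v w) -> u = v.
Proof.
move=> [_ pQ] H; apply/eqP; rewrite -subr_eq0; apply/negPn/negP => /pQ.
by rewrite innerDl innerNl H subrr ltxx.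
Qed.

(** * The Koszul formula at a point *)

Section KoszulAlgebra.
Variables (R : realType) (m : nat) (Q : 'M[R]_m) (d : 'I_m -> 'M[R]_m).
Implicit Types (u v w : 'rV[R]_m).
Hypotheses (sQ : spd Q) (sd : forall i, (d i)^T = d i).

(* The Levi-Civita connection at one point: [d i] stands for the [i]-th partial
   derivative of the metric. *)
Definition dirsum w : 'M[R]_m := \sum_i w 0 i *: d i.

(** Right-hand side of the Koszul formula for fields with constant coefficients, whose brackets
    vanish. *)
Definition koszul_form u v w : R :=
  inner (dirsum u) v w + inner (dirsum v) u w - inner (dirsum w) u v.

(** The formula of [christoffel_form], with an arbitrary family [d] in place of the partial
    derivatives of the metric. *)
Definition koszul_vec u v : 'rV[R]_m :=
  \row_k \sum_i \sum_j (2^-1 * \sum_l invmx Q k l * (d i j l + d j i l - d l i j)) * u 0 i * v 0 j.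

Lemma inner_dirsum a u v : inner (dirsum a) u v = \sum_i a 0 i * inner (d i) u v.
Proof. by rewrite /dirsum inner_mx_sum; apply: eq_bigr => i _; rewrite inner_mxZ. Qed.

Lemma koszul_form_coord u v w :
  koszul_form u v w = \sum_l w 0 l * koszul_form u v (basis_vec R l).
Proof.
rewrite /koszul_form (inner_coordr (dirsum u) v w) (inner_coordr (dirsum v) u w) (inner_dirsum w).
rewrite -big_split -sumrB /=; apply: eq_bigr => l _; rewrite (inner_dirsum (basis_vec R l)).
rewrite (bigD1 l) //= big1 => [|i il]; last by rewrite mxE (negbTE il) andbF mul0r.
by rewrite mxE !eqxx mul1r addr0 -mulrDr -mulrBr.
Qed.

Lemma inner_dirsum_entries a b l : inner (dirsum a) b (basis_vec R l) =
  \sum_i \sum_j a 0 i * b 0 j * d i j l.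
Proof.
rewrite inner_dirsum; apply: eq_bigr => i _.
rewrite (inner_coordl _ b) mulr_sumr; apply: eq_bigr => j _.
by rewrite inner_basis mulrA.
Qed.

Lemma koszul_form_basis u v l : koszul_form u v (basis_vec R l) =
  \sum_i \sum_j (d i j l + d j i l - d l i j) * u 0 i * v 0 j.
Proof.
rewrite /koszul_form !inner_dirsum_entries.
have E2 : inner (dirsum (basis_vec R l)) u v = \sum_i \sum_j u 0 i * v 0 j * d l i j.
  rewrite inner_dirsum (bigD1 l) //= big1 => [|i il]; last by rewrite mxE (negbTE il) andbF mul0r.
  rewrite mxE !eqxx mul1r addr0 (inner_coordl _ u v); apply: eq_bigr => i _.
  rewrite (inner_coordr _ _ v) mulr_sumr; apply: eq_bigr => j _.
  by rewrite inner_basis mulrA.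
rewrite E2 [X in _ + X - _]exchange_big /= -big_split -sumrB /=.
apply: eq_bigr => i _; rewrite -big_split -sumrB /=; apply: eq_bigr => j _.
by ring.
Qed.

Lemma koszul_vecE u v :
  koszul_vec u v = 2^-1 *: ((\row_l koszul_form u v (basis_vec R l)) *m invmx Q).
Proof.
apply/rowP => k; rewrite !mxE mulr_sumr.
transitivity (\sum_i \sum_j \sum_l 2^-1 * (invmx Q k l *
  ((d i j l + d j i l - d l i j) * u 0 i * v 0 j))).
  apply: eq_bigr => i _; apply: eq_bigr => j _.
  rewrite -mulrA -mulrA mulr_suml mulr_sumr; apply: eq_bigr => l _.
  by rewrite !mulrA.
under eq_bigr => i _ do rewrite exchange_big /=.
rewrite exchange_big /=; apply: eq_bigr => l _; rewrite mxE koszul_form_basis // mulr_suml mulr_sumr.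
apply: eq_bigr => i _; rewrite mulr_suml mulr_sumr; apply: eq_bigr => j _.
have -> : invmx Q k l = invmx Q l k.
  by have [sx _] := sQ; rewrite -[in LHS]sx -trmx_inv mxE.
by congr (_ * _); rewrite mulrC.
Qed.

(** Symmetry and compatibility with the metric are deduced from this identity and the nondegeneracy
    of [Q], with no return to indices. *)
Lemma koszul_vecP u v w : 2 * inner Q (koszul_vec u v) w = koszul_form u v w.
Proof.
rewrite koszul_vecE // innerZl mulrA divff ?mul1r //.
rewrite inner_mulinv ?spd_unitmx //.
by rewrite (koszul_form_coord u v w); apply: eq_bigr => l _; rewrite mxE mulrC.
Qed.

Lemma dirsum_sym w u v : inner (dirsum w) u v = inner (dirsum w) v u.
Proof. by rewrite !inner_dirsum; apply: eq_bigr => i _; rewrite (innerC u v (sd i)). Qed.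

Lemma koszul_vec_sym u v : koszul_vec u v = koszul_vec v u.
Proof.
apply: (inner_inj sQ) => w; have two : (2 : R) != 0 by [].
apply: (mulfI two); rewrite !koszul_vecP /koszul_form (dirsum_sym w u v).
by congr (_ - _); exact: addrC.
Qed.

Lemma koszul_vec_compatible u v w :
  inner (dirsum w) u v = inner Q (koszul_vec w u) v + inner Q u (koszul_vec w v).
Proof.
rewrite (spd_sym_inner u _ sQ); have two : (2 : R) != 0 by [].
apply: (mulfI two); rewrite mulrDr !koszul_vecP /koszul_form.
by rewrite (dirsum_sym w v u); ring.
Qed.

End KoszulAlgebra.

Section Koszul.
Variables (R : realType) (m : nat) (U : set 'rV[R]_m) (g : 'rV[R]_m -> 'M[R]_m).
Implicit Types (x u v w : 'rV[R]_m).
Hypotheses (oU : open U) (Cg : forall k, Ck_on k U g) (sg : forall x, U x -> spd (g x)).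

Notation Gam := (christoffel_form g).

Lemma metric_derive_sym x w : U x -> ('D_w g x)^T = 'D_w g x.
Proof.
move=> Ux; apply/matrixP => i j; rewrite mxE.
rewrite -!(derive_mx_entry w _ _ oU (Cg 1) Ux); apply: near_eq_derive.
apply: (open_near oU Ux) => y Uy; have [sy _] := sg Uy.
by rewrite -{1}sy mxE.
Qed.

Lemma christoffel_koszul x u v : U x ->
  Gam x u v = koszul_vec (g x) (fun i => 'D_(basis_vec R i) g x) u v.
Proof.
move=> Ux; apply/rowP => k; rewrite !mxE; apply: eq_bigr => i _; apply: eq_bigr => j _.
congr (_ * _ * _ * _); apply: eq_bigr => l _.
have E a b c := derive_mx_entry (basis_vec R a) b c oU (Cg 1) Ux.
by congr (_ * (_ + _ - _)); rewrite E.
Qed.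

Lemma derive_dirsum x w : U x -> 'D_w g x = dirsum (fun i => 'D_(basis_vec R i) g x) w.
Proof. by move=> Ux; exact: (C1_derive_mxE w oU (Cg 1) Ux). Qed.

Lemma koszul x u v w : U x -> 2 * inner (g x) (Gam x u v) w =
  inner ('D_u g x) v w + inner ('D_v g x) u w - inner ('D_w g x) u v.
Proof.
move=> Ux; rewrite christoffel_koszul // (koszul_vecP _ (sg Ux)).
by rewrite (derive_dirsum u Ux) (derive_dirsum v Ux) (derive_dirsum w Ux).
Qed.

Lemma Gam_sym x u v : U x -> Gam x u v = Gam x v u.
Proof.
move=> Ux; rewrite (christoffel_koszul u v Ux) (christoffel_koszul v u Ux).
by apply: (koszul_vec_sym (sg Ux)) => i; exact: metric_derive_sym.
Qed.

Lemma metric_compatible x u v w : U x ->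
  inner ('D_w g x) u v = inner (g x) (Gam x w u) v + inner (g x) u (Gam x w v).
Proof.
move=> Ux; rewrite (christoffel_koszul w u Ux) (christoffel_koszul w v Ux) (derive_dirsum w Ux).
by apply: (koszul_vec_compatible (sg Ux)) => i; exact: metric_derive_sym.
Qed.

Lemma GamDl x u v w : Gam x (u + v) w = Gam x u w + Gam x v w.
Proof.
apply/rowP => k; rewrite !mxE -big_split /=; apply: eq_bigr => i _.
by rewrite -big_split /=; apply: eq_bigr => j _; rewrite mxE; ring.
Qed.

Lemma GamZl x (a : R) u w : Gam x (a *: u) w = a *: Gam x u w.
Proof.
apply/rowP => k; rewrite !mxE mulr_sumr; apply: eq_bigr => i _.
by rewrite mulr_sumr; apply: eq_bigr => j _; rewrite mxE; ring.
Qed.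

Lemma GamDr x u v w : Gam x w (u + v) = Gam x w u + Gam x w v.
Proof.
apply/rowP => k; rewrite !mxE -big_split /=; apply: eq_bigr => i _.
by rewrite -big_split /=; apply: eq_bigr => j _; rewrite mxE; ring.
Qed.

Lemma GamZr x (a : R) u w : Gam x w (a *: u) = a *: Gam x w u.
Proof.
apply/rowP => k; rewrite !mxE mulr_sumr; apply: eq_bigr => i _.
by rewrite mulr_sumr; apply: eq_bigr => j _; rewrite mxE; ring.
Qed.

Lemma Gam0l x w : Gam x 0 w = 0.
Proof. by have := GamZl x 0 0 w; rewrite !scale0r. Qed.

Lemma Ck_on_christoffel k i j l : Ck_on k U (christoffel g l i j).
Proof.
have Ci : Ck_on k U (fun x => invmx (g x)) by apply: (Ck_on_invmx oU _ (Cg k)) => x /sg/spd_unitmx.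
have Cd a b c : Ck_on k U ('D_(basis_vec R a) (fun y => g y b c)).
  by apply: Ck_on_partial; exact: (Ck_on_mx k.+1 g oU).1 (Cg _) b c.
have Ce a b : Ck_on k U (fun y => invmx (g y) a b) by exact: (Ck_on_mx k (fun y => invmx (g y)) oU).1 Ci a b.
apply: (@Ck_onM _ _ k U (cst 2^-1)) => //; first exact: Ck_on_cst.
apply: Ck_on_sum => // a _; apply: Ck_onM => //.
by apply: Ck_onB => //; apply: Ck_onD.
Qed.

Lemma Ck_on_Gam (p : nat) (V : set 'rV[R]_p) k (F X Y : 'rV[R]_p -> 'rV[R]_m) : open V ->
  (forall y, V y -> U (F y)) -> Ck_on k V F -> Ck_on k V X -> Ck_on k V Y ->
  Ck_on k V (fun y => Gam (F y) (X y) (Y y)).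
Proof.
move=> oV VU CF CX CY; apply/Ck_on_mx => // a b.
apply: (@Ck_on_eq _ _ R k V (fun y => \sum_i \sum_j (christoffel g b i j \o F) y * X y 0 i * Y y 0 j)) => //.
  by move=> y _; rewrite mxE.
apply: Ck_on_sum => // i _; apply: Ck_on_sum => // j _.
apply: Ck_onM => //; last exact: (Ck_on_mx _ _ oV).1.
apply: Ck_onM => //; last exact: (Ck_on_mx _ _ oV).1.
exact: Ck_on_comp oV oU VU CF (Ck_on_christoffel k i j b).
Qed.

End Koszul.

(** [A] and [H] stand for the first and second derivatives of a change of coordinates at a point. Of
    the six terms in [H] that the Koszul formula produces, four cancel by symmetry and the other two
    add up to twice the pairing of [H u v] with [A w]. *)
Lemma koszul_transform (R : realType) (m n : nat) (Q : 'M[R]_m) (Q' : 'M[R]_n)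
    (d : 'rV[R]_m -> 'M[R]_m) (d' : 'rV[R]_n -> 'M[R]_n) (A : 'rV[R]_m -> 'rV[R]_n)
    (H : 'rV[R]_m -> 'rV[R]_m -> 'rV[R]_n) (G : 'rV[R]_m) (G' : 'rV[R]_n) u v w :
  spd Q' -> (forall a b, H a b = H b a) -> (forall a b, inner Q a b = inner Q' (A a) (A b)) ->
  (forall a b c, inner (d c) a b = inner (d' (A c)) (A a) (A b)
     + inner Q' (H c a) (A b) + inner Q' (A a) (H c b)) ->
  2 * inner Q G w = inner (d u) v w + inner (d v) u w - inner (d w) u v ->
  2 * inner Q' G' (A w) = inner (d' (A u)) (A v) (A w) + inner (d' (A v)) (A u) (A w)
     - inner (d' (A w)) (A u) (A v) ->
  inner Q' (A G) (A w) = inner Q' (G' + H u v) (A w).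
Proof.
move=> sQ' sH AQ Ad K K'; have two : (2 : R) != 0 by [].
apply: (mulfI two); rewrite -AQ K innerDl mulrDr K' !Ad (sH v u) (sH w u) (sH w v).
by rewrite (spd_sym_inner (A v) (H u w) sQ') (spd_sym_inner (A u) (H v w) sQ'); ring.
Qed.

(** * Christoffel symbols under a change of coordinates *)

Section Transformation.
Variables (R : realType) (m : nat) (U U' : set 'rV[R]_m) (g g' : 'rV[R]_m -> 'M[R]_m)
  (th : 'rV[R]_m -> 'rV[R]_m).
Implicit Types (x u v w : 'rV[R]_m).
Hypotheses (oU : open U) (oU' : open U') (UU' : forall x, U x -> U' (th x)).
Hypothesis Cth : forall k, Ck_on k U th.
Hypotheses (Cg : forall k, Ck_on k U g) (sg : forall x, U x -> spd (g x)).
Hypotheses (Cg' : forall k, Ck_on k U' g') (sg' : forall x, U' x -> spd (g' x)).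
Hypothesis isom : forall x u v, U x ->
  inner (g x) u v = inner (g' (th x)) ('D_u th x) ('D_v th x).

(** Vectors are rows: the differential acts by multiplication on the right, and this is the
    transpose of the usual Jacobian matrix. *)
Definition jac x : 'M[R]_m := \matrix_(i, j) 'D_(basis_vec R i) th x 0 j.

Lemma mul_jac x u : U x -> u *m jac x = 'D_u th x.
Proof.
move=> Ux; rewrite (C1_derive_mxE u oU (Cth 1) Ux) mulmx_sum_row.
by apply: eq_bigr => i _; congr (_ *: _); apply/rowP => j; rewrite !mxE.
Qed.

Lemma metric_jac x : U x -> g x = jac x *m g' (th x) *m (jac x)^T.
Proof.
move=> Ux; apply/matrixP => i j; rewrite -(inner_basis (g x)) isom // -!mul_jac //.
by rewrite inner_mulmxl inner_mulmxr inner_basis.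
Qed.

(** Invertibility is read off the isometry: the product J g' J^T is nondegenerate. The inverse
    change of coordinates does not enter. *)
Lemma jac_unit x : U x -> jac x \in unitmx.
Proof.
move=> Ux; have := spd_unitmx (sg Ux); rewrite metric_jac // -mulmxA unitmx_mul.
by case/andP.
Qed.

Lemma derive_th_surj x w : U x -> exists u, w = 'D_u th x.
Proof.
move=> Ux; exists (w *m invmx (jac x)).
by rewrite -mul_jac // -mulmxA mulVmx ?mulmx1 //; exact: jac_unit.
Qed.

Lemma invmx_metric_jac x : U x -> (jac x)^T *m invmx (g x) *m jac x = invmx (g' (th x)).
Proof.
move=> Ux; have uJ := jac_unit Ux; have uG := spd_unitmx (sg' (UU' Ux)).
have uJT : (jac x)^T \in unitmx by rewrite unitmx_tr.
have E : jac x *m g' (th x) = g x *m invmx (jac x)^T by rewrite (metric_jac Ux) mulmxK.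
rewrite -[LHS](mulmxK uG) -(mulmxA _ (jac x)) E -(mulmxA _ (invmx _)) (mulKmx (spd_unitmx (sg Ux))).
by rewrite mulmxV // mul1mx.
Qed.

Lemma derive_isom x u v w : U x ->
  inner ('D_w g x) u v = inner ('D_('D_w th x) g' (th x)) ('D_u th x) ('D_v th x)
   + inner (g' (th x)) ('D_w ('D_u th) x) ('D_v th x)
   + inner (g' (th x)) ('D_u th x) ('D_w ('D_v th) x).
Proof.
move=> Ux.
have C1D a : Ck_on 1 U ('D_a th) by exact: Ck_on_derive_dir oU (Cth 2).
have da a : derivable ('D_a th) x w by exact: C1_derivable_mx oU (C1D a) Ux.
have [dg' Eg'] := derive_comp_mx w oU oU' (Cg' 1) (Cth 1) Ux (UU' Ux).
have dg : derivable g x w by exact: C1_derivable_mx oU (Cg 1) Ux.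
have [_ E1] := @is_derive_inner _ _ _ g (cst u) (cst v) x w dg (@derivable_cst _ _ _ _ _ _) (@derivable_cst _ _ _ _ _ _).
have [_ E2] := is_derive_inner dg' (da u) (da v).
rewrite !derive_cst inner0l inner0r !addr0 in E1.
rewrite -Eg' -[RHS]E2 -E1; apply: near_eq_derive.
by apply: (open_near oU Ux) => y Uy /=; exact: isom.
Qed.

Lemma christoffel_transform x u v : U x ->
  'D_(christoffel_form g x u v) th x =
  christoffel_form g' (th x) ('D_u th x) ('D_v th x) + 'D_u ('D_v th) x.
Proof.
move=> Ux; apply: (inner_inj (sg' (UU' Ux))) => w'; have [w ->] := derive_th_surj w' Ux.
apply: (@koszul_transform R m m (g x) (g' (th x)) (fun a => 'D_a g x) (fun a => 'D_a g' (th x))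
  (fun a => 'D_a th x) (fun a b => 'D_a ('D_b th) x) _ _ u v w).
- exact: sg' (UU' Ux).
- by move=> a b; exact: derive_dir_sym_mx oU (Cth 2) Ux.
- by move=> a b; exact: isom.
- by move=> a b c; exact: derive_isom.
- exact: (koszul oU Cg sg u v w Ux).
- exact: (koszul oU' Cg' sg' ('D_u th x) ('D_v th x) ('D_w th x) (UU' Ux)).
Qed.

End Transformation.

Section CovariantDerivative.
Variables (R : realType) (m : nat) (U : set 'rV[R]_m) (g : 'rV[R]_m -> 'M[R]_m).
Implicit Types (x u v w : 'rV[R]_m).
Hypotheses (oU : open U) (Cg : forall k, Ck_on k U g) (sg : forall x, U x -> spd (g x)).

Notation Gam := (christoffel_form g).

Definition nabla (X : 'rV[R]_m -> 'rV[R]_m) x v : 'rV[R]_m := 'D_v X x + Gam x v (X x).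

Definition nabla_mx (X : 'rV[R]_m -> 'rV[R]_m) x : 'M[R]_m :=
  \matrix_(i, j) nabla X x (basis_vec R i) 0 j.

Definition Gam_mx x w : 'M[R]_m := \matrix_(i, j) Gam x (basis_vec R i) w 0 j.

Lemma mul_Gam_mx x v w : v *m Gam_mx x w = Gam x v w.
Proof.
rewrite mulmx_sum_row [in RHS](row_sum_basis v).
rewrite (big_morph (fun v => Gam x v w) (fun a b => GamDl g x a b w) (Gam0l g x w)).
apply: eq_bigr => i _; rewrite GamZl; congr (_ *: _).
by apply/rowP => j; rewrite !mxE.
Qed.

Lemma mul_nabla_mx X x v : Ck_on 1 U X -> U x -> v *m nabla_mx X x = nabla X x v.
Proof.
move=> CX Ux; rewrite /nabla -mul_Gam_mx (C1_derive_mxE v oU CX Ux) !mulmx_sum_row -big_split /=.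
apply: eq_bigr => i _; rewrite -scalerDr; congr (_ *: _).
by apply/rowP => j; rewrite !mxE.
Qed.

Lemma metric_derive_mx x w : U x ->
  'D_w g x = Gam_mx x w *m g x + g x *m (Gam_mx x w)^T.
Proof.
move=> Ux; apply/matrixP => i j; rewrite -(inner_basis ('D_w g x)).
rewrite (metric_compatible oU Cg sg _ _ _ Ux) (Gam_sym oU Cg sg w _ Ux) (Gam_sym oU Cg sg w _ Ux).
rewrite -!mul_Gam_mx.
by rewrite inner_mulmxl inner_mulmxr !inner_basis !mxE.
Qed.

(** Compatibility writes the derivative of the metric along [w] as Gam g plus its transpose, so that
    half of its trace against the inverse metric is the trace of Gam. The term coming from the
    density is therefore the Christoffel part of the covariant derivative. *)
Lemma chart_div_trace X x : Ck_on 1 U X -> U x -> chart_div g X x = \tr (nabla_mx X x).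
Proof.
move=> CX Ux; rewrite /chart_div big_split /= /mxtrace.
have -> : \sum_i nabla_mx X x i i = \sum_i 'D_(basis_vec R i) (fun y => X y 0 i) x + \tr (Gam_mx x (X x)).
  rewrite /mxtrace -big_split /=; apply: eq_bigr => i _.
  by rewrite !mxE (derive_mx_entry _ _ _ oU CX Ux).
congr (_ + _).
have -> : \sum_i 2^-1 * \tr ('D_(basis_vec R i) g x *m invmx (g x)) * X x 0 i =
    2^-1 * \tr ('D_(X x) g x *m invmx (g x)).
  rewrite (C1_derive_mxE _ oU (Cg 1) Ux) mulmx_suml raddf_sum mulr_sumr /=.
  by apply: eq_bigr => i _; rewrite -scalemxAl mxtraceZ; ring.
have ug := spd_unitmx (sg Ux).
rewrite (metric_derive_mx _ Ux) mulmxDl -!mulmxA mulmxV // mulmx1 mxtraceD.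
rewrite [X in _ + X]mxtrace_mulC -mulmxA mulVmx // mulmx1 mxtrace_tr.
by move: (\tr _) => t; field.
Qed.

End CovariantDerivative.

(** * Change of charts *)

#[local] Opaque christoffel_form.

(** The vector that represents the linear form [om] for the inner product [Q]; [gradient] is the
    case of a differential. *)
Definition sharp (R : realType) (m : nat) (Q : 'M[R]_m) (om : 'rV[R]_m -> R) : 'rV[R]_m :=
  (\row_l om (basis_vec R l)) *m invmx Q.

Lemma inner_sharp (R : realType) (m : nat) (Q : 'M[R]_m) (om : 'rV[R]_m -> R) w :
  spd Q -> (forall u v, om (u + v) = om u + om v) -> (forall (a : R) u, om (a *: u) = a * om u) ->
  inner Q (sharp Q om) w = om w.
Proof.
move=> sQ omD omZ; rewrite /sharp inner_mulinv ?spd_unitmx //.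
have om0 : om 0 = 0 by rewrite -(scale0r (0 : 'rV[R]_m)) omZ mul0r.
rewrite [in RHS](row_sum_basis w) (big_morph om omD om0).
by apply: eq_bigr => l _; rewrite mxE omZ mulrC.
Qed.

Section FieldTransformation.
Variables (R : realType) (m : nat) (U U' : set 'rV[R]_m) (g g' : 'rV[R]_m -> 'M[R]_m)
  (th : 'rV[R]_m -> 'rV[R]_m).
Implicit Types (x u v w : 'rV[R]_m).
Hypotheses (oU : open U) (oU' : open U') (UU' : forall x, U x -> U' (th x)).
Hypothesis Cth : forall k, Ck_on k U th.
Hypotheses (Cg : forall k, Ck_on k U g) (sg : forall x, U x -> spd (g x)).
Hypotheses (Cg' : forall k, Ck_on k U' g') (sg' : forall x, U' x -> spd (g' x)).
Hypothesis isom : forall x u v, U x ->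
  inner (g x) u v = inner (g' (th x)) ('D_u th x) ('D_v th x).

Lemma transform_eq x X X' : U x -> (forall w, inner (g x) X w = inner (g' (th x)) X' ('D_w th x)) ->
  X' = 'D_X th x.
Proof.
move=> Ux E; apply: (inner_inj (sg' (UU' Ux))) => w'.
have [w ->] := derive_th_surj oU Cth sg isom w' Ux.
by rewrite -E; exact: isom.
Qed.

Lemma nabla_transform X X' x v : Ck_on 1 U X -> Ck_on 1 U' X' ->
  (forall y, U y -> X' (th y) = 'D_(X y) th y) -> U x ->
  nabla g' X' (th x) ('D_v th x) = 'D_(nabla g X x v) th x.
Proof.
move=> CX CX' XX' Ux; rewrite /nabla (derive_dirD _ _ oU (Cth 1) Ux).
rewrite (christoffel_transform oU oU' UU' Cth Cg sg Cg' sg' isom v (X x) Ux) XX' //.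
have [_ E] := derive_comp_mx v oU oU' CX' (Cth 1) Ux (UU' Ux).
have E2 : 'D_v (X' \o th) x = 'D_v (fun y => 'D_(X y) th y) x.
  by apply: near_eq_derive; apply: (open_near oU Ux) => y Uy; exact: XX'.
rewrite -E E2 (derive_along_mx _ oU (Cth 2) CX Ux) -!addrA; congr (_ + _).
exact: addrC.
Qed.

(** The matrices of the two covariant derivatives are conjugate by the Jacobian, hence have the same
    trace. *)
Lemma chart_div_transform X X' x : Ck_on 1 U X -> Ck_on 1 U' X' ->
  (forall y, U y -> X' (th y) = 'D_(X y) th y) -> U x ->
  chart_div g' X' (th x) = chart_div g X x.
Proof.
move=> CX CX' XX' Ux; have Ux' := UU' Ux.
rewrite (chart_div_trace oU Cg sg CX Ux) (chart_div_trace oU' Cg' sg' CX' Ux').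
have uJ := jac_unit oU Cth sg isom Ux.
have E : jac th x *m nabla_mx g' X' (th x) = nabla_mx g X x *m jac th x.
  apply/row_matrixP => i; rewrite !rowE !mulmxA (mul_jac oU Cth _ Ux).
  rewrite (mul_nabla_mx g' oU' _ CX' Ux') (mul_nabla_mx g oU _ CX Ux) (mul_jac oU Cth _ Ux).
  exact: (nabla_transform _ CX CX' XX' Ux).
by rewrite -[nabla_mx g' X' (th x)](mulKmx uJ) E mxtrace_mulC -mulmxA mulmxV // mulmx1.
Qed.

End FieldTransformation.

Lemma derive_dirN (R : realType) (m p q : nat) (U : set 'rV[R]_m) (G : 'rV[R]_m -> 'M[R]_(p, q)) x v :
  open U -> Ck_on 1 U G -> U x -> 'D_(- v) G x = - 'D_v G x.
Proof. by move=> oU CG Ux; rewrite -scaleN1r (derive_dirZ _ _ oU CG Ux) scaleN1r. Qed.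

(** * Bilinearity of the second fundamental form *)

Section SecondFundamentalForm.
Variables (R : realType) (m n : nat) (U : set 'rV[R]_m) (g : 'rV[R]_m -> 'M[R]_m)
  (h : 'rV[R]_n -> 'M[R]_n) (F : 'rV[R]_m -> 'rV[R]_n).
Implicit Types (x u v w : 'rV[R]_m).
Hypotheses (oU : open U) (CF : forall k, Ck_on k U F).

(** [second_fundamental_form] on constant fields, for which the source connection reduces to its
    Christoffel term. Bilinearity gives access to other bases and frames. *)
Definition sff x u v : 'rV[R]_n :=
  'D_u ('D_v F) x + christoffel_form h (F x) ('D_u F x) ('D_v F x) - 'D_(christoffel_form g x u v) F x.

Lemma second_fundamental_form_cst x u v :
  second_fundamental_form g h F (cst u) (cst v) x = sff x u v.
Proof.
rewrite /second_fundamental_form /pullback_connection /pushforward /levi_civita /sff /=.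
by rewrite derive_cst add0r.
Qed.

Let C1D w : Ck_on 1 U ('D_w F). Proof. exact: Ck_on_derive_dir oU (CF 2). Qed.

Let add3 (a a' b b' c c' : 'rV[R]_n) : (a + a') + (b + b') - (c + c') = (a + b - c) + (a' + b' - c').
Proof. by apply/rowP => j; rewrite !mxE; ring. Qed.

Let scale3 (r : R) (a b c : 'rV[R]_n) : r *: a + r *: b - r *: c = r *: (a + b - c).
Proof. by rewrite scalerBr scalerDr. Qed.

Lemma sffDl x u v w : U x -> sff x (u + v) w = sff x u w + sff x v w.
Proof.
move=> Ux; rewrite /sff -add3; congr (_ + _ - _).
- exact: (derive_dirD u v oU (C1D w) Ux).
- exact: (etrans (congr1 (fun z => christoffel_form h (F x) z ('D_w F x)) (derive_dirD u v oU (CF 1) Ux)) (GamDl _ _ _ _ _)).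
- exact: (etrans (congr1 (fun z => 'D_z F x) (GamDl _ _ _ _ _)) (derive_dirD _ _ oU (CF 1) Ux)).
Qed.

Lemma sffZl x (a : R) u w : U x -> sff x (a *: u) w = a *: sff x u w.
Proof.
move=> Ux; rewrite /sff -scale3; congr (_ + _ - _).
- exact: (derive_dirZ a u oU (C1D w) Ux).
- exact: (etrans (congr1 (fun z => christoffel_form h (F x) z ('D_w F x)) (derive_dirZ a u oU (CF 1) Ux)) (GamZl _ _ _ _ _)).
- exact: (etrans (congr1 (fun z => 'D_z F x) (GamZl _ _ _ _ _)) (derive_dirZ a _ oU (CF 1) Ux)).
Qed.

Let second_sym x u v : U x -> 'D_u ('D_v F) x = 'D_v ('D_u F) x.
Proof. exact: derive_dir_sym_mx oU (CF 2). Qed.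

Lemma sffDr x u v w : U x -> sff x w (u + v) = sff x w u + sff x w v.
Proof.
move=> Ux; rewrite /sff -add3; congr (_ + _ - _).
(* Linearity in the inner direction is borrowed from that in the outer one, second derivatives being
   symmetric. *)
- exact: (etrans (second_sym w (u + v) Ux) (etrans (derive_dirD u v oU (C1D w) Ux)
    (f_equal2 (fun y z => y + z) (second_sym u w Ux) (second_sym v w Ux)))).
- exact: (etrans (congr1 (fun z => christoffel_form h (F x) ('D_w F x) z) (derive_dirD u v oU (CF 1) Ux)) (GamDr _ _ _ _ _)).
- exact: (etrans (congr1 (fun z => 'D_z F x) (GamDr _ _ _ _ _)) (derive_dirD _ _ oU (CF 1) Ux)).
Qed.

Lemma sffZr x (a : R) u w : U x -> sff x w (a *: u) = a *: sff x w u.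
Proof.
move=> Ux; rewrite /sff -scale3; congr (_ + _ - _).
- exact: (etrans (second_sym w (a *: u) Ux)
    (etrans (derive_dirZ a u oU (C1D w) Ux) (congr1 (fun z => a *: z) (second_sym u w Ux)))).
- exact: (etrans (congr1 (fun z => christoffel_form h (F x) ('D_w F x) z) (derive_dirZ a u oU (CF 1) Ux)) (GamZr _ _ _ _ _)).
- exact: (etrans (congr1 (fun z => 'D_z F x) (GamZr _ _ _ _ _)) (derive_dirZ a _ oU (CF 1) Ux)).
Qed.

Lemma sff_sum x u v : U x -> sff x u v =
  \sum_i \sum_j (u 0 i * v 0 j) *: sff x (basis_vec R i) (basis_vec R j).
Proof.
move=> Ux; have l0 w : sff x 0 w = 0 by have := sffZl 0 0 w Ux; rewrite !scale0r.
have r0 w : sff x w 0 = 0 by have := sffZr 0 0 w Ux; rewrite !scale0r.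
rewrite [in LHS](row_sum_basis u).
rewrite (big_morph (fun a => sff x a v) (fun a b => sffDl a b v Ux) (l0 v)).
apply: eq_bigr => i _; rewrite sffZl // [in LHS](row_sum_basis v).
rewrite (big_morph (fun a => sff x _ a) (fun a b => sffDr a b _ Ux) (r0 _)) scaler_sumr.
by apply: eq_bigr => j _; rewrite sffZr // scalerA.
Qed.

End SecondFundamentalForm.

(** Trace of a bilinear form under a congruence. It serves twice: for a change of source chart and
    for the passage to an orthonormal frame. *)
Lemma congruence_sum (R : realType) (m n : nat) (J G : 'M[R]_m) (S : 'I_m -> 'I_m -> 'rV[R]_n) :
  \sum_k \sum_l (J^T *m G *m J) k l *: S k l =
  \sum_i \sum_j G i j *: \sum_k \sum_l (J i k * J j l) *: S k l.
Proof.
transitivity (\sum_k \sum_l \sum_i \sum_j (G i j * (J i k * J j l)) *: S k l).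
  apply: eq_bigr => k _; apply: eq_bigr => l _.
  rewrite mxE exchange_big /= scaler_suml; apply: eq_bigr => j _.
  rewrite mxE mulr_suml scaler_suml; apply: eq_bigr => i _.
  by rewrite mxE; congr (_ *: _); ring.
under eq_bigr => k _ do rewrite exchange_big /=.
rewrite exchange_big /=; apply: eq_bigr => i _.
under eq_bigr => k _ do rewrite exchange_big /=.
rewrite exchange_big /=; apply: eq_bigr => j _.
rewrite scaler_sumr; apply: eq_bigr => k _; rewrite scaler_sumr; apply: eq_bigr => l _.
by rewrite scalerA.
Qed.

Lemma derive_dir_sum (R : realType) (m p q : nat) (U : set 'rV[R]_m) (G : 'rV[R]_m -> 'M[R]_(p, q)) x
    (I : Type) (r : seq I) (v : I -> 'rV[R]_m) : open U -> Ck_on 1 U G -> U x ->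
  'D_(\sum_(i <- r) v i) G x = \sum_(i <- r) 'D_(v i) G x.
Proof.
move=> oU CG Ux; elim: r => [|i r IH].
  by have := derive_dirZ 0 0 oU CG Ux; rewrite !big_nil !scale0r.
rewrite !big_cons -IH; exact: (derive_dirD _ _ oU CG Ux).
Qed.

(** * The f-tension field under changes of both charts *)

Section MapTransformation.
Variables (R : realType) (m n : nat) (U U' : set 'rV[R]_m) (g g' : 'rV[R]_m -> 'M[R]_m)
  (th : 'rV[R]_m -> 'rV[R]_m).
Variables (Y Y' : set 'rV[R]_n) (h h' : 'rV[R]_n -> 'M[R]_n) (eta : 'rV[R]_n -> 'rV[R]_n).
Variables (F F' : 'rV[R]_m -> 'rV[R]_n) (f f' : 'rV[R]_m -> R).
Implicit Types (x u v w : 'rV[R]_m).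
Hypotheses (oU : open U) (oU' : open U') (UU' : forall x, U x -> U' (th x)).
Hypothesis Cth : forall k, Ck_on k U th.
Hypotheses (Cg : forall k, Ck_on k U g) (sg : forall x, U x -> spd (g x)).
Hypotheses (Cg' : forall k, Ck_on k U' g') (sg' : forall x, U' x -> spd (g' x)).
Hypothesis isom : forall x u v, U x ->
  inner (g x) u v = inner (g' (th x)) ('D_u th x) ('D_v th x).
Hypotheses (oY : open Y) (oY' : open Y') (YY' : forall y, Y y -> Y' (eta y)).
Hypothesis Ceta : forall k, Ck_on k Y eta.
Hypotheses (Ch : forall k, Ck_on k Y h) (sh : forall y, Y y -> spd (h y)).
Hypotheses (Ch' : forall k, Ck_on k Y' h') (sh' : forall y, Y' y -> spd (h' y)).
Hypothesis isomh : forall y (u v : 'rV[R]_n), Y y ->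
  inner (h y) u v = inner (h' (eta y)) ('D_u eta y) ('D_v eta y).
Hypotheses (UY : forall x, U x -> Y (F x)) (CF : forall k, Ck_on k U F).
Hypotheses (CF' : forall k, Ck_on k U' F').
Hypothesis FF' : forall x, U x -> F' (th x) = eta (F x).
Hypotheses (Cf : forall k, Ck_on k U f) (Cf' : forall k, Ck_on k U' f').
Hypothesis ff' : forall x, U x -> f' (th x) = f x.

Lemma derive_map_transform x v : U x ->
  'D_('D_v th x) F' (th x) = 'D_('D_v F x) eta (F x).
Proof.
move=> Ux; have [_ <-] := derive_comp_mx v oU oU' (CF' 1) (Cth 1) Ux (UU' Ux).
have [_ <-] := derive_comp_mx v oU oY (Ceta 1) (CF 1) Ux (UY Ux).
by apply: near_eq_derive; apply: (open_near oU Ux) => y Uy; exact: FF'.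
Qed.

(** Both sides expand the second derivative of one map, F' after [th], which is also [eta] after
    F. *)
Lemma second_derive_map_transform x u v : U x ->
  'D_('D_u th x) ('D_('D_v th x) F') (th x) + 'D_('D_u ('D_v th) x) F' (th x) =
  'D_('D_u F x) ('D_('D_v F x) eta) (F x) + 'D_('D_u ('D_v F) x) eta (F x).
Proof.
move=> Ux; have E1 := second_derive_comp u v oU oU' UU' (CF' 2) (Cth 2) Ux.
have E2 := second_derive_comp u v oU oY UY (Ceta 2) (CF 2) Ux.
apply: (etrans (esym E1) (etrans _ E2)).
apply: near_eq_derive; apply: (open_near oU Ux) => y Uy; apply: near_eq_derive.
exact: (open_near oU Uy FF').
Qed.

(** [hf] and [he] carry the second derivatives of the source and target changes of coordinates. Each
    cancels against the inhomogeneous term in the transformation law of the corresponding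
    Christoffel symbols. *)
Let sff_transform_alg (t s1 s2 a ad he hf gh gh' gh'' gg gg' : 'rV[R]_n) :
  t = s1 + s2 -> s1 = ad + gh -> s2 = - gg -> a + hf = he + ad -> gh = gh'' + he ->
  gg' + hf = gg -> gh' = gh'' -> a + gh' - gg' = t.
Proof.
move=> -> -> -> E1 -> <- ->; rewrite -[a](addrK hf) E1.
by apply/rowP => j; rewrite !mxE; ring.
Qed.

Lemma sff_transform x u v : U x ->
  sff g' h' F' (th x) ('D_u th x) ('D_v th x) = 'D_(sff g h F x u v) eta (F x).
Proof.
move=> Ux; have Yx := UY Ux; have C1 := Ceta 1; rewrite /sff.
have R1 := derive_dirD ('D_u ('D_v F) x + christoffel_form h (F x) ('D_u F x) ('D_v F x))
  (- 'D_(christoffel_form g x u v) F x) oY C1 Yx.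
have R2 := derive_dirD ('D_u ('D_v F) x) (christoffel_form h (F x) ('D_u F x) ('D_v F x)) oY C1 Yx.
have R3 := derive_dirN ('D_(christoffel_form g x u v) F x) oY C1 Yx.
have E1 := second_derive_map_transform u v Ux.
have E2 := christoffel_transform oY oY' YY' Ceta Ch sh Ch' sh' isomh ('D_u F x) ('D_v F x) Yx.
have E3 := derive_map_transform (christoffel_form g x u v) Ux.
have E4 : 'D_('D_(christoffel_form g x u v) th x) F' (th x) = _ :=
  etrans (congr1 (fun z => 'D_z F' (th x))
    (christoffel_transform oU oU' UU' Cth Cg sg Cg' sg' isom u v Ux))
   (derive_dirD (christoffel_form g' (th x) ('D_u th x) ('D_v th x)) ('D_u ('D_v th) x)
     oU' (CF' 1) (UU' Ux)).
have E5 : christoffel_form h' (F' (th x)) ('D_('D_u th x) F' (th x)) ('D_('D_v th x) F' (th x)) =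
  christoffel_form h' (eta (F x)) ('D_('D_u F x) eta (F x)) ('D_('D_v F x) eta (F x)).
  by rewrite (FF' Ux) (derive_map_transform u Ux) (derive_map_transform v Ux).
exact: (sff_transform_alg R1 R2 R3 E1 E2 (etrans (esym E4) E3) E5).
Qed.

Lemma tensionE p (G : 'rV[R]_p -> 'M[R]_p) (H : 'rV[R]_n -> 'M[R]_n) (K : 'rV[R]_p -> 'rV[R]_n) y :
  tension G H K y =
  \sum_i \sum_j invmx (G y) i j *: sff G H K y (basis_vec R i) (basis_vec R j).
Proof.
by apply: eq_bigr => i _; apply: eq_bigr => j _; rewrite second_fundamental_form_cst.
Qed.

Lemma tension_transform x : U x ->
  tension g' h' F' (th x) = 'D_(tension g h F x) eta (F x).
Proof.
move=> Ux; have EJ := invmx_metric_jac oU UU' Cth sg sg' isom Ux.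
pose S k l := sff g' h' F' (th x) (basis_vec R k) (basis_vec R l).
have L : tension g' h' F' (th x) = \sum_i \sum_j invmx (g x) i j *: \sum_k \sum_l
    (jac th x i k * jac th x j l) *: S k l.
  exact: (etrans (tensionE g' h' F' (th x)) (etrans (congr1 (fun Q : 'M[R]_m => \sum_i \sum_j Q i j *: S i j)
    (esym EJ)) (congruence_sum _ _ _))).
have Yx := UY Ux; have C1 := Ceta 1.
apply: (etrans L); rewrite [in RHS]tensionE; apply: (esym (etrans (derive_dir_sum _ _ oY C1 Yx) _)).
apply: eq_bigr => i _; apply: (etrans (derive_dir_sum _ _ oY C1 Yx)).
apply: eq_bigr => j _; apply: (etrans (derive_dirZ _ _ oY C1 Yx)); congr (_ *: _).
apply: (etrans (esym (sff_transform _ _ Ux))).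
apply: (etrans (sff_sum g' h' oU' CF' _ _ (UU' Ux))).
apply: eq_bigr => k _; apply: eq_bigr => l _.
by congr (_ * _ *: _); rewrite mxE.
Qed.

Lemma gradient_transform x : U x ->
  gradient g' f' (th x) = 'D_(gradient g f x) th x.
Proof.
move=> Ux; apply: (transform_eq oU UU' Cth sg sg' isom Ux) => w.
have S := @inner_sharp R m (g x) (fun v => 'D_v f x) w (sg Ux)
  (fun u v => derive_funD u v oU (Cf 1) Ux) (fun a v => derive_funZ a v oU (Cf 1) Ux).
have S' := @inner_sharp R m (g' (th x)) (fun v => 'D_v f' (th x)) ('D_w th x) (sg' (UU' Ux))
  (fun u v => derive_funD u v oU' (Cf' 1) (UU' Ux)) (fun a v => derive_funZ a v oU' (Cf' 1) (UU' Ux)).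
have [_ E] := C1_derive_comp oU' (Cf' 1) (UU' Ux) (C1_derivable (v := w) oU (Cth 1) Ux).
have E2 : 'D_w f x = 'D_w (f' \o th) x.
  by apply: near_eq_derive; apply: (open_near oU Ux) => y Uy; exact: (esym (ff' Uy)).
exact: (etrans S (etrans (etrans E2 E) (esym S'))).
Qed.

Lemma f_tension_transform x : U x ->
  f_tension g' h' F' f' (th x) = 'D_(f_tension g h F f x) eta (F x).
Proof.
move=> Ux; rewrite /f_tension /pushforward (gradient_transform Ux) (tension_transform Ux) (ff' Ux).
rewrite (derive_map_transform (gradient g f x) Ux).
have Yx := UY Ux; have C1 := Ceta 1.
apply: (esym (etrans (derive_dirD _ _ oY C1 Yx) _)); congr (_ + _).
exact: derive_dirZ oY C1 Yx.
Qed.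

End MapTransformation.

(** * Curvature *)

Lemma Ck_on_id (R : realType) (m : nat) k (U : set 'rV[R]_m) : open U -> Ck_on k U (fun x : 'rV[R]_m => x).
Proof.
by move=> oU; apply/Ck_on_mx => // i j; rewrite ord1; exact: Ck_on_coord.
Qed.

Lemma Ck_on_inner (R : realType) (m n : nat) k (U : set 'rV[R]_m) (Q : 'rV[R]_m -> 'M[R]_n)
    (A B : 'rV[R]_m -> 'rV[R]_n) : open U -> Ck_on k U Q -> Ck_on k U A -> Ck_on k U B ->
  Ck_on k U (fun y => inner (Q y) (A y) (B y)).
Proof.
move=> oU CQ CA CB.
apply: (@Ck_on_eq _ _ R k U (fun y => \sum_i \sum_j A y 0 i * B y 0 j * Q y i j)) => //.
  move=> y _; rewrite inner_coordl; apply: eq_bigr => i _.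
  by rewrite inner_coordr mulr_sumr; apply: eq_bigr => j _; rewrite inner_basis mulrA.
apply: Ck_on_sum => // i _; apply: Ck_on_sum => // j _; apply: Ck_onM => //.
  by apply: Ck_onM => //; [exact: (Ck_on_mx k A oU).1 CA 0 i|exact: (Ck_on_mx k B oU).1 CB 0 j].
exact: (Ck_on_mx k Q oU).1 CQ i j.
Qed.

Section PullbackConnection.
Variables (R : realType) (m n : nat) (U : set 'rV[R]_m) (Y : set 'rV[R]_n)
  (h : 'rV[R]_n -> 'M[R]_n) (F : 'rV[R]_m -> 'rV[R]_n).
Implicit Types (x u v w : 'rV[R]_m) (V Z : 'rV[R]_m -> 'rV[R]_n).
Hypotheses (oU : open U) (oY : open Y) (UY : forall x, U x -> Y (F x)).
Hypotheses (Ch : forall k, Ck_on k Y h) (sh : forall y, Y y -> spd (h y)).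
Hypothesis CF : forall k, Ck_on k U F.

Definition nablaF V x v : 'rV[R]_n := 'D_v V x + christoffel_form h (F x) ('D_v F x) (V x).

Lemma is_derive_pullback_inner V Z x v : Ck_on 1 U V -> Ck_on 1 U Z -> U x ->
  is_derive x v (fun y => inner (h (F y)) (V y) (Z y))
    (inner (h (F x)) (nablaF V x v) (Z x) + inner (h (F x)) (V x) (nablaF Z x v)).
Proof.
move=> CV CZ Ux; have Yx := UY Ux.
have [dh Eh] := derive_comp_mx v oU oY (Ch 1) (CF 1) Ux Yx.
have [d E] := is_derive_inner dh (C1_derivable_mx (v := v) oU CV Ux) (C1_derivable_mx (v := v) oU CZ Ux).
split; first exact: d.
apply: (etrans E); rewrite Eh /nablaF innerDl innerDr.
rewrite (metric_compatible oY Ch sh (V x) (Z x) ('D_v F x) Yx) /=.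
move: (inner _ _ _) (inner _ _ _) (inner _ _ _) (inner _ _ _) => a b c d'.
by ring.
Qed.

End PullbackConnection.

Section Curvature.
Variables (R : realType) (n : nat) (Y : set 'rV[R]_n) (h : 'rV[R]_n -> 'M[R]_n).
Implicit Types (u v w z : 'rV[R]_n).
Hypotheses (oY : open Y) (Ch : forall k, Ck_on k Y h) (sh : forall y, Y y -> spd (h y)).

Lemma is_derive_inner_nabla (X Z : 'rV[R]_n -> 'rV[R]_n) y v : Ck_on 1 Y X -> Ck_on 1 Y Z -> Y y ->
  is_derive y v (fun y => inner (h y) (X y) (Z y))
    (inner (h y) (nabla h X y v) (Z y) + inner (h y) (X y) (nabla h Z y v)).
Proof.
move=> CX CZ Yy.
have H := @is_derive_pullback_inner R n n Y Y h (fun y => y) oY oY (fun y Hy => Hy) Ch sh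
  (fun k => Ck_on_id k oY) X Z y v CX CZ Yy.
move: H; rewrite /nablaF /nabla.
have [_ ->] := @is_derive_id R 'rV[R]_n y v.
by [].
Qed.

Lemma riemann_nabla y u v w : riemann h y u v w =
  nabla h (fun z => christoffel_form h z v w) y u - nabla h (fun z => christoffel_form h z u w) y v.
Proof.
have L a b : levi_civita h (cst a) (cst b) = (fun z => christoffel_form h z a b).
  by apply/funext => z; rewrite /levi_civita derive_cst add0r.
rewrite /riemann /curvature !L.
have -> : levi_civita h (lie_bracket (cst u) (cst v)) (cst w) y = 0.
  by rewrite /levi_civita /lie_bracket !derive_cst subrr Gam0l addr0.
by rewrite subr0.
Qed.

(** The function <w, z>, with [w] and [z] constant, is differentiated along [u] and [v] in both
    orders. Its second derivatives agree, the mixed products cancel, and what remains is the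
    skew-symmetry. *)
Lemma riemann_skew y u v w z : Y y ->
  inner (h y) (riemann h y u v w) z = - inner (h y) w (riemann h y u v z).
Proof.
move=> Yy; pose N a b := fun x => christoffel_form h x a b.
have CN a b : Ck_on 1 Y (N a b).
  exact: (Ck_on_Gam oY Ch sh oY (fun x Hx => Hx) (Ck_on_id 1 oY) (Ck_on_cst 1 Y a) (Ck_on_cst 1 Y b)).
have nc a b x : nabla h (cst b) x a = N a b x by rewrite /nabla derive_cst add0r.
have D1 a x : Y x -> 'D_a (fun x => inner (h x) w z) x = inner (h x) (N a w x) z + inner (h x) w (N a z x).
  move=> Yx; have [_ E] := is_derive_inner_nabla a (Ck_on_cst 1 Y w) (Ck_on_cst 1 Y z) Yx.
  by apply: (etrans E); rewrite !nc.
have D2 a b : 'D_b ('D_a (fun x => inner (h x) w z)) y =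
   inner (h y) (nabla h (N a w) y b) z + inner (h y) (N a w y) (N b z y)
   + (inner (h y) (N b w y) (N a z y) + inner (h y) w (nabla h (N a z) y b)).
  have [d1 E1] := is_derive_inner_nabla b (CN a w) (Ck_on_cst 1 Y z) Yy.
  have [d2 E2] := is_derive_inner_nabla b (Ck_on_cst 1 Y w) (CN a z) Yy.
  rewrite !nc in E1 E2.
  apply: (etrans _ (etrans (deriveD d1 d2) (f_equal2 (fun s t => s + t) E1 E2))).
  by apply: near_eq_derive; apply: (open_near oY Yy) => x Yx; exact: D1.
have Cphi := Ck_on_inner oY (Ch 2) (Ck_on_cst 2 Y w) (Ck_on_cst 2 Y z).
have S := etrans (esym (D2 v u)) (etrans (derive_dir_sym u v oY Cphi Yy) (D2 u v)).
rewrite !riemann_nabla innerDl innerDr innerNl innerNr -/(N v w) -/(N u w) -/(N v z) -/(N u z).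
move: S; set a := inner _ (nabla _ _ _ _) _; set b := inner _ (N _ _ _) _; set c := inner _ (N _ _ _) _.
set d := inner _ _ (nabla _ _ _ _); set e := inner _ (nabla _ _ _ _) _; set f := inner _ _ (nabla _ _ _ _).
by clearbody a b c d e f; clear; lra.
Qed.

Lemma row_dependent u v : ~~ row_free (col_mx u v) ->
  exists a b : R, a *: u + b *: v = 0 /\ (a != 0) || (b != 0).
Proof.
rewrite -kermx_eq0 => /rowV0Pn[c cK c0].
have := sub_kermxP cK; rewrite -[c]hsubmxK mul_row_col => E.
have sc (A : 'M[R]_(1, 1)) (r : 'rV[R]_n) : A *m r = A 0 0 *: r.
  by rewrite {1}[A]mx11_scalar mul_scalar_mx.
rewrite !sc in E; exists (lsubmx c 0 0), (rsubmx c 0 0); split => //.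
apply: contraNT c0; rewrite negb_or !negbK => /andP[/eqP l0 /eqP r0].
by rewrite -[c]hsubmxK (mx11_scalar (lsubmx c)) (mx11_scalar (rsubmx c)) l0 r0 !raddf0 row_mx0.
Qed.

(** Multiplied by <v, v>, the Gram determinant is the squared norm of <v, v> u - <u, v> v, a vector
    that independence prevents from vanishing. *)
Lemma gram_gt0 (Q : 'M[R]_n) u v : spd Q -> row_free (col_mx u v) ->
  0 < inner Q u u * inner Q v v - inner Q u v ^+ 2.
Proof.
move=> sQ rf; have inj (c : 'rV[R]_(1 + 1)) : c *m col_mx u v = 0 -> c = 0.
  by move=> /eqP; rewrite (mulmx_free_eq0 _ rf) => /eqP.
have indep (a b : R) : a *: u + b *: v = 0 -> a = 0.
  move=> E; have := inj (row_mx a%:M b%:M).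
  rewrite mul_row_col !mul_scalar_mx => /(_ E)/(congr1 lsubmx).
  by rewrite row_mxKl => /matrixP/(_ 0 0); rewrite !mxE eqxx.
have v0 : v != 0.
  apply/eqP => v0; have := inj (row_mx 0 1%:M).
  rewrite mul_row_col mul0mx mul1mx v0 addr0 => /(_ erefl)/(congr1 rsubmx).
  by rewrite row_mxKr => /matrixP/(_ 0 0)/eqP; rewrite !mxE eqxx oner_eq0.
have vv : 0 < inner Q v v by exact: sQ.2.
have w0 : inner Q v v *: u - inner Q u v *: v != 0.
  apply/eqP => E; have := indep (inner Q v v) (- inner Q u v); rewrite scaleNr E => /(_ erefl) H.
  by rewrite H ltxx in vv.
have := sQ.2 _ w0; rewrite innerDl !innerDr !innerNl !innerNr !innerZl !innerZr (spd_sym_inner v u sQ).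
move: vv.
set a := inner Q v v; set b := inner Q u v; set c := inner Q u u; clearbody a b c => a0.
by rewrite [ltRHS](_ : _ = a * (c * a - b ^+ 2)); [rewrite pmulr_rgt0|ring].
Qed.

(** For independent vectors, skew-symmetry turns the pairing into minus the sectional curvature
    times the Gram determinant. The hypothesis is silent about dependent vectors; there the skew
    form [K] is evaluated on proportional vectors and vanishes. *)
Lemma curvature_term_ge0 y u v : Y y ->
  (forall u v, row_free (col_mx u v) -> sectional h y u v <= 0) ->
  0 <= inner (h y) (riemann h y u v u) v.
Proof.
move=> Yy sec; have sy := sh Yy.
pose K a b := inner (h y) (riemann h y u v a) b.
have Ks a b : K a b = - K b a.
  by rewrite /K riemann_skew // (spd_sym_inner a _ sy).
have K0 a : K a a = 0 by have := Ks a a; move: (K a a) => k; lra.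
have [rf|/row_dependent[a [b [E ab]]]] := boolP (row_free (col_mx u v)).
  have := sec u v rf; rewrite /sectional pmulr_lle0 ?invr_gt0; last exact: gram_gt0.
  by rewrite -/(K v u) -/(K u v) (Ks u v) oppr_ge0.
suff : K u v = 0 by rewrite /K => ->.
have KZ c r s : K r (c *: s) = c * K r s by exact: innerZr.
case/orP: ab => [a0|b0].
  have -> : u = (- (a^-1 * b)) *: v.
    apply: (scalerI a0); rewrite scalerA mulrN mulrA divff // mul1r scaleNr.
    by apply/eqP; rewrite -addr_eq0 E.
  by rewrite Ks KZ K0 mulr0 oppr0.
have -> : v = (- (b^-1 * a)) *: u.
  apply: (scalerI b0); rewrite scalerA mulrN mulrA divff // mul1r scaleNr.
  by apply/eqP; rewrite -addr_eq0 addrC E.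
by rewrite KZ K0 mulr0.
Qed.

End Curvature.

(** * Orthonormal frames and the Bochner formula *)

Section Frames.
Variables (R : realType) (m : nat) (U : set 'rV[R]_m) (g : 'rV[R]_m -> 'M[R]_m).
Implicit Types (x u v w : 'rV[R]_m).
Hypotheses (oU : open U) (Cg : forall k, Ck_on k U g) (sg : forall x, U x -> spd (g x)).

Lemma Ck_onZ_mx (n : nat) k (r : 'rV[R]_m -> R) (A : 'rV[R]_m -> 'rV[R]_n) :
  Ck_on k U r -> Ck_on k U A -> Ck_on k U (fun x => r x *: A x).
Proof.
move=> Cr CA; apply/Ck_on_mx => // i j.
apply: (@Ck_on_eq _ _ R k U (fun x => r x * A x i j)) => //; first by move=> x _; rewrite mxE.
by apply: Ck_onM => //; exact: (Ck_on_mx k A oU).1 CA i j.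
Qed.

(** The induction keeps the frame triangular: the vector [v x] to be normalized has coordinate 1 at
    index [p], so that it is nonzero at all points of [U] and the frame exists on the whole of
    [U]. *)
Lemma gram_schmidt p : (p <= m)%N -> exists e : nat -> 'rV[R]_m -> 'rV[R]_m,
  [/\ forall i k, (i < p)%N -> Ck_on k U (e i),
      forall i x (j : 'I_m), (i < p)%N -> U x -> (i < j)%N -> e i x 0 j = 0 &
      forall i j x, (i < p)%N -> (j < p)%N -> U x -> inner (g x) (e i x) (e j x) = (i == j)%:R].
Proof.
elim: p => [_|p IH pm]; first by exists (fun _ _ => 0); split.
have [e [Ce te oe]] := IH (ltnW pm); pose o := Ordinal pm.
pose v x := basis_vec R o + \sum_(i < p) (- inner (g x) (basis_vec R o) (e i x)) *: e i x.
have Cv k : Ck_on k U v.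
  apply: Ck_onD => //; first exact: Ck_on_cst.
  apply: Ck_on_sum => // i _; apply: Ck_onZ_mx; last exact: Ce.
  apply: Ck_onN => //; apply: Ck_on_inner => //; [exact: Ck_on_cst|exact: Ce].
have ve x j : U x -> (j < p)%N -> inner (g x) (v x) (e j x) = 0.
  move=> Ux jp; rewrite innerDl inner_suml (bigD1 (Ordinal jp)) //= big1 => [|i ij].
    by rewrite innerZl oe // eqxx mulr1 addr0 subrr.
  by rewrite innerZl oe // (_ : (i == j :> nat) = false) ?mulr0 //; apply/negbTE.
have vt x (j : 'I_m) : U x -> (p <= j)%N -> v x 0 j = (j == o)%:R.
  move=> Ux pj; rewrite mxE summxE big1 ?addr0 ?mxE ?eqxx // => i _.
  by rewrite mxE te ?mulr0 // (leq_trans _ pj).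
have v0 x : U x -> v x != 0.
  by move=> Ux; apply/eqP => /rowP/(_ o)/eqP; rewrite vt // eqxx mxE oner_eq0.
have vv x : U x -> 0 < inner (g x) (v x) (v x) by move=> Ux; exact: (sg Ux).2 (v0 x Ux).
pose s x := (Num.sqrt (inner (g x) (v x) (v x)))^-1.
have Cs k : Ck_on k U s.
  apply: Ck_onV => //; first by move=> x Ux; rewrite sqrtr_eq0 -ltNge; exact: vv.
  by apply: Ck_on_sqrt => //; exact: Ck_on_inner.
have sE x : U x -> s x * (s x * inner (g x) (v x) (v x)) = 1.
  move=> Ux; have vx := vv x Ux; rewrite mulrA -expr2 exprVn sqr_sqrtr ?ltW // mulVf //.
  by rewrite lt0r_neq0.
exists (fun i => if i == p then fun x => s x *: v x else e i); split.
- move=> i k; rewrite ltnS leq_eqVlt; have [_ _|_ /= ip] := eqVneq i p; last exact: Ce.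
  exact: Ck_onZ_mx.
- move=> i x j; rewrite ltnS leq_eqVlt; have [-> _ Ux pj|_ /= ip Ux ij] := eqVneq i p; last exact: te.
  rewrite mxE vt ?(ltnW pj) // (_ : (j == o) = false) ?mulr0 //.
  by apply/negbTE; rewrite -val_eqE /= gtn_eqF.
have lt_p i : (i < p.+1)%N -> i != p -> (i < p)%N by rewrite ltnS leq_eqVlt => /orP[->|].
move=> i j x /lt_p ip /lt_p jp Ux; have [ei|/ip {}ip] := eqVneq i p; have [ej|/jp {}jp] := eqVneq j p.
- by rewrite ei ej eqxx innerZl innerZr sE.
- by rewrite innerZl ve // mulr0 ei gtn_eqF.
- by rewrite innerZr (spd_sym_inner _ _ (sg Ux)) ve // mulr0 ej ltn_eqF.
- exact: oe.
Qed.

Lemma orthonormal_frame_exists : exists e, orthonormal_frame g U e.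
Proof.
have [e [Ce _ oe]] := gram_schmidt (leqnn m); exists (fun i : 'I_m => e i); split.
  by move=> i k; exact: Ce.
by move=> x Ux i j; rewrite oe.
Qed.

Variable e : 'I_m -> 'rV[R]_m -> 'rV[R]_m.
Hypothesis fe : orthonormal_frame g U e.

Let E x : 'M[R]_m := \matrix_(i, j) e i x 0 j.

Let rowE' x i : row i (E x) = e i x.
Proof. by apply/rowP => j; rewrite !mxE. Qed.

Let frame_mx x : U x -> E x *m g x *m (E x)^T = 1%:M.
Proof.
move=> Ux; apply/matrixP => i j; rewrite [RHS]mxE -(fe.2 x Ux i j) -!rowE' !rowE.
by rewrite inner_mulmxl inner_mulmxr inner_basis.
Qed.

Let frame_mx2 x : U x -> g x *m (E x)^T *m E x = 1%:M.
Proof. by move=> Ux; apply: mulmx1C; rewrite mulmxA frame_mx. Qed.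

Lemma frame_expand x w : U x -> w = \sum_i inner (g x) w (e i x) *: e i x.
Proof.
move=> Ux; rewrite -[LHS]mulmx1 -(frame_mx2 Ux) mulmxA mulmx_sum_row.
apply: eq_bigr => i _; rewrite rowE'; congr (_ *: _).
rewrite (row_sum_basis w) inner_suml mulmx_suml summxE; apply: eq_bigr => k _.
rewrite innerZl -scalemxAl mxE -rowE mxE -rowE' rowE inner_mulmxr inner_basis.
by [].
Qed.

Lemma chart_div_frame X x : Ck_on 1 U X -> U x ->
  chart_div g X x = \sum_i inner (g x) (nabla g X x (e i x)) (e i x).
Proof.
move=> CX Ux; rewrite (chart_div_trace oU Cg sg CX Ux).
rewrite -[nabla_mx g X x]mulmx1 -(frame_mx2 Ux) mulmxA mxtrace_mulC.
rewrite /mxtrace; apply: eq_bigr => i _.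
rewrite -(mul_nabla_mx g oU (e i x) CX Ux) -rowE' !rowE -mulmxA inner_mulmxl inner_mulmxr.
by rewrite inner_basis !mulmxA.
Qed.

Lemma sum_sff_frame (n : nat) (h : 'rV[R]_n -> 'M[R]_n) (F : 'rV[R]_m -> 'rV[R]_n) x :
  (forall k, Ck_on k U F) -> U x ->
  tension g h F x = \sum_i sff g h F x (e i x) (e i x).
Proof.
move=> CF Ux; have ug := spd_unitmx (sg Ux).
have -> : tension g h F x = \sum_i \sum_j ((E x)^T *m 1%:M *m E x) i j *:
    sff g h F x (basis_vec R i) (basis_vec R j).
  by rewrite tensionE mulmx1 -[(E x)^T *m E x](mulKmx ug) (mulmxA (g x)) frame_mx2 // mulmx1.
rewrite congruence_sum; apply: eq_bigr => i _.
rewrite [LHS](bigD1 i) //= [X in _ + X]big1 => [|j ji]; last by rewrite [1%:M i j]mxE eq_sym (negbTE ji) scale0r.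
rewrite [1%:M i i]mxE eqxx scale1r addr0 (sff_sum g h oU CF (e i x) (e i x) Ux).
by apply: eq_bigr => k _; apply: eq_bigr => l _; rewrite !mxE.
Qed.

Lemma derive_fun_dir_sum (f : 'rV[R]_m -> R) x (I : Type) (r : seq I) (c : I -> R) (v : I -> 'rV[R]_m) :
  Ck_on 1 U f -> U x ->
  'D_(\sum_(i <- r) c i *: v i) f x = \sum_(i <- r) c i * 'D_(v i) f x.
Proof.
move=> Cf Ux; elim: r => [|i r IH].
  by have := derive_funZ 0 0 oU Cf Ux; rewrite !big_nil scale0r mul0r.
rewrite !big_cons -IH; apply: (etrans (derive_funD _ _ oU Cf Ux)).
by congr (_ + _); exact: derive_funZ oU Cf Ux.
Qed.

Lemma gradient_frame (f : 'rV[R]_m -> R) x : Ck_on 1 U f -> U x ->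
  gradient g f x = \sum_i 'D_(e i x) f x *: e i x.
Proof.
move=> Cf Ux; apply: (inner_inj (sg Ux)) => w.
apply: (etrans (@inner_sharp R m (g x) (fun v => 'D_v f x) w (sg Ux)
  (fun u v => derive_funD u v oU Cf Ux) (fun a v => derive_funZ a v oU Cf Ux))).
rewrite [in LHS](frame_expand w Ux) derive_fun_dir_sum // inner_suml.
by apply: eq_bigr => i _; rewrite innerZl mulrC (spd_sym_inner w _ (sg Ux)).
Qed.

(** Product rule in the term <nabla X, e_i> of the trace. Only the covector remains on the right, so
    that the inverse metric in [X] is never differentiated. *)
Lemma chart_div_dual X (om : 'rV[R]_m -> 'rV[R]_m -> R) x : Ck_on 1 U X ->
  (forall y w, U y -> inner (g y) (X y) w = om y w) -> U x ->
  chart_div g X x = \sum_i ('D_(e i x) (fun y => om y (e i y)) x - om x (levi_civita g (e i) (e i) x)).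
Proof.
move=> CX Xom Ux; rewrite chart_div_frame //; apply: eq_bigr => i _.
have [_ D] := is_derive_inner_nabla oU Cg sg (e i x) CX (fe.1 i 1) Ux.
have D' : 'D_(e i x) (fun y => inner (g y) (X y) (e i y)) x = 'D_(e i x) (fun y => om y (e i y)) x.
  by apply: near_eq_derive; apply: (open_near oU Ux) => y Uy; exact: Xom.
by rewrite -D' -(Xom _ _ Ux) D addrK.
Qed.

End Frames.

Section Bochner.
Variables (R : realType) (m n : nat) (U : set 'rV[R]_m) (Y : set 'rV[R]_n)
  (g : 'rV[R]_m -> 'M[R]_m) (h : 'rV[R]_n -> 'M[R]_n) (F : 'rV[R]_m -> 'rV[R]_n)
  (f : 'rV[R]_m -> R) (e : 'I_m -> 'rV[R]_m -> 'rV[R]_m).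
Hypotheses (oU : open U) (oY : open Y) (UY : forall x, U x -> Y (F x)).
Hypotheses (Cg : forall k, Ck_on k U g) (sg : forall x, U x -> spd (g x)).
Hypotheses (Ch : forall k, Ck_on k Y h) (sh : forall y, Y y -> spd (h y)).
Hypotheses (CF : forall k, Ck_on k U F) (Cf : forall k, Ck_on k U f).
Hypothesis fe : orthonormal_frame g U e.
Implicit Types (x : 'rV[R]_m).

Notation "<< u , v >>_ x" := (inner (h (F x)) u v) (at level 0, x at level 2).

Lemma Ck_on_pullback k X V : Ck_on k U X -> Ck_on k.+1 U V ->
  Ck_on k U (pullback_connection h F X V).
Proof.
move=> CX CV; apply/Ck_on_mx => // i j; apply: (@Ck_on_eq _ _ R k U
  (fun x => 'D_(X x) V x i j + christoffel_form h (F x) ('D_(X x) F x) (V x) i j)) => //.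
  by move=> x _; rewrite [RHS]mxE.
have C1 := Ck_on_derive_along_mx oU CV CX.
have C2 := Ck_on_derive_along_mx oU (CF k.+1) CX.
have C3 := Ck_on_Gam oY Ch sh oU UY (CF k) C2 (Ck_onW CV).
by apply: Ck_onD => //; [exact: (Ck_on_mx k _ oU).1 C1 i j|exact: (Ck_on_mx k _ oU).1 C3 i j].
Qed.

(** For each [i]: [A] pairs the second covariant derivative with the section, [B] the derivative
    along nabla_{e_i} e_i, [K] is the curvature term, [Q] the squared norm of the first derivative,
    and [dp] comes from the derivative of the weight. [S] is the term in the gradient of the
    weight. *)
Let bochner_alg (phi S : R) (dp A B Q K : 'I_m -> R) :
  phi * \sum_i (A i - B i - K i) + S = 0 -> 2 * S = \sum_i dp i ->
  \sum_i (dp i + 2 * phi * (A i + Q i) - phi * (2 * B i)) = 2 * phi * \sum_i (Q i + K i).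
Proof.
move=> E G; rewrite sumrB big_split /= -G -!mulr_sumr !big_split /=.
have {}E : S = - (phi * \sum_i (A i - B i - K i)) by apply/eqP; rewrite -addr_eq0 addrC E.
by rewrite E !sumrB; ring.
Qed.

(** The equation is linear in [V], and nothing ties [V] to the map here. The weight [f] in the field
    is what absorbs the first-order term: the derivative of [f] produces exactly twice the pairing
    of nabla_{grad f} V with [V]. *)
Lemma bochner_energy V X x : (forall k, Ck_on k U V) -> Ck_on 1 U X ->
  (forall y w, U y -> inner (g y) (X y) w = f y * 'D_w (fun y => <<V y, V y>>_y) y) -> U x ->
  - (f x *: jacobi g h F e V x) + pullback_connection h F (gradient g f) V x = 0 ->
  chart_div g X x = 2 * f x * \sum_i (<<nablaF h F V x (e i x), nablaF h F V x (e i x)>>_x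
    + <<riemann h (F x) ('D_(e i x) F x) (V x) ('D_(e i x) F x), V x>>_x).
Proof.
move=> CV CX EX Ux bi; pose P i := pullback_connection h F (e i) V.
have CP i : Ck_on 1 U (P i) by apply: Ck_on_pullback; [exact: fe.1|exact: CV].
have Du y w : U y -> 'D_w (fun y => <<V y, V y>>_y) y = 2 * <<nablaF h F V y w, V y>>_y.
  move=> Uy; have [_ D] := is_derive_pullback_inner oU oY UY Ch sh CF w (CV 1) (CV 1) Uy.
  apply: (etrans D); rewrite (spd_sym_inner (V y) _ (sh (UY Uy))).
  by rewrite mulr2n mulrDl mul1r.
have EX' y w : U y -> inner (g y) (X y) w = f y * (2 * <<nablaF h F V y w, V y>>_y).
  by move=> Uy; rewrite EX // Du.
rewrite (chart_div_dual oU Cg sg fe CX EX' Ux).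
pose A i := <<nablaF h F (P i) x (e i x), V x>>_x.
pose B i := <<nablaF h F V x (levi_civita g (e i) (e i) x), V x>>_x.
pose Q i := <<P i x, P i x>>_x.
pose K i := <<riemann h (F x) ('D_(e i x) F x) (V x) ('D_(e i x) F x), V x>>_x.
pose d i := 'D_(e i x) f x.
have dE i : 'D_(e i x) (fun y => f y * (2 * <<P i y, V y>>_y)) x =
    d i * (2 * <<P i x, V x>>_x) + 2 * f x * (A i + Q i).
  have [d1 E1] := is_derive_pullback_inner oU oY UY Ch sh CF (e i x) (CP i) (CV 1) Ux.
  have df : derivable f x (e i x) by exact: C1_derivable_fun oU (Cf 1) Ux.
  have d2 : derivable (fun y => 2 * <<P i y, V y>>_y) x (e i x).
    exact: (@derivableM _ _ (cst 2) (fun y => <<P i y, V y>>_y) x (e i x) (@derivable_cst _ _ _ _ _ _) d1).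
  apply: (etrans (deriveM df d2)).
  rewrite (@deriveM _ _ (cst 2) (fun y => <<P i y, V y>>_y) x (e i x) (@derivable_cst _ _ _ _ _ _) d1).
  rewrite derive_cst E1 /GRing.scale /= -/(A i) -/(Q i) -/(d i).
  by ring.
have G : 2 * <<nablaF h F V x (gradient g f x), V x>>_x = \sum_i d i * (2 * <<P i x, V x>>_x).
  have Cu : Ck_on 1 U (fun y => <<V y, V y>>_y).
    exact: (Ck_on_inner oU (Ck_on_comp_mx oU oY UY (CF 1) (Ch 1)) (CV 1) (CV 1)).
  apply: (etrans (esym (Du x (gradient g f x) Ux))).
  apply: (etrans (congr1 (fun w => 'D_w (fun y => <<V y, V y>>_y) x) (gradient_frame oU sg fe (Cf 1) Ux))).
  apply: (etrans (derive_fun_dir_sum oU _ _ _ Cu Ux)).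
  by apply: eq_bigr => i _; congr (_ * _); exact: Du.
have inner3 (a b c : 'rV[R]_n) w : inner (h (F x)) (a - b - c) w =
    inner (h (F x)) a w - inner (h (F x)) b w - inner (h (F x)) c w.
  by rewrite !innerDl !innerNl.
have BI : f x * \sum_i (A i - B i - K i) + <<nablaF h F V x (gradient g f x), V x>>_x = 0.
  have := congr1 (fun r => inner (h (F x)) r (V x)) bi.
  rewrite innerDl inner0l innerNl innerZl /jacobi innerNl mulrN opprK inner_suml; apply: etrans.
  congr (_ * _ + _); apply: eq_bigr => i _; symmetry.
  exact: inner3.
transitivity (\sum_i (d i * (2 * <<P i x, V x>>_x) + 2 * f x * (A i + Q i) - f x * (2 * B i))).
  by apply: eq_bigr => i _; rewrite dE.
exact: (@bochner_alg (f x) _ (fun i => d i * (2 * <<P i x, V x>>_x)) A B Q K BI G).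
Qed.

Notation T := (f_tension g h F f).

Lemma nabla_pushforward i x : U x ->
  nablaF h F (pushforward F (e i)) x (e i x) - 'D_(levi_civita g (e i) (e i) x) F x =
  sff g h F x (e i x) (e i x).
Proof.
move=> Ux; have E1 := derive_along_mx (e i x) oU (CF 2) (fe.1 i 1) Ux.
have E2 : 'D_(levi_civita g (e i) (e i) x) F x = _ :=
  derive_dirD ('D_(e i x) (e i) x) (christoffel_form g x (e i x) (e i x)) oU (CF 1) Ux.
have alg (a b c d s t : 'rV[R]_n) : s = a + b -> t = a + d -> s + c - t = b + c - d.
  by move=> -> ->; apply/rowP => j; rewrite !mxE; ring.
exact: (alg _ _ _ _ _ _ E1 E2).
Qed.

Let parallel_alg (phi S : R) (D Q B : 'I_m -> R) :
  S = phi * \sum_i B i + \sum_i D i -> \sum_i (D i + phi * Q i - phi * (Q i - B i)) = S.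
Proof.
move=> ->; rewrite mulr_sumr -big_split /=; apply: eq_bigr => i _; ring.
Qed.

Lemma divergence_parallel X x : Ck_on 1 U T -> Ck_on 1 U X ->
  (forall y w, U y -> inner (g y) (X y) w = f y * <<'D_w F y, T y>>_y) -> U x ->
  (forall i, nablaF h F T x (e i x) = 0) ->
  chart_div g X x = <<T x, T x>>_x.
Proof.
move=> CT CX EX Ux par; rewrite (chart_div_dual oU Cg sg fe CX EX Ux).
pose Z i := pushforward F (e i).
have CZ i : Ck_on 1 U (Z i) := Ck_on_derive_along_mx oU (CF 2) (fe.1 i 1).
pose D i := 'D_(e i x) f x * <<Z i x, T x>>_x.
pose Q i := <<nablaF h F (Z i) x (e i x), T x>>_x.
pose B i := <<sff g h F x (e i x) (e i x), T x>>_x.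
have dE i : 'D_(e i x) (fun y => f y * <<Z i y, T y>>_y) x = D i + f x * Q i.
  have [d1 E1] := is_derive_pullback_inner oU oY UY Ch sh CF (e i x) (CZ i) CT Ux.
  have df : derivable f x (e i x) by exact: C1_derivable_fun oU (Cf 1) Ux.
  apply: (etrans (deriveM df d1)).
  by rewrite E1 par inner0r addr0 /GRing.scale /= addrC; congr (_ + _); exact: mulrC.
have BE i : <<'D_(levi_civita g (e i) (e i) x) F x, T x>>_x = Q i - B i.
  by rewrite /Q /B -(nabla_pushforward i Ux) innerDl innerNl subKr.
have TE : <<T x, T x>>_x = f x * \sum_i B i + \sum_i D i.
  have E : T x = f x *: \sum_i sff g h F x (e i x) (e i x) + \sum_i 'D_(e i x) f x *: Z i x.
    apply: (f_equal2 (fun a b : 'rV[R]_n => a + b)).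
      exact: (congr1 (fun a => f x *: a) (sum_sff_frame oU sg fe h CF Ux)).
    apply: (etrans (congr1 (fun w => 'D_w F x) (gradient_frame oU sg fe (Cf 1) Ux))).
    apply: (etrans (derive_dir_sum _ _ oU (CF 1) Ux)); apply: eq_bigr => i _.
    exact: derive_dirZ oU (CF 1) Ux.
  apply: (etrans (congr1 (fun r => inner (h (F x)) r (T x)) E)).
  rewrite innerDl innerZl !inner_suml; congr (_ + _); apply: eq_bigr => i _.
  exact: innerZl.
apply: (etrans _ (@parallel_alg (f x) _ D Q B TE)); apply: eq_bigr => i _.
exact: (f_equal2 (fun s t => s - f x * t) (dE i) (BE i)).
Qed.

End Bochner.

(** * Proof of the theorem *)

Section Smoothness.
Variables (R : realType) (m n : nat) (U : set 'rV[R]_m) (Y : set 'rV[R]_n)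
  (g : 'rV[R]_m -> 'M[R]_m) (h : 'rV[R]_n -> 'M[R]_n) (F : 'rV[R]_m -> 'rV[R]_n)
  (f : 'rV[R]_m -> R).
Hypotheses (oU : open U) (oY : open Y) (UY : forall x, U x -> Y (F x)).
Hypotheses (Cg : forall k, Ck_on k U g) (sg : forall x, U x -> spd (g x)).
Hypotheses (Ch : forall k, Ck_on k Y h) (sh : forall y, Y y -> spd (h y)).
Hypotheses (CF : forall k, Ck_on k U F) (Cf : forall k, Ck_on k U f).

Lemma Ck_onD_mx (p q : nat) k (A B : 'rV[R]_m -> 'M[R]_(p, q)) :
  Ck_on k U A -> Ck_on k U B -> Ck_on k U (fun x => A x + B x).
Proof.
move=> CA CB; apply/Ck_on_mx => // i j.
apply: (@Ck_on_eq _ _ R k U (fun x => A x i j + B x i j)) => //; first by move=> x _; rewrite mxE.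
by apply: Ck_onD => //; [exact: (Ck_on_mx k A oU).1 CA i j|exact: (Ck_on_mx k B oU).1 CB i j].
Qed.

Lemma Ck_on_sharp k (om : 'rV[R]_m -> 'rV[R]_m -> R) : (forall w, Ck_on k U (fun x => om x w)) ->
  Ck_on k U (fun x => sharp (g x) (om x)).
Proof.
move=> Com; apply/Ck_on_mx => // i j.
have Ci : Ck_on k U (fun x => invmx (g x)) by apply: (Ck_on_invmx oU _ (Cg k)) => x /sg/spd_unitmx.
apply: (@Ck_on_eq _ _ R k U (fun x => \sum_l om x (basis_vec R l) * invmx (g x) l j)) => //.
  by move=> x _; rewrite mxE; apply: eq_bigr => l _; rewrite mxE.
apply: Ck_on_sum => // l _; apply: Ck_onM => //.
exact: (Ck_on_mx k (fun x => invmx (g x)) oU).1 Ci l j.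
Qed.

Lemma Ck_on_gradient k : Ck_on k U (gradient g f).
Proof.
apply: Ck_on_sharp => w.
exact: (Ck_on_derive_along oU (Cf k.+1) (Ck_on_cst k U w)).
Qed.

Lemma Ck_on_sff k u v : Ck_on k U (fun x => sff g h F x u v).
Proof.
have CD l w : Ck_on l U ('D_w F) by exact: Ck_on_derive_dir oU (CF l.+1).
have CG := Ck_on_Gam oU Cg sg oU (fun x Ux => Ux) (Ck_on_id k oU) (Ck_on_cst k U u) (Ck_on_cst k U v).
have C1 := Ck_on_derive_dir u oU (CD k.+1 v).
have C2 := Ck_on_Gam oY Ch sh oU UY (CF k) (CD k u) (CD k v).
have C3 := Ck_on_derive_along_mx oU (CF k.+1) CG.
apply: (@Ck_on_eq _ _ _ k U (fun x => ('D_u ('D_v F) x + christoffel_form h (F x) ('D_u F x) ('D_v F x))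
  + (@cst 'rV[R]_m R (-1) x) *: 'D_(christoffel_form g x u v) F x)) => //.
  by move=> x _; rewrite scaleN1r.
apply: Ck_onD_mx; first exact: (Ck_onD_mx C1 C2).
exact: (@Ck_onZ_mx R m U oU n k (cst (-1)) _ (@Ck_on_cst R m R k U (-1)) C3).
Qed.

Lemma Ck_on_f_tension k : Ck_on k U (f_tension g h F f).
Proof.
have Ci : Ck_on k U (fun x => invmx (g x)) by apply: (Ck_on_invmx oU _ (Cg k)) => x /sg/spd_unitmx.
apply: (@Ck_onD_mx 1 n k (fun x => f x *: tension g h F x) (fun x => 'D_(gradient g f x) F x)); last first.
  exact: Ck_on_derive_along_mx oU (CF k.+1) (Ck_on_gradient k).
apply: (Ck_onZ_mx oU (Cf k)).
apply: (@Ck_on_eq _ _ _ k U (fun x => \sum_i \sum_j invmx (g x) i j *: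
  sff g h F x (basis_vec R i) (basis_vec R j)) _ oU (fun x _ => esym (tensionE g h F x))).
have Cij i j := @Ck_onZ_mx R m U oU n k (fun x => invmx (g x) i j) _
  ((Ck_on_mx k (fun x => invmx (g x)) oU).1 Ci i j) (Ck_on_sff k (basis_vec R i) (basis_vec R j)).
pose S i j := fun x => invmx (g x) i j *: sff g h F x (basis_vec R i) (basis_vec R j).
apply: (@Ck_on_sum R m _ k U _ _ xpredT (fun i x => \sum_j S i j x) oU) => i _.
by apply: (@Ck_on_sum R m _ k U _ _ xpredT (fun j x => S i j x) oU) => j _; exact: Cij.
Qed.

End Smoothness.

(** * The divergence theorem for the dual of a covector field *)

Section CovectorFields.
Variables (R : realType) (m : nat) (M : riemannianManifold R m).
Implicit Types (a b : atlas_index M) (x w : 'rV[R]_m).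

Notation img a := (chart_img (atlas a)).

Variable om : atlas_index M -> 'rV[R]_m -> 'rV[R]_m -> R.
Hypothesis compactM : compact [set: M].
Hypothesis omD : forall a x u v, img a x -> om a x (u + v) = om a x u + om a x v.
Hypothesis omZ : forall a x (r : R) u, img a x -> om a x (r *: u) = r * om a x u.
Hypothesis Com : forall a w, Ck_on 1 (img a) (fun x => om a x w).
Hypothesis om_transition : forall a b x w, overlap a b x ->
  om a x w = om b (transition a b x) ('D_w (transition a b) x).

Definition dual_field a x := sharp (metric a x) (om a x).

Lemma inner_dual_field a x w : img a x -> inner (metric a x) (dual_field a x) w = om a x w.
Proof.
move=> ix; apply: inner_sharp; first exact: metric_spd.
  by move=> u v; exact: omD.
by move=> r u; exact: omZ.
Qed.

Lemma dual_field_Ck a : Ck_on 1 (img a) (dual_field a).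
Proof.
apply: (@Ck_on_sharp R m (img a) (metric a) (@img_open _ _ _ a) (fun k => metric_Ck k a) _ 1 (om a)).
  exact: metric_spd.
exact: Com.
Qed.

Let imgT a b x : overlap a b x -> img b (transition a b x).
Proof. by move=> /transition_overlap/overlap_img. Qed.

Let Cover a b k : Ck_on k (overlap a b) (metric a).
Proof. exact: (Ck_on_subset (@overlap_img _ _ _ a b) (metric_Ck k a)). Qed.

Let sover a b x : overlap a b x -> spd (metric a x).
Proof. by move=> /overlap_img; exact: metric_spd. Qed.

Let dual_transition a b x : overlap a b x ->
  dual_field b (transition a b x) = 'D_(dual_field a x) (transition a b) x.
Proof.
move=> Ox; apply: (@transform_eq R m (overlap a b) (img b) (metric a) (metric b) (transition a b)
  (@overlap_open _ _ _ a b) (@imgT a b) (fun k => transition_Ck k a b) (@sover a b)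
  (@metric_spd _ _ _ b) (fun x u v => @metric_transition _ _ _ a b x u v) x _ _ Ox) => w.
rewrite inner_dual_field; last exact: overlap_img Ox.
exact: (etrans (om_transition w Ox) (esym (inner_dual_field _ (imgT Ox)))).
Qed.

(** The transition laws of the dual field and of its divergence are established here once, from the
    pullback rule [om_transition], for the two forms to which the theorem is applied. *)
Lemma dual_divergence_theorem :
  (forall a x, img a x -> 0 <= chart_div (metric a) (dual_field a) x) ->
  forall a x, img a x -> chart_div (metric a) (dual_field a) x = 0.
Proof.
have div_transition a b x : overlap a b x ->
    chart_div (metric b) (dual_field b) (transition a b x) = chart_div (metric a) (dual_field a) x.
  move=> Ox; exact: (@chart_div_transform R m (overlap a b) (img b) (metric a) (metric b) (transition a b)
    (@overlap_open _ _ _ a b) (@img_open _ _ _ b) (@imgT a b) (fun k => transition_Ck k a b)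
    (@Cover a b) (@sover a b) (fun k => metric_Ck k b)
    (@metric_spd _ _ _ b) (fun x u v => @metric_transition _ _ _ a b x u v)
    (dual_field a) (dual_field b) x (Ck_on_subset (@overlap_img _ _ _ a b) (dual_field_Ck a)) (dual_field_Ck b)
    (@dual_transition a b) Ox).
move=> pos a x ix; have za := cinv_dom ix.
have := divergence_theorem compactM dual_field_Ck dual_transition div_transition _ (chart_inv (atlas a) x).
rewrite (total_divE div_transition za) cinvK //; apply => z.
have [c zc] := atlas_cover z; rewrite (total_divE div_transition zc).
by apply: pos; exact: cmap_img.
Qed.

End CovectorFields.

#[local] Opaque f_tension.

(** * The map and its f-tension field read in charts *)

Section LocalExpressions.
Variables (R : realType) (m n : nat) (M : riemannianManifold R m) (N : riemannianManifold R n)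
  (f : M -> R) (phi : M -> N).
Hypotheses (f_smooth : smooth_function f) (phi_smooth : smooth_map phi).
Implicit Types (a : atlas_index M) (b : atlas_index N) (z : M) (x w : 'rV[R]_m).

Notation dom a := (chart_dom (atlas a)).
Notation cmap a := (chart_map (atlas a)).
Notation cinv a := (chart_inv (atlas a)).
Notation img a := (chart_img (atlas a)).
Notation F a b := (local_map phi a b).
Notation fa a := (f \o cinv a).
Notation T a b := (f_tension (metric a) (metric b) (F a b) (fa a)).

Lemma local_dom_open a b : open (local_dom phi a b).
Proof.
apply: cmap_open_image; apply: open_comp; last exact: chart_dom_open.
by move=> z _; exact: phi_smooth.1.
Qed.

Lemma local_domP a b x : local_dom phi a b x -> img a x /\ dom b (phi (cinv a x)).
Proof. by case=> z [za zb] <-; rewrite cmapK //; split => //; exact: cmap_img. Qed.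

Lemma local_dom_cmap a b z : dom a z -> dom b (phi z) -> local_dom phi a b (cmap a z).
Proof. by move=> za zb; exists z. Qed.

Lemma local_dom_img a b : local_dom phi a b `<=` img a.
Proof. by move=> x /local_domP[]. Qed.

Lemma local_map_img a b x : local_dom phi a b x -> img b (F a b x).
Proof. by move=> /local_domP[_ H]; exact: cmap_img. Qed.

Lemma local_map_Ck a b k : Ck_on k (local_dom phi a b) (F a b).
Proof. exact: phi_smooth.2. Qed.

Lemma local_metric_Ck a b k : Ck_on k (local_dom phi a b) (metric a).
Proof. exact: (Ck_on_subset (@local_dom_img a b) (metric_Ck k a)). Qed.

Lemma local_metric_spd a b x : local_dom phi a b x -> spd (metric a x).
Proof. by move=> /local_dom_img; exact: metric_spd. Qed.

Lemma local_f_Ck a b k : Ck_on k (local_dom phi a b) (fa a).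
Proof. exact: (Ck_on_subset (@local_dom_img a b) (f_smooth a k)). Qed.

Lemma local_tension_Ck a b k : Ck_on k (local_dom phi a b) (T a b).
Proof.
exact: (Ck_on_f_tension (@local_dom_open a b) (@img_open _ _ _ b) (@local_map_img a b)
  (local_metric_Ck a b) (@local_metric_spd a b) (fun k => metric_Ck k b) (@metric_spd _ _ _ b)
  (local_map_Ck a b) (local_f_Ck a b)).
Qed.

Section ChangeOfCharts.
Variables (a a' : atlas_index M) (b b' : atlas_index N).

(** The part of the chart [a] on which all four charts are available, so that the transformation
    laws apply on one open set. *)
Let U : set 'rV[R]_m := cmap a @` (dom a `&` (dom a' `&` phi @^-1` (dom b `&` dom b'))).

Let oU : open U.
Proof.
apply: cmap_open_image; apply: openI; first exact: chart_dom_open.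
apply: open_comp; first by move=> z _; exact: phi_smooth.1.
by apply: openI; exact: chart_dom_open.
Qed.

Let UP x : U x -> [/\ overlap a a' x, local_dom phi a b x, local_dom phi a' b' (transition a a' x),
  overlap b b' (F a b x) &
  F a' b' (transition a a' x) = transition b b' (F a b x) /\ fa a' (transition a a' x) = fa a x].
Proof.
case=> z [za [za' [zb zb']]] <-; rewrite transition_cmap //.
have EF : F a b (cmap a z) = cmap b (phi z) by rewrite /local_map /= cmapK.
rewrite EF transition_cmap //; split; try by exists z.
  exact: overlap_cmap.
by rewrite /local_map /= !cmapK.
Qed.

Let F_cmap z : dom a z -> F a b (cmap a z) = cmap b (phi z).
Proof. by move=> za; rewrite /local_map /= cmapK. Qed.

Let Cth k : Ck_on k U (transition a a').
Proof. by apply: (Ck_on_subset _ (transition_Ck k a a')) => x /UP[]. Qed.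

Let isom x u v : U x -> inner (metric a x) u v =
  inner (metric a' (transition a a' x)) ('D_u (transition a a') x) ('D_v (transition a a') x).
Proof. by move=> /UP[Ox _ _ _ _]; exact: metric_transition. Qed.

Let CFU k : Ck_on k U (F a b).
Proof. by apply: (Ck_on_subset _ (local_map_Ck a b k)) => x /UP[]. Qed.

Let UU' x : U x -> local_dom phi a' b' (transition a a' x). Proof. by case/UP. Qed.
Let UY x : U x -> overlap b b' (F a b x). Proof. by case/UP. Qed.
Let FF x : U x -> F a' b' (transition a a' x) = transition b b' (F a b x). Proof. by case/UP=> _ _ _ _ []. Qed.
Let ff x : U x -> fa a' (transition a a' x) = fa a x. Proof. by case/UP=> _ _ _ _ []. Qed.
Let CgU k : Ck_on k U (metric a).
Proof. by apply: (Ck_on_subset _ (local_metric_Ck a b k)) => x /UP[]. Qed.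
Let sgU x : U x -> spd (metric a x).
Proof. by case/UP => _ H _ _ _; exact: local_metric_spd H. Qed.
Let CfU k : Ck_on k U (fa a).
Proof. by apply: (Ck_on_subset _ (local_f_Ck a b k)) => x /UP[]. Qed.
Let YY' y : overlap b b' y -> img b' (transition b b' y).
Proof. by move=> /transition_overlap/overlap_img. Qed.
Let ChY k : Ck_on k (overlap b b') (metric b).
Proof. exact: (Ck_on_subset (@overlap_img _ _ _ b b') (metric_Ck k b)). Qed.
Let shY y : overlap b b' y -> spd (metric b y).
Proof. by move=> /overlap_img; exact: metric_spd. Qed.

Lemma tension_change z : dom a z -> dom a' z -> dom b (phi z) -> dom b' (phi z) ->
  T a' b' (cmap a' z) = 'D_(T a b (cmap a z)) (transition b b') (cmap b (phi z)).
Proof.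
move=> za za' zb zb'; have Ux : U (cmap a z) by exists z.
have H := f_tension_transform oU (@local_dom_open a' b') UU' Cth CgU sgU (local_metric_Ck a' b')
  (@local_metric_spd a' b') isom (@overlap_open _ _ _ b b') (@img_open _ _ _ b') YY'
  (fun k => transition_Ck k b b') ChY shY (fun k => metric_Ck k b') (@metric_spd _ _ _ b')
  (fun y u v => @metric_transition _ _ _ b b' y u v) UY CFU (local_map_Ck a' b') FF CfU
  (local_f_Ck a' b') ff Ux.
by rewrite (transition_cmap a' za) (F_cmap za) in H.
Qed.

Lemma local_map_change z w : dom a z -> dom a' z -> dom b (phi z) -> dom b' (phi z) ->
  'D_('D_w (transition a a') (cmap a z)) (F a' b') (cmap a' z) =
  'D_('D_w (F a b) (cmap a z)) (transition b b') (cmap b (phi z)).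
Proof.
move=> za za' zb zb'; have Ux : U (cmap a z) by exists z.
have H := derive_map_transform oU (@local_dom_open a' b') UU' Cth (@overlap_open _ _ _ b b')
  (fun k => transition_Ck k b b') UY CFU (local_map_Ck a' b') FF w Ux.
by rewrite (transition_cmap a' za) (F_cmap za) in H.
Qed.

End ChangeOfCharts.

End LocalExpressions.

(** * The two covector fields and the conclusion *)

Section Assembly.
Variables (R : realType) (m n : nat) (M : riemannianManifold R m) (N : riemannianManifold R n)
  (f : M -> R) (phi : M -> N).
Hypotheses (f_smooth : smooth_function f) (phi_smooth : smooth_map phi).
Implicit Types (a : atlas_index M) (b : atlas_index N) (z : M) (x w : 'rV[R]_m).

Notation dom a := (chart_dom (atlas a)).
Notation cmap a := (chart_map (atlas a)).
Notation cinv a := (chart_inv (atlas a)).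
Notation img a := (chart_img (atlas a)).
Notation F a b := (local_map phi a b).
Notation fa a := (f \o cinv a).
Notation T a b := (f_tension (metric a) (metric b) (F a b) (fa a)).

Let local_energy a b x : R := inner (metric b (F a b x)) (T a b x) (T a b x).

Let local_form a b x w : R := f (cinv a x) * inner (metric b (F a b x)) ('D_w (F a b) x) (T a b x).

Let F_cmap a b z : dom a z -> F a b (cmap a z) = cmap b (phi z).
Proof. by move=> za; rewrite /local_map /= cmapK. Qed.

Let local_energy_change a a' b b' z : dom a z -> dom a' z -> dom b (phi z) -> dom b' (phi z) ->
  local_energy a' b' (cmap a' z) = local_energy a b (cmap a z).
Proof.
move=> za za' zb zb'; rewrite /local_energy (tension_change f_smooth phi_smooth za za' zb zb').
rewrite !F_cmap // -(transition_cmap b' zb).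
by symmetry; apply: metric_transition; exact: overlap_cmap.
Qed.

Let local_form_change a a' b b' z w : dom a z -> dom a' z -> dom b (phi z) -> dom b' (phi z) ->
  local_form a' b' (cmap a' z) ('D_w (transition a a') (cmap a z)) = local_form a b (cmap a z) w.
Proof.
move=> za za' zb zb'; rewrite /local_form (tension_change f_smooth phi_smooth za za' zb zb').
rewrite (local_map_change f phi_smooth w za za' zb zb') !F_cmap // !cmapK // -(transition_cmap b' zb).
by congr (_ * _); symmetry; apply: metric_transition; exact: overlap_cmap.
Qed.

Let chart_of (p : nat) (P : smoothManifold R p) (y : P) : atlas_index P := projT1 (cid (atlas_cover y)).

Let chart_ofP (p : nat) (P : smoothManifold R p) (y : P) : chart_dom (atlas (chart_of y)) y.
Proof. exact: projT2 (cid (atlas_cover y)). Qed.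

(** The squared norm of the f-tension field, in charts chosen arbitrarily at each point; by
    [energyE] any other charts give the same value. *)
Definition energy z : R := local_energy (chart_of z) (chart_of (phi z)) (cmap (chart_of z) z).

Lemma energyE a b z : dom a z -> dom b (phi z) -> energy z = local_energy a b (cmap a z).
Proof. by move=> za zb; apply: local_energy_change => //; exact: chart_ofP. Qed.

Lemma energy_local a b x : local_dom phi a b x ->
  (energy \o cinv a) x = inner (metric b (F a b x)) (T a b x) (T a b x).
Proof.
move=> Dx; have [ix zb] := local_domP Dx; have za := cinv_dom ix.
by rewrite /= (energyE za zb) cinvK.
Qed.

Lemma energy_Ck a k : Ck_on k (img a) (energy \o cinv a).
Proof.
apply: Ck_on_local => x ix; have za := cinv_dom ix; pose b := chart_of (phi (cinv a x)).
have oD := @local_dom_open _ _ _ _ _ phi phi_smooth a b.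
exists (local_dom phi a b).
  by split => //; rewrite -(cinvK ix); exact: local_dom_cmap (chart_ofP _).
apply: (@Ck_on_eq _ _ _ k _ (fun y => inner (metric b (F a b y)) (T a b y) (T a b y)) _ oD).
  by move=> y Dy; rewrite (energy_local Dy).
have CT := local_tension_Ck f_smooth phi_smooth a b k.
apply: (Ck_on_inner oD _ CT CT).
exact: (Ck_on_comp_mx oD (@img_open _ _ _ b) (@local_map_img _ _ _ _ _ phi a b)
  (local_map_Ck phi_smooth a b k) (metric_Ck k b)).
Qed.

(** Its dual field is f grad |T|^2. *)
Definition energy_form a x w : R := f (cinv a x) * 'D_w (energy \o cinv a) x.

(** Only the target chart has to be chosen, a form on the source being given chart by chart; by
    [stress_formE] the choice is immaterial. *)
Definition stress_form a x w : R := local_form a (chart_of (phi (cinv a x))) x w.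

Let derive_transition_refl a x w : img a x -> 'D_w (transition a a) x = w.
Proof.
move=> ix; have [_ E] := @is_derive_id R 'rV[R]_m x w; rewrite -[RHS]E.
by apply: near_eq_derive; apply: (open_near (@img_open _ _ _ a) ix) => y; exact: cinvK.
Qed.

Lemma stress_formE a b x w : local_dom phi a b x ->
  stress_form a x w = f (cinv a x) * inner (metric b (F a b x)) ('D_w (F a b) x) (T a b x).
Proof.
move=> Dx; have [ix zb] := local_domP Dx; have za := cinv_dom ix.
have H := local_form_change w za za (chart_ofP (phi (cinv a x))) zb.
(* Only the target chart changes: the transition of the source chart to itself is the identity near
   [x]. *)
rewrite (cinvK ix) (derive_transition_refl w ix) in H.
exact: (esym H).
Qed.

Let local_dom_chart a x : img a x -> local_dom phi a (chart_of (phi (cinv a x))) x.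
Proof.
move=> ix; have := local_dom_cmap (cinv_dom ix) (chart_ofP (phi (cinv a x))).
by rewrite (cinvK ix).
Qed.

Let f_Ck a k : Ck_on k (img a) (fa a). Proof. exact: f_smooth. Qed.

Lemma energy_form_Ck a w : Ck_on 1 (img a) (fun x => energy_form a x w).
Proof.
apply: (@Ck_onM R m 1 (img a) (fa a) _ (@img_open _ _ _ a) (f_Ck a 1)).
exact: (Ck_on_derive_along (@img_open _ _ _ a) (energy_Ck a 2) (Ck_on_cst 1 _ w)).
Qed.

Lemma energy_formD a x u v : img a x -> energy_form a x (u + v) = energy_form a x u + energy_form a x v.
Proof.
by move=> ix; rewrite /energy_form (derive_funD u v (@img_open _ _ _ a) (energy_Ck a 1) ix) mulrDr.
Qed.

Lemma energy_formZ a x (r : R) u : img a x -> energy_form a x (r *: u) = r * energy_form a x u.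
Proof.
by move=> ix; rewrite /energy_form (derive_funZ r u (@img_open _ _ _ a) (energy_Ck a 1) ix) mulrCA.
Qed.

Lemma energy_form_transition a a' x w : overlap a a' x ->
  energy_form a x w = energy_form a' (transition a a' x) ('D_w (transition a a') x).
Proof.
have same y : overlap a a' y -> cinv a' (transition a a' y) = cinv a y.
  by move=> /overlapP[iy ya']; exact: cmapK.
move=> Ox; have dt := C1_derivable (v := w) (@overlap_open _ _ _ a a') (transition_Ck 1 a a') Ox.
have [_ E] := C1_derive_comp (@img_open _ _ _ a') (energy_Ck a' 1) (overlap_img (transition_overlap Ox)) dt.
apply: (f_equal2 (fun s t : R => s * t)); first exact: (congr1 f (esym (same x Ox))).
apply: (etrans _ E); apply: near_eq_derive.
apply: (open_near (@overlap_open _ _ _ a a') Ox) => y Oy.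
exact: (congr1 energy (esym (same y Oy))).
Qed.

Lemma stress_form_Ck a w : Ck_on 1 (img a) (fun x => stress_form a x w).
Proof.
apply: Ck_on_local => x ix; have Dx := local_dom_chart ix.
set b := chart_of _ in Dx; have oD := @local_dom_open _ _ _ _ _ phi phi_smooth a b.
exists (local_dom phi a b) => //.
apply: (@Ck_on_eq _ _ _ 1 _ (fun y => fa a y * inner (metric b (F a b y)) ('D_w (F a b) y) (T a b y)) _ oD).
  by move=> y Dy; rewrite (stress_formE w Dy).
apply: (@Ck_onM R m 1 _ (fa a) _ oD (@local_f_Ck _ _ _ _ _ f phi f_smooth a b 1)).
apply: (Ck_on_inner oD _ _ (local_tension_Ck f_smooth phi_smooth a b 1)).
  exact: (Ck_on_comp_mx oD (@img_open _ _ _ b) (@local_map_img _ _ _ _ _ phi a b)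
    (local_map_Ck phi_smooth a b 1) (metric_Ck 1 b)).
exact: (Ck_on_derive_dir w oD (local_map_Ck phi_smooth a b 2)).
Qed.

Lemma stress_formD a x u v : img a x -> stress_form a x (u + v) = stress_form a x u + stress_form a x v.
Proof.
move=> ix; have Dx := local_dom_chart ix; rewrite !(stress_formE _ Dx).
have oD := @local_dom_open _ _ _ _ _ phi phi_smooth a (chart_of (phi (cinv a x))).
by rewrite (derive_dirD u v oD (local_map_Ck phi_smooth a _ 1) Dx) innerDl mulrDr.
Qed.

Lemma stress_formZ a x (r : R) u : img a x -> stress_form a x (r *: u) = r * stress_form a x u.
Proof.
move=> ix; have Dx := local_dom_chart ix; rewrite !(stress_formE _ Dx).
have oD := @local_dom_open _ _ _ _ _ phi phi_smooth a (chart_of (phi (cinv a x))).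
by rewrite (derive_dirZ r u oD (local_map_Ck phi_smooth a _ 1) Dx) innerZl mulrCA.
Qed.

Lemma stress_form_transition a a' x w : overlap a a' x ->
  stress_form a x w = stress_form a' (transition a a' x) ('D_w (transition a a') x).
Proof.
move=> Ox; have [ix xa'] := overlapP Ox; have xa := cinv_dom ix.
have zb := chart_ofP (phi (cinv a x)); set b := chart_of _ in zb.
have Dx := local_dom_cmap xa zb; have H := local_form_change w xa xa' zb zb.
rewrite (cinvK ix) in Dx H.
have Dx' : local_dom phi a' b (transition a a' x) := local_dom_cmap xa' zb.
exact: (etrans (stress_formE w Dx) (etrans (esym H) (esym (stress_formE _ Dx')))).
Qed.

Hypotheses (compactM : compact [set: M]) (curvN : nonpositive_curvature N).
Hypotheses (f_pos : forall p : M, 0 < f p) (bi : bi_f_harmonic f phi).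

Let energy_field := dual_field energy_form.
Let stress_field := dual_field stress_form.

Let energy_divergence a b x (e : 'I_m -> 'rV[R]_m -> 'rV[R]_m) :
  orthonormal_frame (metric a) (local_dom phi a b) e -> local_dom phi a b x ->
  let V i := nablaF (metric b) (F a b) (T a b) x (e i x) in
  chart_div (metric a) (energy_field a) x = 2 * f (cinv a x) *
    \sum_i (inner (metric b (F a b x)) (V i) (V i)
      + inner (metric b (F a b x)) (riemann (metric b) (F a b x) ('D_(e i x) (F a b) x) (T a b x)
          ('D_(e i x) (F a b) x)) (T a b x)).
Proof.
move=> fe Dx /=; have oD := @local_dom_open _ _ _ _ _ phi phi_smooth a b.
apply: (@bochner_energy R m n (local_dom phi a b) (img b) (metric a) (metric b) (F a b) (fa a) e
  oD (@img_open _ _ _ b) (@local_map_img _ _ _ _ _ phi a b) (local_metric_Ck phi a b)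
  (@local_metric_spd _ _ _ _ _ phi a b) (fun k => metric_Ck k b) (@metric_spd _ _ _ b)
  (local_map_Ck phi_smooth a b) (@local_f_Ck _ _ _ _ _ f phi f_smooth a b) fe (T a b) (energy_field a) x
  (local_tension_Ck f_smooth phi_smooth a b) _ _ Dx).
- apply: (Ck_on_subset (@local_dom_img _ _ _ _ _ phi a b)).
  exact: (dual_field_Ck energy_form_Ck).
- move=> y w Dy; apply: (etrans (inner_dual_field energy_formD energy_formZ w (local_dom_img Dy))).
  apply: (congr1 (fun t : R => f (cinv a y) * t)).
  by apply: near_eq_derive; apply: (open_near oD Dy) => y' Dy'; exact: (energy_local Dy').
- exact: (bi oD (fun _ H => H) fe Dx).
Qed.

Let energy_term_ge0 a b x u (v : 'rV[R]_n) : local_dom phi a b x ->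
  0 <= inner (metric b (F a b x)) v v
    + inner (metric b (F a b x)) (riemann (metric b) (F a b x) u (T a b x) u) (T a b x).
Proof.
move=> Dx; have Yx := local_map_img Dx.
apply: addr_ge0; first exact: spd_ge0 (metric_spd Yx).
apply: (curvature_term_ge0 (@img_open _ _ _ b) (fun k => metric_Ck k b) (@metric_spd _ _ _ b)) => //.
by move=> u' v'; exact: curvN.
Qed.

Let energy_divergence0 a x : img a x -> chart_div (metric a) (energy_field a) x = 0.
Proof.
move: a x; apply: (dual_divergence_theorem compactM energy_formD energy_formZ energy_form_Ck
  energy_form_transition) => a x ix.
have Dx := local_dom_chart ix; set b := chart_of _ in Dx.
have [e fe] := orthonormal_frame_exists (@local_dom_open _ _ _ _ _ phi phi_smooth a b) (local_metric_Ck phi a b)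
  (@local_metric_spd _ _ _ _ _ phi a b).
rewrite (energy_divergence fe Dx); apply: mulr_ge0; first by rewrite mulr_ge0 // ltW.
by apply: sumr_ge0 => i _; exact: energy_term_ge0.
Qed.

(** The factor 2 f is positive and the sum has nonnegative terms, so that each of them vanishes;
    both parts of such a term are nonnegative, hence the squared norm is 0. *)
Let parallel a b x (e : 'I_m -> 'rV[R]_m -> 'rV[R]_m) i :
  orthonormal_frame (metric a) (local_dom phi a b) e -> local_dom phi a b x ->
  nablaF (metric b) (F a b) (T a b) x (e i x) = 0.
Proof.
move=> fe Dx; have := energy_divergence fe Dx; rewrite energy_divergence0; last exact: local_dom_img Dx.
move=> /esym/eqP; rewrite mulf_eq0 mulf_eq0 pnatr_eq0 (gt_eqF (f_pos _)) /=.
rewrite psumr_eq0 => [/allP/(_ i)|j _]; last exact: energy_term_ge0.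
rewrite mem_index_enum => /(_ isT)/eqP H.
have sY := metric_spd (local_map_img Dx).
apply/eqP/negPn/negP => /(sY.2); rewrite lt_neqAle => /andP[+ _]; apply/negP; rewrite negbK.
set V := nablaF _ _ _ _ _ in H *.
(* The zero vector in place of [V] isolates the sign of the curvature part. *)
have := energy_term_ge0 ('D_(e i x) (F a b) x) 0 Dx; rewrite inner0l add0r => K0.
have V0 := spd_ge0 V sY.
by move: H K0 V0; set p := inner _ V V; set q := inner _ _ (T a b x) => H K0 V0; apply/eqP; clearbody p q; lra.
Qed.

Let stress_divergence a b x : local_dom phi a b x ->
  chart_div (metric a) (stress_field a) x = inner (metric b (F a b x)) (T a b x) (T a b x).
Proof.
move=> Dx; have oD := @local_dom_open _ _ _ _ _ phi phi_smooth a b.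
have [e fe] := orthonormal_frame_exists oD (local_metric_Ck phi a b)
  (@local_metric_spd _ _ _ _ _ phi a b).
apply: (@divergence_parallel R m n (local_dom phi a b) (img b) (metric a) (metric b) (F a b) (fa a) e
  oD (@img_open _ _ _ b) (@local_map_img _ _ _ _ _ phi a b) (local_metric_Ck phi a b)
  (@local_metric_spd _ _ _ _ _ phi a b) (fun k => metric_Ck k b) (@metric_spd _ _ _ b)
  (local_map_Ck phi_smooth a b) (@local_f_Ck _ _ _ _ _ f phi f_smooth a b) fe (stress_field a) x
  (local_tension_Ck f_smooth phi_smooth a b 1) _ _ Dx).
- apply: (Ck_on_subset (@local_dom_img _ _ _ _ _ phi a b)).
  exact: (dual_field_Ck stress_form_Ck).
- move=> y w Dy; apply: (etrans (inner_dual_field stress_formD stress_formZ w (local_dom_img Dy))).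
  exact: (stress_formE w Dy).
- by move=> i; exact: (parallel i fe Dx).
Qed.

Lemma bi_f_harmonic_f_harmonic : f_harmonic f phi.
Proof.
move=> a b x Dx; have ix := local_dom_img Dx; have sY := metric_spd (local_map_img Dx).
have : chart_div (metric a) (stress_field a) x = 0.
  apply: (dual_divergence_theorem compactM stress_formD stress_formZ stress_form_Ck
    stress_form_transition) ix => a' x' ix'.
  have Dx' := local_dom_chart ix'; rewrite (stress_divergence Dx').
  exact: spd_ge0 (metric_spd (local_map_img Dx')).
rewrite (stress_divergence Dx) => H; apply/eqP/negPn/negP => /(sY.2).
by rewrite H ltxx.
Qed.

End Assembly.

Theorem theorem1p6 (R : realType) (m n : nat)
    (M : riemannianManifold R m) (N : riemannianManifold R n)
    (f : M -> R) (phi : M -> N)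
    (compactM : compact [set: M])
    (curvN : nonpositive_curvature N)
    (f_smooth : smooth_function f)
    (f_pos : forall p : M, 0 < f p)
    (phi_smooth : smooth_map phi)
    (phi_bi_f_harmonic : bi_f_harmonic f phi) :
  f_harmonic f phi.
Proof. exact: (bi_f_harmonic_f_harmonic f_smooth phi_smooth compactM curvN f_pos phi_bi_f_harmonic). Qed.
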